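(* Let $\mathfrak g\in\{\mathfrak{sl}_\infty(\mathbb C),\mathfrak{so}_\infty(\mathbb C),\mathfrak{sp}_\infty(\mathbb C)\}$ with root system $\Phi\in\{A_\infty,B_\infty,C_\infty,D_\infty\}$ relative to the splitting Cartan subalgebra $\mathfrak h$, let $\prec$ be an admissible linear order (see context), let $\mathfrak n=\bigoplus_{\alpha\in\Phi^+}\mathfrak g^\alpha$ be the corresponding locally nilpotent radical, and let $\mathcal B$ be the Kostant cascade of $\mathfrak n$ (possibly empty, finite or infinite). If $\Phi=A_\infty$ or $C_\infty$, then the center $Z(\mathfrak n)$ of $U(\mathfrak n)$ is generated as an algebra by the elements $\Delta_q$, $1\le q\le|\mathcal B|$; if $\Phi=B_\infty$ or $D_\infty$, then $Z(\mathfrak n)$ is generated by the elements $P_q$, $1\le q\le |\mathcal B|$. These generators are algebraically independent, so $Z(\mathfrak n)$ is a polynomial ring in $|\mathcal B|$ variables (and $Z(\mathfrak n)=\mathbb C$ if $\mathcal B=\emptyset$).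
   Context: Notation: $\mathfrak g=\bigcup_n\mathfrak g_n$ is a union of simple Lie algebras of rank $n$ of one fixed classical type, $\mathfrak h=\bigcup\mathfrak h_n$ a nested union of Cartan subalgebras (splitting Cartan subalgebra), $\mathfrak g=\mathfrak h\oplus\bigoplus_{\alpha\in\Phi}\mathfrak g^\alpha$. The root systems are $A_\infty=\pm\{\epsilon_i-\epsilon_j: i<j\}$, $B_\infty=A_\infty\cup\pm\{\epsilon_i+\epsilon_j:i<j\}\cup\pm\{\epsilon_i\}$, $C_\infty=A_\infty\cup\pm\{\epsilon_i+\epsilon_j:i<j\}\cup\pm\{2\epsilon_i\}$, $D_\infty=A_\infty\cup\pm\{\epsilon_i+\epsilon_j:i<j\}$, indices in $\mathbb Z_{>0}$. Admissible orders: for $A_\infty$, any linear order $\prec$ on $\{\epsilon_i\}$; for $B_\infty,C_\infty$, any linear order on $\{0\}\cup\{\pm\epsilon_i\}$ reversed by multiplication by $-1$; for $D_\infty$, such an order with the extra property that a minimal positive element, if it exists, is some $\epsilon_i$. Put $\vartheta_i=\epsilon_i$ if $\epsilon_i\succ0$ (and always for $A_\infty$) and $\vartheta_i=-\epsilon_i$ if $\epsilon_i\prec0$. Positive roots: $A_\infty^+=\{\vartheta_i-\vartheta_j:\vartheta_i\succ\vartheta_j\}$; $B^+_\infty$, $C^+_\infty$, $D^+_\infty$ consist of $\vartheta_i\pm\vartheta_j$ ($\vartheta_i\succ\vartheta_j$) together with $\vartheta_i$ (for $B$), $2\vartheta_i$ (for $C$), nothing more (for $D$). $\mathfrak n=\bigoplus_{\alpha\in\Phi^+}\mathfrak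 g^\alpha$. Kostant cascade: $\mathcal N_0=\emptyset$ and for $k\ge1$: for $A_\infty$, $\mathcal N_k=\mathcal N_{k-1}\cup\{i,j\}$ if the set $\{\vartheta_s:s\notin\mathcal N_{k-1}\}$ has a maximal element $\vartheta_i$ and a minimal element $\vartheta_j$; for $C_\infty$, $\mathcal N_k=\mathcal N_{k-1}\cup\{i\}$ if $\{\vartheta_s:s\notin\mathcal N_{k-1}\}$ has a maximal element $\vartheta_i$; for $B_\infty,D_\infty$, $\mathcal N_k=\mathcal N_{k-1}\cup\{i,j\}$ if $\{\vartheta_s:s\notin\mathcal N_{k-1}\}$ has a maximal element $\vartheta_i$ and $\{\vartheta_s:s\notin\mathcal N_{k-1}\cup\{i\}\}$ has a maximal element $\vartheta_j$; otherwise $\mathcal N_k=\mathcal N_{k-1}$. Whenever $\mathcal N_{k-1}\subsetneq\mathcal N_k$ set $\beta_k=\vartheta_i-\vartheta_j$ ($A_\infty$, $\vartheta_i\succ\vartheta_j$), $\beta_k=\vartheta_i+\vartheta_j$ ($B_\infty,D_\infty$), $\beta_k=2\vartheta_i$ ($C_\infty$); $\mathcal B$ is the set of all such $\beta_k$. Root vectors: for the finite-dimensional $\mathfrak n_n$ (strictly upper triangular matrices in $\mathfrak{sl}_n$, $\mathfrak{so}_{2n+1}$, $\mathfrak{sp}_{2n}$, $\mathfrak{so}_{2n}$ in the standard realization with basis $e_1,\dots,e_n,(e_0),e_{-n},\dots,e_{-1}$) use $e_{\epsilon_i-\epsilon_j}=E_{ij}$ (type A), $e_{\epsilon_i-\epsilon_j}=E_{ij}-E_{-j,-i}$,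 $e_{\epsilon_i+\epsilon_j}=E_{i,-j}-E_{j,-i}$ (types B, D), $e_{\epsilon_i+\epsilon_j}=E_{i,-j}+E_{j,-i}$, $e_{2\epsilon_i}=E_{i,-i}$ (type C), with $E_{ab}$ elementary matrices. For a finite $M=\{a_1,\dots,a_n\}\subset\mathbb Z_{>0}$ with $\vartheta_{a_1}\succ\dots\succ\vartheta_{a_n}$ let $j_M$ send $\epsilon_r\mapsto\vartheta_{a_r}$ and $\mathfrak n_M=\bigoplus\{\mathfrak g^\alpha:\alpha\in\Phi^+\cap\mathrm{span}(\epsilon_i,i\in M)\}$. Root vectors $f_\alpha\in\mathfrak g^\alpha$ ($\alpha\in\Phi^+$) are fixed so that for every finite $M$ the map $e_\alpha\mapsto f_{j_M(\alpha)}$ is a Lie algebra isomorphism $\mathfrak n_{|M|}\to\mathfrak n_M$. Generators: for $q\le|\mathcal B|$: (A) write $\mathcal N_q=\{i_1,\dots,i_q,j_1,\dots,j_q\}$ with $\vartheta_{i_1}\succ\dots\succ\vartheta_{i_q}\succ\vartheta_{j_q}\succ\dots\succ\vartheta_{j_1}$ and set $\Delta_q=\det\big(f_{\vartheta_{i_r}-\vartheta_{j_{q+1-s}}}\big)_{r,s=1}^q$; (C) write $\mathcal N_q=\{i_1,\dots,i_q\}$, $\vartheta_{i_1}\succ\dots\succ\vartheta_{i_q}$, and $\Delta_q=\det(x_{rs})_{r,s=1}^q$ with $x_{rs}=f_{\vartheta_{i_r}+\vartheta_{i_{q+1-s}}}$ if $r\ne q+1-s$ and $x_{rs}=2f_{2\vartheta_{i_r}}$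 if $r=q+1-s$; (B, D) write $\mathcal N_q=\{a_1,\dots,a_{2q}\}$ with $\vartheta_{a_1}\succ\dots\succ\vartheta_{a_{2q}}$ and let $P_q$ be the Pfaffian of the skew-symmetric $2q\times 2q$ matrix with $(r,s)$ entry $f_{\vartheta_{a_r}+\vartheta_{a_s}}$ for $r<s$ (so the monomial $f_{\vartheta_{a_1}+\vartheta_{a_2}}\cdots f_{\vartheta_{a_{2q-1}}+\vartheta_{a_{2q}}}$ has coefficient $1$). All entries in each of these expressions commute in $U(\mathfrak n)$, so they are well-defined elements of $U(\mathfrak n)$. *)

(* Defs.v *)
From mathcomp Require Import all_boot all_algebra all_fingroup.
From mathcomp Require Import reals.
From mathcomp Require Import complex.
From mathcomp Require Import mpoly.
Set Implicit Arguments. Unset Strict Implicit. Unset Printing Implicit Defensive.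
Import GRing.Theory.
Local Open Scope ring_scope.

Inductive ctype := TA | TB | TC | TD.
Definition ctype_eqb (a b : ctype) : bool :=
  match a, b with TA,TA | TB,TB | TC,TC | TD,TD => true | _,_ => false end.

(* Elements of {0} ∪ {±ε_i}: None = 0, Some (true,i) = ε_i,
   Some (false,i) = -ε_i.  Index i : nat stands for the paper's i+1. *)
Definition sel := option (bool * nat).
Definition eps (i : nat) : sel := Some (true, i).
Definition sneg (x : sel) : sel :=
  match x with None => None | Some (b, i) => Some (~~ b, i) end.

Definition strict_total (P : sel -> Prop) (prec : rel sel) : Prop :=
  (forall x, P x -> ~~ prec x x) /\
  (forall x y z, P x -> P y -> P z -> prec x y -> prec y z -> prec x z) /\
  (forall x y, P x -> P y -> x <> y -> prec x y \/ prec y x).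

(* Admissible orders.  For A_infty only the restriction of prec to the
   ε_i matters. *)
Definition admissible (t : ctype) (prec : rel sel) : Prop :=
  match t with
  | TA => strict_total (fun x => exists i, x = eps i) prec
  | TB | TC => strict_total (fun _ => True) prec /\
               (forall x y, prec x y = prec (sneg y) (sneg x))
  | TD => (strict_total (fun _ => True) prec /\
           (forall x y, prec x y = prec (sneg y) (sneg x))) /\
          (forall x, prec None x ->
             (forall y, prec None y -> y <> x -> prec x y) ->
             exists i, x = eps i)
  end.

Definition theta (t : ctype) (prec : rel sel) (i : nat) : sel :=
  match t with
  | TA => eps i
  | _ => if prec None (eps i) then eps i else sneg (eps i)
  end.

Definition gtth (t : ctype) (prec : rel sel) (i j : nat) : bool :=
  prec (theta t prec j) (theta t prec i).

Section Cascade.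
Variables (t : ctype) (prec : rel sel).

Definition is_max (S : nat -> Prop) (i : nat) : Prop :=
  ~ S i /\ forall s, ~ S s -> s <> i -> gtth t prec i s.
Definition is_min (S : nat -> Prop) (j : nat) : Prop :=
  ~ S j /\ forall s, ~ S s -> s <> j -> gtth t prec s j.

Definition cstep (S : nat -> Prop) : nat -> Prop := fun x =>
  S x \/
  match t with
  | TA => exists i j, is_max S i /\ is_min S j /\ (x = i \/ x = j)
  | TC => exists i, is_max S i /\ x = i
  | TB | TD => exists i j, is_max S i /\
                 is_max (fun s => S s \/ s = i) j /\ (x = i \/ x = j)
  end.

Definition Nset (k : nat) : nat -> Prop := iter k cstep (fun _ => False).

(* N_{k-1} ⊊ N_k, i.e. β_k is defined *)
Definition grows (k : nat) : Prop :=
  exists x, Nset k x /\ ~ Nset k.-1 x.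

(* q <= |B| *)
Definition cascade_ge (q : nat) : Prop :=
  forall k, (0 < k <= q)%N -> grows k.
End Cascade.

Inductive proot :=
  | PM of nat & nat   (* ϑ_i - ϑ_j,  ϑ_i ≻ ϑ_j *)
  | PP of nat & nat   (* ϑ_i + ϑ_j,  ϑ_i ≻ ϑ_j  (B, C, D) *)
  | PS of nat         (* ϑ_i  (B) *)
  | PL of nat.        (* 2ϑ_i (C) *)

Definition valid (t : ctype) (prec : rel sel) (r : proot) : bool :=
  match r with
  | PM i j => gtth t prec i j
  | PP i j => ~~ ctype_eqb t TA && gtth t prec i j
  | PS _ => ctype_eqb t TB
  | PL _ => ctype_eqb t TC
  end.

(* Finitary matrices as finite lists of (coefficient, row, column);
   the basis vector labelled Some(true,i) has weight ϑ_i, Some(false,i)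
   weight -ϑ_i, None weight 0.  For a finite M this is the standard
   realization transported along j_M. *)
Section Mat.
Variable F : fieldType.
Definition fmat := seq (F * sel * sel).
Definition mentry (L : fmat) (x y : sel) : F :=
  \sum_(e <- L) (if (e.1.2 == x) && (e.2 == y) then e.1.1 else 0).
Definition mmul (L1 L2 : fmat) : fmat :=
  flatten [seq [seq (e1.1.1 * e2.1.1, e1.1.2, e2.2) | e2 <- L2 & e1.2 == e2.1.2]
          | e1 <- L1].

Definition P (i : nat) : sel := Some (true, i).
Definition N (i : nat) : sel := Some (false, i).

Definition rmat (t : ctype) (r : proot) : fmat :=
  match r with
  | PM i j => if ctype_eqb t TA then [:: (1, P i, P j)]
              else [:: (1, P i, P j); (-1, N j, N i)]
  | PP i j => if ctype_eqb t TC then [:: (1, P i, N j); (1, P j, N i)]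
              else [:: (1, P i, N j); (-1, P j, N i)]
  | PS i => [:: (1, P i, None); (-1, None, N i)]
  | PL i => [:: (1, P i, N i)]
  end.
End Mat.

(* U(n) presented by generators f_α and relations                       *)
Inductive term (F : Type) :=
  | Tc of F
  | Tg of proot
  | Tadd of term F & term F
  | Tmul of term F & term F.
Arguments Tg {F}.

Section Enveloping.
Variables (F : fieldType) (t : ctype) (prec : rel sel).

Definition tscale (c : F) (a : term F) := Tmul (Tc c) a.
Definition tsum (s : seq (term F)) := foldr (@Tadd F) (Tc 0) s.
Definition tprod (s : seq (term F)) := foldr (@Tmul F) (Tc 1) s.
Definition tpow (a : term F) (n : nat) := iter n (Tmul a) (Tc 1).

(* equality in U(n): the congruence of unital associative F-algebras
   generated by the defining relations of U(n) *)
Inductive equ : term F -> term F -> Prop :=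
  | eq_refl a : equ a a
  | eq_sym a b : equ a b -> equ b a
  | eq_trans a b c : equ a b -> equ b c -> equ a c
  | eq_add a a' b b' : equ a a' -> equ b b' -> equ (Tadd a b) (Tadd a' b')
  | eq_mul a a' b b' : equ a a' -> equ b b' -> equ (Tmul a b) (Tmul a' b')
  | eq_addA a b c : equ (Tadd a (Tadd b c)) (Tadd (Tadd a b) c)
  | eq_addC a b : equ (Tadd a b) (Tadd b a)
  | eq_add0 a : equ (Tadd (Tc 0) a) a
  | eq_addN a : equ (Tadd a (Tmul (Tc (-1)) a)) (Tc 0)
  | eq_mulA a b c : equ (Tmul a (Tmul b c)) (Tmul (Tmul a b) c)
  | eq_mul1l a : equ (Tmul (Tc 1) a) a
  | eq_mul1r a : equ (Tmul a (Tc 1)) a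
  | eq_mulDl a b c : equ (Tmul (Tadd a b) c) (Tadd (Tmul a c) (Tmul b c))
  | eq_mulDr a b c : equ (Tmul a (Tadd b c)) (Tadd (Tmul a b) (Tmul a c))
  | eq_cadd c d : equ (Tc (c + d)) (Tadd (Tc c) (Tc d))
  | eq_cmul c d : equ (Tc (c * d)) (Tmul (Tc c) (Tc d))
  | eq_ccomm c a : equ (Tmul (Tc c) a) (Tmul a (Tc c))
  (* only the f_α with α ∈ Φ^+ are generators *)
  | eq_invalid r : ~~ valid t prec r -> equ (Tg r) (Tc 0)
  (* f_α f_β - f_β f_α = [f_α, f_β] in n *)
  | eq_lie r s (L : seq (F * proot)) :
      valid t prec r -> valid t prec s ->
      all (fun e => valid t prec e.2) L ->
      (forall x y, mentry (mmul (rmat F t r) (rmat F t s)) x y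
                   - mentry (mmul (rmat F t s) (rmat F t r)) x y
                   = \sum_(e <- L) e.1 * mentry (rmat F t e.2) x y) ->
      equ (Tadd (Tmul (Tg r) (Tg s)) (tscale (-1) (Tmul (Tg s) (Tg r))))
          (tsum [seq tscale e.1 (Tg e.2) | e <- L]).

Definition central (z : term F) : Prop :=
  forall u, equ (Tmul z u) (Tmul u z).

Definition ueval (k : nat) (p : {mpoly F[k]}) (g : 'I_k -> term F) : term F :=
  tsum [seq tscale p@_m (tprod [seq tpow (g i) (m i) | i <- enum 'I_k])
       | m <- msupp p].

(* determinant and Pfaffian of matrices with (commuting) entries in U(n) *)
Definition tdet (q : nat) (x : 'I_q -> 'I_q -> term F) : term F :=
  tsum [seq tscale ((-1) ^+ odd_perm s) (tprod [seq x i (s i) | i <- enum 'I_q])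
       | s <- enum [set: 'S_q]].

Lemma ord_dbl_lt (q : nat) (j : 'I_q) : (j.*2 < q.*2)%N.
Proof. by rewrite ltn_double. Qed.
Lemma ord_dbl1_lt (q : nat) (j : 'I_q) : (j.*2.+1 < q.*2)%N.
Proof. by rewrite -doubleS leq_double. Qed.
Definition odbl q (j : 'I_q) : 'I_q.*2 := Ordinal (ord_dbl_lt j).
Definition odbl1 q (j : 'I_q) : 'I_q.*2 := Ordinal (ord_dbl1_lt j).

Definition tpf (q : nat) (x : 'I_q.*2 -> 'I_q.*2 -> term F) : term F :=
  tscale ((2 ^ q * q`!)%:R)^-1
    (tsum [seq tscale ((-1) ^+ odd_perm s)
                 (tprod [seq x (s (odbl i)) (s (odbl1 i)) | i <- enum 'I_q])
          | s <- enum [set: 'S_q.*2]]).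

Definition fplus (i j : nat) : proot :=
  if gtth t prec i j then PP i j else PP j i.

(* a : decreasing enumeration (a 0, ..., a (n-1)) of N_q *)
Definition Delta_A (q : nat) (a : nat -> nat) : term F :=
  tdet (fun r s : 'I_q => Tg (PM (a r) (a (q + s)%N))).
Definition Delta_C (q : nat) (a : nat -> nat) : term F :=
  tdet (fun r s : 'I_q =>
          if (r + s == q.-1)%N then tscale 2 (Tg (PL (a r)))
          else Tg (fplus (a r) (a (q.-1 - s)%N))).
Definition Pf_BD (q : nat) (a : nat -> nat) : term F :=
  tpf (fun r s : 'I_q.*2 =>
         if (r < s)%N then Tg (PP (a r) (a s))
         else if (s < r)%N then tscale (-1) (Tg (PP (a s) (a r)))
         else Tc 0).

Definition dec_listing (n : nat) (S : nat -> Prop) (a : nat -> nat) : Prop :=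
  (forall r s, (r < s < n)%N -> gtth t prec (a r) (a s)) /\
  (forall x, S x <-> exists2 r, (r < n)%N & a r = x).

Definition is_generator (q : nat) (G : term F) : Prop :=
  exists a : nat -> nat,
    match t with
    | TA => dec_listing q.*2 (Nset t prec q) a /\ G = Delta_A q a
    | TC => dec_listing q (Nset t prec q) a /\ G = Delta_C q a
    | TB | TD => dec_listing q.*2 (Nset t prec q) a /\ G = Pf_BD q a
    end.
End Enveloping.

(* Main.v *)
Require Import Defs.
From HB Require Import structures.
From mathcomp Require Import all_boot all_algebra all_fingroup.
From mathcomp Require Import reals.
From mathcomp Require Import complex.
From mathcomp Require Import mpoly.
From mathcomp Require Import boolp functions ring zify.
Import GRing.Theory Num.Theory.
Local Open Scope ring_scope.
Set Implicit Arguments. Unset Strict Implicit. Unset Printing Implicit Defensive.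

(** By PBW the symbol of a central element of degree d is a polynomial on the
    dual of n annihilated by the coadjoint vector fields.  PBW itself is obtained
    from tensor powers of the natural representation, whose matrix coefficients
    read off the symbol.  Only finitely many indices occur in the symbol, so
    bracketing with root vectors that involve a fresh index shows that it depends
    only on the root vectors f_{i-j} (type A) or f_{i+j}, f_{2i} (types B, C, D)
    with i in a finite initial segment (and j in a finite final segment) of the
    order.  These commute, and the symbol is then a polynomial function of a
    rectangular, symmetric or skew-symmetric matrix invariant under unipotent
    row and column operations.  Elimination shows that such a function is
    determined by its restriction to (block) diagonal matrices, and moving along
    a 2x2 (4x4) block shows that the exponents of this restriction decrease, so
    that it is a polynomial in the leading minors (Pfaffians).  Subtracting this
    polynomial lowers the degree. *)

(** A symbol is handled only through its values: a noncommutative polynomial is a list of words,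
    evaluated at valuations of the root vectors. A vanishing coadjoint derivative is integrated
    along explicit polynomial curves, the flows of $f_{\vartheta_x-\vartheta_y}$; this turns
    infinitesimal invariance into invariance under elementary operations. Elimination meets zero
    pivots, but the functions are polynomial on lines, so a pivot may be perturbed. Exponents
    decrease for this reason: $\mathrm{diag}(sd_q,d_{q+1}/s)$ is equivalent to a block with entries
    affine in $s$, so the value is polynomial in $s$ and negative powers cannot occur. For symmetric
    matrices this block contains $\sqrt{-d_qd_{q+1}}$, which is where algebraic closedness enters.
    The surviving root vectors commute, so among them equality in $U(\mathfrak n)$ is equality of
    values; corrections of lower degree come only from discarding the other root vectors. The
    infinite index set supplies the fresh indices and keeps finite initial and final segments
    apart. *)

(** * Polynomial functions over a field of characteristic zero *)

Section PolynomialFunctions.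
Variable F : numFieldType.

(** The numbers 1, 2, ... are distinct in characteristic zero and are too many roots for a nonzero
    polynomial. Leaving out 0 allows later identities to divide by the parameter. *)
Lemma poly_eq0 (p : {poly F}) : (forall x, x != 0 -> p.[x] = 0) -> p = 0.
Proof.
move=> h; apply/eqP/negPn/negP => p0.
pose rs : seq F := [seq (i.+1)%:R | i <- iota 0 (size p)].
have : (size rs < size p)%N.
  apply: max_poly_roots p0 _ _.
    by apply/allP => _ /mapP [i _ ->]; rewrite /root h ?pnatr_eq0.
  rewrite map_inj_uniq ?iota_uniq // => i j /eqP.
  by rewrite eqr_nat => /eqP [].
by rewrite size_map size_iota ltnn.
Qed.

Lemma poly_deriv0 (p : {poly F}) : (forall x, p^`().[x] = 0) -> forall x, p.[x] = p.[0].
Proof.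
move=> h x; have d0 : p^`() = 0 by apply: poly_eq0.
rewrite -[p]polyseqK; suff -> : Poly p = (p`_0)%:P by rewrite !hornerC.
apply/polyP => -[|i]; rewrite polyseqK coefC //=.
have /(congr1 (fun q : {poly F} => q`_i)) := d0; rewrite coef_deriv coef0.
by move/eqP; rewrite mulrn_eq0 /= => /eqP.
Qed.

(** Uniqueness of base-[B] digits, which makes the Kronecker substitution in [mpoly_eq0] injective
    on exponents. *)
Lemma digits_inj B n (a b : nat -> nat) :
  (forall i, i < n -> a i < B)%N -> (forall i, i < n -> b i < B)%N ->
  (\sum_(i < n) a i * B ^ i = \sum_(i < n) b i * B ^ i)%N ->
  forall i, (i < n)%N -> a i = b i.
Proof.
elim: n a b => [|n IH] a b ha hb //.
have recl (f : nat -> nat) : (\sum_(i < n.+1) f i * B ^ i = f 0 + (\sum_(i < n) f i.+1 * B ^ i) * B)%N.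
  rewrite big_ord_recl /= expn0 muln1 big_distrl /=; congr (_ + _)%N.
  by apply: eq_bigr => i _; rewrite /bump /= add1n expnSr mulnA.
have Bp : (0 < B)%N by apply: leq_ltn_trans (ha 0%N isT).
rewrite !recl => e; have e0 : a 0%N = b 0%N.
  have := congr1 (modn^~ B) e; rewrite /= ![(_ 0 + _)%N]addnC !modnMDl.
  by rewrite !modn_small // ?ha ?hb.
case=> [//|i] lt; apply: (IH (a \o succn) (b \o succn)) => //= [j|j|].
- by move=> lt'; apply: (ha j.+1).
- by move=> lt'; apply: (hb j.+1).
- by move: e; rewrite e0 => /addnI/eqP; rewrite eqn_pmul2r // => /eqP.
Qed.

(** Kronecker substitution: with [B] above every exponent, $y_i=x^{B^i}$ sends distinct monomials to
    distinct powers of $x$ and reduces the claim to one variable. For $x\ne0$ all these coordinates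
    are nonzero. *)
Lemma mpoly_eq0 k (p : {mpoly F[k]}) :
  (forall y : 'I_k -> F, (forall i, y i != 0) -> p.@[y] = 0) -> p = 0.
Proof.
move=> h; pose B := (msize p).+1.
pose code (m : 'X_{1..k}) := (\sum_(i < k) m i * B ^ i)%N.
have bnd m (i : 'I_k) : m \in msupp p -> (m i < B)%N.
  move=> /msize_mdeg_lt lt; rewrite ltnS (leq_trans _ (ltnW lt)) //.
  by rewrite mdegE (bigD1 i) //= leq_addr.
have inj m m' : m \in msupp p -> m' \in msupp p -> code m = code m' -> m = m'.
  move=> hm hm' e; apply/mnmP => i.
  pose ex (m : 'X_{1..k}) j := if insub j is Some i then m (i : 'I_k) else 0%N.
  have exE m0 (j : 'I_k) : ex m0 j = m0 j by rewrite /ex valK.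
  have sumE m0 : (\sum_(j < k) ex m0 j * B ^ j)%N = code m0.
    by apply: eq_bigr => j _; rewrite exE.
  rewrite -!exE; apply: (@digits_inj B k) => //= [j lt|j lt|].
  - by rewrite -[j]/(val (Ordinal lt)) exE bnd.
  - by rewrite -[j]/(val (Ordinal lt)) exE bnd.
  - by rewrite !sumE.
pose q := \sum_(m <- msupp p) p@_m *: 'X^(code m).
have q0 : q = 0.
  apply: poly_eq0 => x x0; rewrite -(h (fun i => x ^+ (B ^ i))); last first.
    by move=> i; rewrite expf_neq0.
  rewrite mevalE horner_sum; apply: eq_bigr => m _.
  rewrite hornerZ hornerXn; congr (_ * _); rewrite /code.
  rewrite expr_sum; apply: eq_bigr => i _.
  by rewrite mulnC exprM.
apply/mpolyP => m; rewrite mcoeff0.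
have [hm|] := boolP (m \in msupp p); last by rewrite -mcoeff_eq0 => /eqP.
have := congr1 (fun q : {poly F} => q`_(code m)) q0.
rewrite coef0 coef_sum (bigD1_seq m) ?msupp_uniq //= coefZ coefXn eqxx mulr1.
rewrite big_seq_cond big1 ?addr0 // => m' /andP [hm' ne].
rewrite coefZ coefXn; case: eqP => [e|_]; last by rewrite mulr0.
by rewrite (inj _ _ hm hm' e) eqxx in ne.
Qed.
End PolynomialFunctions.

(** * Restrictions to diagonal matrices and their exponents *)

Section Slices.
Variable F : numFieldType.

(** Under $y_i\mapsto sy_i$, $y_j\mapsto y_j/s$ the monomial [m] is multiplied by $s^{m_i-m_j}$. A
    polynomial in $s$ has no negative powers, so the part of [h] with a given negative $m_i-m_j$
    vanishes at all $y$ and is 0. *)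
Lemma dominant_exponents k (h : {mpoly F[k]}) (i j : 'I_k) : i != j ->
  (forall y : 'I_k -> F, (forall l, y l != 0) -> exists p : {poly F}, forall s, s != 0 ->
     h.@[fun l => if l == i then s * y i else if l == j then y j / s else y l] = p.[s]) ->
  forall m, m \in msupp h -> (m j <= m i)%N.
Proof.
move=> ij hP m0 hm0; rewrite leqNgt; apply/negP => lt0.
(* The offset [n] bounds the exponents and keeps the subtraction in [nat] exact; after
   multiplication by $s^n$ the negative powers are those of index below [n]. *)
pose n := msize h; pose ex (m : 'X_{1..k}) := (n + m i - m j)%N.
have bnd m : m \in msupp h -> (m j <= n)%N.
  move=> /msize_mdeg_lt lt; rewrite (leq_trans _ (ltnW lt)) //.
  by rewrite mdegE (bigD1 j) //= leq_addr.
pose he := \sum_(m <- msupp h | ex m == ex m0) h@_m *: 'X_[m].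
have he0 : he = 0.
  apply: mpoly_eq0 => y y0; have [p hp] := hP y y0.
  pose A : {poly F} := \sum_(m <- msupp h) (h@_m * \prod_l y l ^+ m l) *: 'X^(ex m).
  have AE : A - 'X^n * p = 0.
    apply: poly_eq0 => s s0; rewrite hornerD hornerN hornerM hornerXn -hp //.
    apply/eqP; rewrite subr_eq0; apply/eqP; rewrite mevalE mulr_sumr horner_sum.
    apply: eq_big_seq => m hm; rewrite hornerZ hornerXn [RHS]mulrCA -mulrA; congr (_ * _).
    rewrite [in RHS](bigD1 i) //= [in RHS](bigD1 j) 1?eqtype.eq_sym //= eqxx.
    rewrite [j == i]eqtype.eq_sym (negbTE ij) eqxx.
    rewrite [in LHS](bigD1 i) //= [in LHS](bigD1 j) 1?eqtype.eq_sym //=.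
    set r := \prod_(l | _) _; set r' := \prod_(l | _) _.
    have -> : r = r'.
      by apply: eq_bigr => l /andP [/negbTE -> /negbTE ->].
    rewrite /ex !exprMn exprVn.
    have -> : s ^+ (n + m i - m j) = s ^+ n * s ^+ m i / s ^+ m j.
      rewrite -exprD; apply: (canRL (mulfK _)); first by rewrite expf_neq0.
      by rewrite -exprD subnK // (leq_trans (bnd _ hm)) // leq_addr.
    clearbody r'; move: (s ^+ n) (s ^+ m i) (s ^+ m j)^-1 (y i ^+ m i) (y j ^+ m j) r'.
    by clear; move=> x1 x2 x3 x4 x5 x6; ring.
  rewrite /he (raddf_sum (meval y)) /=.
  have := congr1 (fun q : {poly F} => q`_(ex m0)) AE.
  (* $X^n p$ has no coefficient of index below [n], so only [A] contributes here. *)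
  rewrite coef0 coefB coefXnM (_ : ex m0 < n)%N; last by rewrite /ex; have := bnd _ hm0; lia.
  rewrite subr0 coef_sum => s0; rewrite -[RHS]s0 big_mkcond; apply: eq_bigr => m _.
  rewrite coefZ coefXn [ex m0 == _]eqtype.eq_sym; case: ifP => _; last by rewrite mulr0.
  by rewrite [LHS]mevalZ mevalX mulr1.
have := congr1 (mcoeff m0) he0.
rewrite mcoeff0 /he (raddf_sum (mcoeff m0)) /= big_mkcond (bigD1_seq m0) ?msupp_uniq //= eqxx.
rewrite mcoeffZ mcoeffX eqxx mulr1 big1 ?addr0; last first.
  by move=> m ne; rewrite mcoeffZ mcoeffX (negbTE ne) mulr0; case: ifP.
by move=> c0; rewrite mcoeff_msupp c0 eqxx in hm0.
Qed.

Lemma telescope_prod (d : nat -> F) (a : nat -> nat) k :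
  (forall i, (i < k)%N -> (a i.+1 <= a i)%N) ->
  \prod_(i < k) (\prod_(j < i.+1) d j) ^+ (a i - a i.+1) * (\prod_(j < k) d j) ^+ a k
  = \prod_(i < k) d i ^+ a i.
Proof.
elim: k => [|k IH] h; first by rewrite !big_ord0 expr1n mulr1.
rewrite big_ord_recr /= [RHS]big_ord_recr /= -IH; last by move=> i /ltnW/h.
rewrite -!mulrA; congr (_ * _); rewrite -exprD subnK ?h //.
by rewrite big_ord_recr /= exprMn.
Qed.

(** With decreasing exponents $\prod d_i^{m_i}=\prod_i(d_0\cdots d_i)^{m_i-m_{i+1}}$, where $m_k=0$.
    The constants [c i] are present because a generator restricts to $d_0\cdots d_i$ only up to a
    nonzero factor. *)
Lemma slice_polynomial k (h : {mpoly F[k]}) (c : nat -> F) : (forall i, c i != 0) ->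
  (forall m (i j : 'I_k), m \in msupp h -> val j = i.+1 -> (m j <= m i)%N) ->
  exists Q : {mpoly F[k]}, forall d : nat -> F,
    Q.@[fun i : 'I_k => c i * \prod_(j < i.+1) d j] = h.@[fun i : 'I_k => d i].
Proof.
move=> c0 hdom.
pose ex (m : 'X_{1..k}) j := if insub j is Some i then m (i : 'I_k) else 0%N.
have exE m (j : 'I_k) : ex m j = m j by rewrite /ex valK.
pose mm m := [multinom (ex m i - ex m i.+1)%N | i < k].
exists (\sum_(m <- msupp h) (h@_m * \prod_(i < k) c i ^- mm m i) *: 'X_[mm m]) => d.
rewrite (raddf_sum (meval _)) /= [RHS]mevalE; apply: eq_big_seq => m hm.
rewrite [LHS]mevalZ mevalX -mulrA; congr (_ * _).
rewrite -big_split /= (eq_bigr (fun i : 'I_k =>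
   (\prod_(j < i.+1) d j) ^+ (ex m i - ex m i.+1))); last first.
  move=> i _; rewrite mnmE exprMn mulrA mulVf ?mul1r //.
  by rewrite expf_neq0.
rewrite [RHS](eq_bigr (fun i : 'I_k => d i ^+ ex m i)) => [|i _]; last by rewrite exE.
rewrite -telescope_prod => [|i lt].
  by rewrite (_ : ex m k = 0%N) ?expr0 ?mulr1 // /ex insubF // ltnn.
rewrite -[ex m i]/(ex m (Ordinal lt)) exE {1}/ex; case: insubP => // j _ e.
exact: hdom.
Qed.

(** The numbers $c_id_0\cdots d_i$ take any prescribed nonzero values: let [d] be the quotients of
    consecutive ones, after division by [c]. Then [mpoly_eq0] applies. *)
Lemma slice_independent k (p : {mpoly F[k]}) (c : nat -> F) : (forall i, c i != 0) ->
  (forall d : nat -> F, p.@[fun i : 'I_k => c i * \prod_(j < i.+1) d j] = 0) -> p = 0.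
Proof.
move=> c0 h; apply: mpoly_eq0 => y y0.
pose z i := (if insub i is Some l then y (l : 'I_k) else 1) / c i.
have z0 i : z i != 0.
  by rewrite mulf_neq0 ?invr_eq0 //; case: insubP => [l _ _|_]; rewrite ?oner_eq0.
pose d i := if i is i'.+1 then z i / z i' else z 0%N.
have zE i : \prod_(j < i.+1) d j = z i.
  elim: i => [|i IH]; first by rewrite big_ord1.
  by rewrite big_ord_recr /= IH mulrC divfK.
rewrite -(h d); apply: meval_eq => i.
by rewrite zE /z valK mulrC divfK.
Qed.
End Slices.

(** * Functions of matrices that are invariant under elimination *)

Section Elimination.
Variable F : numClosedFieldType.
(** Matrices are indexed by all of [nat], and locality hypotheses confine a function to a corner;
    this avoids casts between dimensions. *)
Local Notation mat := (nat -> nat -> F).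
Implicit Types (X Y H : mat) (c d : nat -> F).

Definition diagm d : mat := fun i j => if i == j then d i else 0.
Definition rescale q s d : nat -> F :=
  fun l => if l == q then s * d q else if l == q.+1 then d q.+1 / s else d l.
Definition line X H (s : F) : mat := fun i j => X i j + s * H i j.
Definition unitm k : mat := fun i j => ((i == k) && (j == k))%:R.

Definition line_polynomial (f : mat -> F) :=
  forall X H, exists p : {poly F}, forall s, f (line X H s) = p.[s].

(** Removes the zero-pivot obstruction: vanishing for every nonzero perturbation passes to the
    unperturbed matrix. *)
Lemma line_zero f X H : line_polynomial f ->
  (forall s, s != 0 -> f (line X H s) = 0) -> f X = 0.
Proof.
move=> lf h; have [p hp] := lf X H.
have p0 : p = 0 by apply: poly_eq0 => s s0; rewrite -hp h.
have := hp 0; rewrite p0 horner0 => <-; congr f.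
by apply: funext => i; apply: funext => j; rewrite /line mul0r addr0.
Qed.

Section Rectangular.
Variables (p m : nat) (f : mat -> F).
Definition rowop a c X : mat := fun i j => X i j + c i * X a j.
Definition colop a c X : mat := fun i j => X i j + c j * X i a.
Hypothesis floc : forall X Y,
  (forall i j, (i < p)%N -> (j < m)%N -> X i j = Y i j) -> f X = f Y.
Hypothesis frow : forall a c X, (forall i, c i != 0 -> (a < i < p)%N) -> f (rowop a c X) = f X.
Hypothesis fcol : forall a c X, (forall i, c i != 0 -> (a < i < m)%N) -> f (colop a c X) = f X.
Hypothesis flin : line_polynomial f.

Definition rclean k X := forall i j, i != j -> (i < k)%N || (j < k)%N ->
  (i < p)%N -> (j < m)%N -> X i j = 0.

(** A nonzero pivot [X a a] clears its column by row operations and its row by column operations,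
    always from smaller to larger indices as the unipotent groups allow. The induction is on the
    number of pivots still to be treated. *)
Lemma rect_zero : (forall d, f (diagm d) = 0) -> forall X, f X = 0.
Proof.
move=> f0; suff h k X : rclean (minn p m - k) X -> f X = 0.
  by move=> X; apply: (h (minn p m)) => i j; rewrite subnn.
elim: k X => [|k IH] X hX.
  rewrite subn0 in hX; rewrite -(f0 (fun i => X i i)); apply: floc => i j lti ltj.
  rewrite /diagm; case: eqP => [->//|/eqP ne]; apply: hX => //.
  by rewrite !leq_min; move: ne lti ltj; lia.
have [le|lt] := leqP (minn p m) k.
  apply: IH; rewrite (_ : (minn p m - k = minn p m - k.+1)%N) //.
  by apply/eqP; lia.
set a := (minn p m - k.+1)%N in hX; have ea : (minn p m - k = a.+1)%N by rewrite /a; lia.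
have ap : (a < p)%N by rewrite /a; lia.
have am : (a < m)%N by rewrite /a; lia.
rewrite ea in IH.
have main Y : rclean a Y -> Y a a != 0 -> f Y = 0.
  move=> hY y0; pose c i := if (a < i < p)%N then - Y i a / Y a a else 0.
  pose c' j := if (a < j < m)%N then - Y a j / Y a a else 0.
  rewrite -(@frow a c); last by move=> i; rewrite /c; case: ifP => //; rewrite eqxx.
  rewrite -(@fcol a c'); last by move=> i; rewrite /c'; case: ifP => //; rewrite eqxx.
  apply: IH => i j ne lt' lti ltj; rewrite /colop /rowop.
  have ca : c a = 0 by rewrite /c ltnn.
  have [ia|gei] := ltnP i a.
    have ci : c i = 0 by rewrite /c; case: ifP => //; lia.
    rewrite ci (hY i j) // ?ia // (hY i a) // ?ia //; first by ring.
    by rewrite neq_ltn ia.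
  have [ja|gej] := ltnP j a.
    have cj : c' j = 0 by rewrite /c'; case: ifP => //; lia.
    rewrite cj (hY i j) // ?ja ?orbT // (hY a j) // ?ja ?orbT //; first by ring.
    by rewrite neq_ltn ja orbT.
  have [ei|ni] := eqVneq i a.
    rewrite ei ca !mul0r !addr0 /c' ltj andbT.
    have -> : (a < j)%N by move: ne; rewrite ei; lia.
    by rewrite -mulrA mulNr mulVf // mulr1 subrr.
  have ej : j = a by move: lt' ni; lia.
  have c'a : c' a = 0 by rewrite /c' ltnn.
  rewrite ej c'a !mul0r addr0 /c lti andbT.
  have -> : (a < i)%N by lia.
  by rewrite -mulrA mulVf // mulr1 subrr.
have [x0|x0] := eqVneq (X a a) 0; last exact: main.
(* The zero pivot is replaced by [s]. The perturbation is diagonal, so the entries already cleared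
   remain 0. *)
apply: (line_zero (H := unitm a)) => // s s0; apply: main.
  move=> i j ne lt' lti ltj; rewrite /line hX // /unitm.
  by rewrite (_ : _ && _ = false) ?mulr0 ?addr0 //; lia.
by rewrite /line x0 /unitm !eqxx mulr1 add0r.
Qed.

(** The block with rows $(sd_q,\ d_qd_{q+1})$ and $(-1,\ 0)$ has determinant $d_qd_{q+1}$ for every
    [s]; elimination with the pivot $sd_q$ turns it into $\mathrm{diag}(sd_q,d_{q+1}/s)$. Its
    entries are affine in [s], so [f] is a polynomial in [s] there. *)
Lemma rect_dominant q d : (q.+1 < minn p m)%N -> (forall l, d l != 0) ->
  exists pol : {poly F}, forall s, s != 0 -> f (diagm (rescale q s d)) = pol.[s].
Proof.
move=> ltq d0.
pose X : mat := fun i j =>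
  if i == q then if j == q.+1 then d q * d q.+1 else 0
  else if i == q.+1 then if j == q then -1 else 0
  else diagm d i j.
pose H : mat := fun i j => ((i == q) && (j == q))%:R * d q.
have [pol hpol] := flin X H; exists pol => s s0; rewrite -hpol.
pose c i := if i == q.+1 then (s * d q)^-1 else 0.
pose c' i := if i == q.+1 then - (d q.+1 / s) else 0.
rewrite -(@frow q c (line X H s)); last by move=> i; rewrite /c; case: (i =P q.+1) => [->|_]; rewrite ?eqxx //; lia.
rewrite -(@fcol q c' (rowop _ _ _)); last by move=> i; rewrite /c'; case: (i =P q.+1) => [->|_]; rewrite ?eqxx //; lia.
apply: floc => i j _ _; rewrite /colop /rowop /line /X /H /c /c' /diagm /rescale.
have nq : (q == q.+1) = false by lia.
have nq' : (q.+1 == q) = false by lia.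
have dq := d0 q; have dq' := d0 q.+1.
have [->|iq] := eqVneq i q; first rewrite ?eqxx ?nq ?nq' /=.
  have [->|jq] := eqVneq j q; first by rewrite ?eqxx ?nq ?nq' /=; ring.
  by have [ej|jq'] := eqVneq j q.+1; rewrite ?ej ?eqxx ?nq ?nq' /=; field.
have [->|iq'] := eqVneq i q.+1.
  rewrite ?eqxx ?nq ?nq' /=.
  have [->|jq] := eqVneq j q; first by rewrite ?eqxx ?nq ?nq' /=; field; rewrite ?dq ?s0.
  by have [ej|jq'] := eqVneq j q.+1; rewrite ?ej ?eqxx ?nq ?nq' /=; field; rewrite ?dq ?s0.
rewrite /=; have [->|ij] := eqVneq i j.
  by rewrite ?(negbTE iq) ?(negbTE iq') ?eqxx /=; case: ifP => _; ring.
by case: ifP => _; ring.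
Qed.
End Rectangular.

(** The congruence $EXE^{T}$ with $E=1+\sum_i c_iE_{ia}$. *)
Definition cong a c X : mat :=
  fun i j => X i j + c i * X a j + c j * X i a + c i * c j * X a a.
Definition sgnsym (e : F) X := forall i j, X j i = e * X i j.

Lemma cong_sgnsym e a c X : sgnsym e X -> sgnsym e (cong a c X).
Proof.
move=> h i j; rewrite /cong (h i j) (h a j) (h i a).
have := h a a => haa; rewrite {1}haa; ring.
Qed.

Section Symmetric.
Variables (n : nat) (f : mat -> F).
Hypothesis floc : forall X Y,
  (forall i j, (i < n)%N -> (j < n)%N -> X i j = Y i j) -> f X = f Y.
Hypothesis fcong : forall a c X, sgnsym 1 X ->
  (forall i, c i != 0 -> (a < i < n)%N) -> f (cong a c X) = f X.
Hypothesis flin : line_polynomial f.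

Definition sclean k X := forall i j, i != j -> (i < k)%N || (j < k)%N ->
  (i < n)%N -> (j < n)%N -> X i j = 0.

(** As for rectangular matrices, but a single congruence clears a row together with its column.
    Symmetry is carried along because the invariance of [f] is assumed for symmetric matrices. *)
Lemma sym_zero : (forall d, f (diagm d) = 0) -> forall X, sgnsym 1 X -> f X = 0.
Proof.
move=> f0; suff h k X : sgnsym 1 X -> sclean (n - k) X -> f X = 0.
  by move=> X sX; apply: (h n) => // i j; rewrite subnn.
elim: k X => [|k IH] X sX hX.
  rewrite subn0 in hX; rewrite -(f0 (fun i => X i i)); apply: floc => i j lti ltj.
  by rewrite /diagm; case: eqP => [->//|/eqP ne]; apply: hX => //; rewrite lti.
have [le|lt] := leqP n k.
  apply: IH => //; rewrite (_ : (n - k = n - k.+1)%N) //.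
  by apply/eqP; lia.
set a := (n - k.+1)%N in hX; have ea : (n - k = a.+1)%N by rewrite /a; lia.
have an : (a < n)%N by rewrite /a; lia.
rewrite ea in IH.
have main Y : sgnsym 1 Y -> sclean a Y -> Y a a != 0 -> f Y = 0.
  move=> sY hY y0; pose c i := if (a < i < n)%N then - Y i a / Y a a else 0.
  rewrite -(@fcong a c) //; last by move=> i; rewrite /c; case: ifP => //; rewrite eqxx.
  apply: IH; first exact: cong_sgnsym.
  have half i j : i != j -> (i < a.+1)%N -> (i < n)%N -> (j < n)%N -> cong a c Y i j = 0.
    move=> ne lt' lti ltj; rewrite /cong.
    have ci : c i = 0 by rewrite /c; case: ifP => //; lia.
    rewrite ci !mul0r !addr0.
    have [ia|gei] := ltnP i a.
      rewrite (hY i j) // ?ia // (hY i a) // ?ia //; first by ring.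
      by rewrite neq_ltn ia.
    have -> : i = a by lia.
    have [ja|gej] := ltnP j a.
      have cj : c j = 0 by rewrite /c; case: ifP => //; lia.
      rewrite cj mul0r addr0 hY // ?ja ?orbT //.
      by rewrite neq_ltn ja orbT.
    rewrite /c ltj andbT (_ : (a < j)%N); last by lia.
    by rewrite -mulrA mulNr mulVf // mulr1 (sY a j) mul1r subrr.
  move=> i j ne /orP [lt'|lt'] lti ltj; first exact: half.
  by rewrite (cong_sgnsym _ _ sY) half ?mulr0 // eqtype.eq_sym.
have [x0|x0] := eqVneq (X a a) 0; last exact: main.
apply: (line_zero (H := unitm a)) => // s s0; apply: main.
- by move=> i j; rewrite /line /unitm (sX i j) andbC; ring.
- move=> i j ne lt' lti ltj; rewrite /line hX // /unitm.
  by rewrite (_ : _ && _ = false) ?mulr0 ?addr0 //; lia.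
- by rewrite /line x0 /unitm !eqxx mulr1 add0r.
Qed.

(** The symmetric block with rows $(sd_q,\ x)$ and $(x,\ 0)$ must have determinant
    $-x^2=d_qd_{q+1}$; this dictates the square root [x]. *)
Lemma sym_dominant q d : (q.+1 < n)%N -> (forall l, d l != 0) ->
  exists pol : {poly F}, forall s, s != 0 -> f (diagm (rescale q s d)) = pol.[s].
Proof.
move=> ltq d0; pose x := sqrtC (- (d q * d q.+1)).
have xx : x * x = - (d q * d q.+1) by rewrite -expr2 sqrtCK.
pose X : mat := fun i j =>
  if i == q then if j == q.+1 then x else 0
  else if i == q.+1 then if j == q then x else 0
  else diagm d i j.
pose H : mat := fun i j => ((i == q) && (j == q))%:R * d q.
have [pol hpol] := flin X H; exists pol => s s0; rewrite -hpol.
pose c i := if i == q.+1 then - (x / (s * d q)) else 0.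
have nq : (q == q.+1) = false by lia.
have nq' : (q.+1 == q) = false by lia.
have dq := d0 q; have dq' := d0 q.+1.
have sX : sgnsym 1 (line X H s).
  move=> i j; rewrite mul1r /line /H [(j == q) && _]andbC; congr (_ + _).
  rewrite /X /diagm.
  case: (i =P q) => e1; case: (i =P q.+1) => e2; case: (j =P q) => e3;
    case: (j =P q.+1) => e4; try done; try (exfalso; lia);
    rewrite 1?[j == i]eqtype.eq_sym; case: (i =P j) => e5; try (exfalso; lia); by rewrite ?e5.
rewrite -(@fcong q c (line X H s)) //; last by move=> i; rewrite /c; case: (i =P q.+1) => [->|_]; rewrite ?eqxx //; lia.
apply: floc => i j _ _; rewrite /cong /line /X /H /c /diagm /rescale.
have [->|iq] := eqVneq i q; first rewrite ?eqxx ?nq ?nq' /=.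
  have [->|jq] := eqVneq j q; first by rewrite ?eqxx ?nq ?nq' /=; ring.
  by have [ej|jq'] := eqVneq j q.+1; rewrite ?ej ?eqxx ?nq ?nq' /=; field; rewrite ?dq ?s0.
have [->|iq'] := eqVneq i q.+1.
  rewrite ?eqxx ?nq ?nq' /=.
  have [->|jq] := eqVneq j q; first by rewrite ?eqxx ?nq ?nq' /=; field; rewrite ?dq ?s0.
  have [ej|jq'] := eqVneq j q.+1; rewrite ?ej ?eqxx ?nq ?nq' /=; last by ring.
  transitivity (- (x * x) / (s * d q)); first by rewrite xx; field; rewrite ?dq ?s0.
  by field; rewrite ?dq ?s0.
rewrite /=; have [->|ij] := eqVneq i j.
  by rewrite ?(negbTE iq) ?(negbTE iq') ?eqxx /=; case: ifP => _; ring.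
by case: ifP => _; ring.
Qed.
End Symmetric.

(** The involution with orbits $\{2l,2l+1\}$, the index pairs of the 2x2 blocks of a skew-symmetric
    normal form. *)
Definition partner i := if odd i then i.-1 else i.+1.
Definition skewm d : mat := fun i j =>
  if j == partner i then if odd i then - d i./2 else d i./2 else 0.

Section Skew.
Variables (n : nat) (f : mat -> F).
Hypothesis floc : forall X Y,
  (forall i j, (i < n)%N -> (j < n)%N -> X i j = Y i j) -> f X = f Y.
Hypothesis fcong : forall a c X, sgnsym (-1) X ->
  (forall i, c i != 0 -> (a < i < n)%N) -> f (cong a c X) = f X.
Hypothesis flin : line_polynomial f.

Lemma skew_diag X i : sgnsym (-1) X -> X i i = 0.
Proof.
by move=> /(_ i i)/eqP; rewrite mulN1r -addr_eq0 -mulr2n mulrn_eq0 /= => /eqP.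
Qed.

Definition kclean k X := forall i j, j != partner i -> (i < k.*2)%N || (j < k.*2)%N ->
  (i < n)%N -> (j < n)%N -> X i j = 0.

Lemma partner_sym i j : (j == partner i) = (i == partner j).
Proof. by rewrite /partner; case: ifP => oi; case: ifP => oj; lia. Qed.

(** Here a pivot is a 2x2 block. If [Y p0 p1] is nonzero, a congruence from row [p0] clears row
    [p1], and then one from row [p1] clears row [p0]. For odd [n] the last index has no partner, but
    its diagonal entry is 0 by skew symmetry. *)
Lemma skew_zero : (forall d, f (skewm d) = 0) -> forall X, sgnsym (-1) X -> f X = 0.
Proof.
move=> f0; suff h k X : sgnsym (-1) X -> kclean (n./2 - k) X -> f X = 0.
  by move=> X sX; apply: (h n./2) => // i j; rewrite subnn.
elim: k X => [|k IH] X sX hX.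
  rewrite subn0 in hX; rewrite -(f0 (fun l => X l.*2 l.*2.+1)); apply: floc => i j lti ltj.
  rewrite /skewm; case: (j =P partner i) => [->|/eqP ne].
    rewrite /partner; case: ifP => oi.
      have -> : (i./2).*2 = i.-1 by lia.
      have -> : i.-1.+1 = i by lia.
      by rewrite sX mulN1r.
    by have -> : (i./2).*2 = i by lia.
  have [big|small] := leqP (n./2).*2 (minn i j).
    have -> : i = j by lia.
    exact: skew_diag.
  by apply: hX => //; lia.
have [le|lt] := leqP n./2 k.
  apply: IH => //; rewrite (_ : (n./2 - k = n./2 - k.+1)%N) //.
  by apply/eqP; lia.
set a := (n./2 - k.+1)%N in hX; have ea : (n./2 - k = a.+1)%N by rewrite /a; lia.
have an : (a.*2.+1 < n)%N by rewrite /a; lia.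
rewrite ea in IH.
pose p0 := a.*2; pose p1 := a.*2.+1.
have main Y : sgnsym (-1) Y -> kclean a Y -> Y p0 p1 != 0 -> f Y = 0.
  move=> sY hY y0; pose x := Y p0 p1.
  pose c i := if (p1 < i < n)%N then Y p1 i / x else 0.
  pose Z := cong p0 c Y.
  pose c' i := if (p1 < i < n)%N then - Z p0 i / x else 0.
  have sZ : sgnsym (-1) Z by apply: cong_sgnsym.
  have cs i : (i <= p1)%N -> c i = 0 by rewrite /c; case: ifP => //; lia.
  have cs' i : (i <= p1)%N -> c' i = 0 by rewrite /c'; case: ifP => //; lia.
  have Y10 : Y p1 p0 = - x by rewrite sY mulN1r.
  have Zx : Z p0 p1 = x.
    by rewrite /Z /cong !cs //; rewrite /x; ring.
  rewrite -(@fcong p0 c) //; last first.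
    by move=> i; rewrite /c /p0 /p1; case: ifP => //; rewrite ?eqxx //; lia.
  rewrite -(@fcong p1 c' (cong _ _ _)) //; last first.
    by move=> i; rewrite /c'; case: ifP => //; rewrite eqxx.
  rewrite -/Z; apply: IH; first exact: cong_sgnsym.
  have half i j : j != partner i -> (i < a.+1.*2)%N -> (i < n)%N -> (j < n)%N ->
     cong p1 c' Z i j = 0.
    move=> ne lt' lti ltj; have ip : (i <= p1)%N by rewrite /p1; lia.
    rewrite {1}/cong (cs' i) // !mul0r !addr0.
    have ZE j' : Z i j' = Y i j' + c j' * Y i p0.
      by rewrite /Z /cong (cs i) //; ring.
    have [ia|gei] := ltnP i p0.
      have Y0 j' : j' != partner i -> (j' < n)%N -> Y i j' = 0.
        by move=> *; apply: hY => //; rewrite ia.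
      have np : p0 != partner i by rewrite /partner /p0; move: ia; rewrite /p0; case: ifP; lia.
      have np' : p1 != partner i by rewrite /partner /p1; move: ia; rewrite /p0; case: ifP; lia.
      rewrite !ZE (Y0 j) // (Y0 p0) //; last by rewrite /p0; lia.
      by rewrite (Y0 p1) //; ring.
    have [lj|gj] := leqP j p1.
      rewrite cs' // mul0r addr0 ZE cs // mul0r addr0.
      have [ja|gej] := ltnP j p0; first by apply: hY => //; rewrite -/p0 ja orbT.
      have -> : j = i by move: ne; rewrite /partner; move: ip gei lj gej; rewrite /p0 /p1; case: ifP; lia.
      exact: skew_diag.
    have [ei|ni] := eqVneq i p0.
      rewrite ei Zx /c' gj ltj /= -mulrA mulVf // mulr1 subrr //.
    have ei : i = p1 by move: ni ip gei; rewrite /p0 /p1; lia.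
    rewrite ei (skew_diag p1 sZ) mulr0 addr0 -ei ZE ei Y10 /c gj ltj /=.
    by rewrite mulrN divfK // subrr.
  move=> i j ne /orP [lt'|lt'] lti ltj; first exact: half.
  by rewrite (cong_sgnsym _ _ sZ) half ?mulr0 // -partner_sym.
have [x0|x0] := eqVneq (X p0 p1) 0; last exact: main.
(* The perturbation of a vanishing pivot has to be skew-symmetric itself. *)
pose H : mat := fun i j => ((i == p0) && (j == p1))%:R - ((i == p1) && (j == p0))%:R.
apply: (line_zero (H := H)) => // s s0; apply: main.
- by move=> i j; rewrite /line /H (sX i j) [(j == p0) && _]andbC [(j == p1) && _]andbC; ring.
- move=> i j ne lt' lti ltj; rewrite /line hX // /H.
  rewrite (_ : (i == p0) && _ = false); last first.
    by apply/negP => /andP [/eqP e1 /eqP e2]; move: ne; rewrite /partner e1 e2 /p0 /p1; case: ifP; lia.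
  rewrite (_ : (i == p1) && _ = false) ?subrr ?mulr0 ?addr0 //.
  by apply/negP => /andP [/eqP e1 /eqP e2]; move: ne; rewrite /partner e1 e2 /p0 /p1; case: ifP; lia.
- rewrite /line x0 /H !eqxx (_ : (p0 == p1) = false) /= ?subr0 ?mulr1 ?add0r //.
  by rewrite /p0 /p1; lia.
Qed.

Definition wedge u v : mat := fun i j =>
  (i == u)%:R * (j == v)%:R - (i == v)%:R * (j == u)%:R.

Lemma wedge_pair l i j : wedge l.*2 l.*2.+1 i j =
  if j == partner i then if i./2 == l then if odd i then -1 else 1 else 0 else 0.
Proof.
rewrite /wedge -!natrM !mulnb /partner; have [oi|oi] := boolP (odd i).
  have -> : (i == l.*2) && (j == l.*2.+1) = false by lia.
  have -> : (i == l.*2.+1) && (j == l.*2) = (j == i.-1) && (i./2 == l) by lia.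
  rewrite sub0r.
  by case: (j == _); case: (_ == l) => //=; rewrite oppr0.
have -> : (i == l.*2.+1) && (j == l.*2) = false by lia.
have -> : (i == l.*2) && (j == l.*2.+1) = (j == i.+1) && (i./2 == l) by lia.
rewrite subr0.
by case: (j == _); case: (_ == l).
Qed.

(** Deletes the two blocks on which the 4x4 move acts, so that the remainder stays inert under the
    congruences. *)
Definition punch q d l : F := if (l == q) || (l == q.+1) then 0 else d l.

Lemma skewm_split q d i j : skewm d i j = skewm (punch q d) i j
  + d q * wedge q.*2 q.*2.+1 i j + d q.+1 * wedge q.+1.*2 q.+1.*2.+1 i j.
Proof.
rewrite !wedge_pair /skewm /punch; case: (j == _); last by rewrite !mulr0 !addr0.
have [->|n1] := eqVneq i./2 q; last have [->|n2] := eqVneq i./2 q.+1.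
- by rewrite (_ : (q == q.+1) = false) /=; [case: ifP => _; ring|lia].
- by case: ifP => _ /=; ring.
- by case: ifP => _ /=; ring.
Qed.

Lemma skewm_punch q d i j : (i./2 == q) || (i./2 == q.+1) || (j./2 == q) || (j./2 == q.+1) ->
  skewm (punch q d) i j = 0.
Proof.
rewrite /skewm /punch /partner; case: ifP => // /eqP -> h.
rewrite (_ : (i./2 == q) || _); first by case: ifP; rewrite ?oppr0.
by move: h; case: ifP; lia.
Qed.

Lemma wedge_sgnsym u v : sgnsym (-1) (wedge u v).
Proof. by move=> i j; rewrite /wedge; ring. Qed.

Lemma skewm_sgnsym d : sgnsym (-1) (skewm d).
Proof.
move=> i j; rewrite /skewm partner_sym; case: (j =P partner i) => [->|_]; last by rewrite mulr0.
rewrite /partner mulN1r; have [oi|oi] := boolP (odd i).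
  by rewrite (_ : odd i.-1 = false) ?opprK; [congr d; lia|lia].
by rewrite (_ : odd i.+1 = true); [congr (- d _); lia|lia].
Qed.

(** The 4x4 block with entries $sd_q$, $-d_qd_{q+1}$, $1$ at $(a,a+1)$, $(a,a+2)$, $(a+1,a+3)$ has
    Pfaffian $d_qd_{q+1}$ for every [s]. Two congruences with the pivot $y=sd_q$ bring it to the
    blocks $sd_q$ and $d_{q+1}/s$. *)
Lemma skew_dominant q d : (q.+1 < n./2)%N -> (forall l, d l != 0) ->
  exists pol : {poly F}, forall s, s != 0 -> f (skewm (rescale q s d)) = pol.[s].
Proof.
move=> ltq d0; pose a := q.*2; pose x := d q * d q.+1.
pose X : mat := fun i j =>
  skewm (punch q d) i j - x * wedge a a.+2 i j + wedge a.+1 a.+3 i j.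
pose H : mat := fun i j => d q * wedge a a.+1 i j.
have [pol hpol] := flin X H; exists pol => s s0; rewrite -hpol.
pose y := s * d q.
have y0 : y != 0 by rewrite mulf_neq0.
pose c i := (x / y) * (i == a.+2)%:R.
pose c' i := y^-1 * (i == a.+3)%:R.
have sX : sgnsym (-1) (line X H s).
  move=> i j; rewrite /line /X /H skewm_sgnsym (wedge_sgnsym a a.+2 i j).
  by rewrite (wedge_sgnsym a a.+1 i j) (wedge_sgnsym a.+1 a.+3 i j); ring.
rewrite -(@fcong a.+1 c (line X H s)) //; last first.
  by move=> i; rewrite /c; case: (i =P a.+2) => [->|_]; rewrite ?mulr0 ?eqxx // /a; lia.
rewrite -(@fcong a c' (cong _ _ _)); last first.
- by move=> i; rewrite /c'; case: (i =P a.+3) => [->|_]; rewrite ?mulr0 ?eqxx // /a; lia.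
- exact: cong_sgnsym.
apply: floc => i j _ _; rewrite (skewm_split q).
have -> : skewm (punch q (rescale q s d)) = skewm (punch q d).
  apply: funext => i'; apply: funext => j'; rewrite /skewm /punch /rescale.
  by case: (_ == q); case: (_ == q.+1).
have -> : rescale q s d q = y by rewrite /rescale eqxx.
have -> : rescale q s d q.+1 = x / y.
  rewrite /rescale eqxx (_ : (q.+1 == q) = false); last by lia.
  by rewrite /x /y; field; rewrite s0 d0.
have -> : q.+1.*2 = a.+2 by rewrite /a; lia.
rewrite -/a /cong /line /X /H.
have S1 j' : skewm (punch q d) a j' = 0 by apply: skewm_punch; rewrite /a; lia.
have S2 j' : skewm (punch q d) a.+1 j' = 0 by apply: skewm_punch; rewrite /a; lia.
have S3 j' : skewm (punch q d) j' a = 0 by apply: skewm_punch; rewrite /a; lia.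
have S4 j' : skewm (punch q d) j' a.+1 = 0 by apply: skewm_punch; rewrite /a; lia.
rewrite !(S1, S2, S3, S4) /wedge /c /c' !eqxx.
have n1 : (a == a.+1) = false by lia. have n2 : (a == a.+2) = false by lia.
have n3 : (a == a.+3) = false by lia. have n4 : (a.+1 == a) = false by lia.
have n5 : (a.+1 == a.+2) = false by lia. have n6 : (a.+1 == a.+3) = false by lia.
rewrite ?(n1, n2, n3, n4, n5, n6).
have dq := d0 q; rewrite /y  ?mulr1n ?mulr0n ?(mulr0, mul0r, mulr1, mul1r, subr0, sub0r, addr0, add0r, oppr0).
by field; rewrite dq s0.
Qed.
End Skew.
End Elimination.

(** * The enveloping algebra as a quotient ring *)

Definition proot_code (r : proot) : nat * (nat * nat) :=
  match r with
  | PM i j => (0, (i, j)) | PP i j => (1, (i, j))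
  | PS i => (2, (i, 0)) | PL i => (3, (i, 0))
  end%N.
Definition proot_decode (c : nat * (nat * nat)) : proot :=
  match c.1 with
  | 0 => PM c.2.1 c.2.2 | 1 => PP c.2.1 c.2.2 | 2 => PS c.2.1 | _ => PL c.2.1
  end%N.
Lemma proot_codeK : cancel proot_code proot_decode. Proof. by case. Qed.
HB.instance Definition _ := Countable.copy proot (can_type proot_codeK).

Section TermChoice.
Variable F : Type.
(** The coefficients are of an arbitrary type, so equality and choice on terms are classical; the
    quotient construction asks for both. *)
HB.instance Definition _ := gen_eqMixin (term F).
HB.instance Definition _ := gen_choiceMixin (term F).
End TermChoice.

Section Envelope.
Local Open Scope quotient_scope.
Variables (F : fieldType) (t : ctype) (prec : rel sel).
Local Notation equ := (@equ F t prec).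

Definition equb (a b : term F) : bool := `[< equ a b >].
Lemma equb_refl : reflexive equb.
Proof. by move=> a; apply/asboolP; constructor. Qed.
Lemma equb_sym : ssrbool.symmetric equb.
Proof. by move=> a b; apply/asboolP/asboolP => h; apply: Defs.eq_sym. Qed.
Lemma equb_trans : transitive equb.
Proof.
by move=> b a c /asboolP h1 /asboolP h2; apply/asboolP; apply: Defs.eq_trans h1 h2.
Qed.
Canonical equb_equiv := EquivRel equb equb_refl equb_sym equb_trans.

Definition env := {eq_quot equb}.
HB.instance Definition _ := EqQuotient.on env.
HB.instance Definition _ := Choice.on env.

Definition cl (a : term F) : env := \pi_env a.

Lemma clP a b : reflect (equ a b) (cl a == cl b).
Proof. by apply: (iffP eqP) => [/eqmodP/asboolP|h] //; apply/eqmodP/asboolP. Qed.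
Lemma clE a b : equ a b -> cl a = cl b. Proof. by move/clP/eqP. Qed.
Lemma cl_equ a b : cl a = cl b -> equ a b. Proof. by move/eqP/clP. Qed.
Lemma equ_repr a : equ (generic_quotient.repr (cl a)) a.
Proof. by apply/cl_equ; rewrite /cl reprK. Qed.
Lemma env_ind (Q : env -> Prop) : (forall a, Q (cl a)) -> forall x, Q x.
Proof. by move=> h x; rewrite -[x]reprK; apply: h. Qed.

Definition eadd (x y : env) := cl (Tadd (generic_quotient.repr x) (generic_quotient.repr y)).
Definition emul (x y : env) := cl (Tmul (generic_quotient.repr x) (generic_quotient.repr y)).
Definition eopp (x : env) := cl (Tmul (Tc (-1)) (generic_quotient.repr x)).
Definition escale (c : F) (x : env) := cl (Tmul (Tc c) (generic_quotient.repr x)).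

Lemma eaddE a b : eadd (cl a) (cl b) = cl (Tadd a b).
Proof. by apply: clE; apply: eq_add; apply: equ_repr. Qed.
Lemma emulE a b : emul (cl a) (cl b) = cl (Tmul a b).
Proof. by apply: clE; apply: eq_mul; apply: equ_repr. Qed.
Lemma eoppE a : eopp (cl a) = cl (Tmul (Tc (-1)) a).
Proof. by apply: clE; apply: eq_mul (equ_repr _); constructor. Qed.
Lemma escaleE c a : escale c (cl a) = cl (Tmul (Tc c) a).
Proof. by apply: clE; apply: eq_mul (equ_repr _); constructor. Qed.

Lemma eaddA : associative eadd.
Proof.
elim/env_ind=> a; elim/env_ind=> b; elim/env_ind=> c.
by rewrite !eaddE; apply: clE; constructor.
Qed.
Lemma eaddC : commutative eadd.
Proof. by elim/env_ind=> a; elim/env_ind=> b; rewrite !eaddE; apply: clE; constructor. Qed.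
Lemma eadd0 : left_id (cl (Tc 0)) eadd.
Proof. by elim/env_ind=> a; rewrite !eaddE; apply: clE; constructor. Qed.
Lemma eaddN : left_inverse (cl (Tc 0)) eopp eadd.
Proof. by elim/env_ind=> a; rewrite eaddC eoppE eaddE; apply: clE; constructor. Qed.
HB.instance Definition _ := GRing.isZmodule.Build env eaddA eaddC eadd0 eaddN.

Lemma emulA : associative emul.
Proof.
elim/env_ind=> a; elim/env_ind=> b; elim/env_ind=> c.
by rewrite !emulE; apply: clE; constructor.
Qed.
Lemma emul1l : left_id (cl (Tc 1)) emul.
Proof. by elim/env_ind=> a; rewrite !emulE; apply: clE; constructor. Qed.
Lemma emul1r : right_id (cl (Tc 1)) emul.
Proof. by elim/env_ind=> a; rewrite !emulE; apply: clE; constructor. Qed.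
Lemma emulDl : left_distributive emul eadd.
Proof.
elim/env_ind=> a; elim/env_ind=> b; elim/env_ind=> c.
by rewrite !(emulE, eaddE); apply: clE; constructor.
Qed.
Lemma emulDr : right_distributive emul eadd.
Proof.
elim/env_ind=> a; elim/env_ind=> b; elim/env_ind=> c.
by rewrite !(emulE, eaddE); apply: clE; constructor.
Qed.
(** A ring structure that allows $1=0$: nontriviality cannot be read off from a presentation. *)
HB.instance Definition _ :=
  GRing.Zmodule_isPzRing.Build env emulA emul1l emul1r emulDl emulDr.

Lemma cl_add a b : cl (Tadd a b) = cl a + cl b. Proof. by rewrite -eaddE. Qed.
Lemma cl_mul a b : cl (Tmul a b) = cl a * cl b. Proof. by rewrite -emulE. Qed.
Lemma cl0 : cl (Tc 0) = 0. Proof. by []. Qed.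
Lemma cl1 : cl (Tc 1) = 1. Proof. by []. Qed.

Lemma cl_cadd c d : cl (Tc (c + d)) = cl (Tc c) + cl (Tc d).
Proof. by rewrite -cl_add; apply: clE; constructor. Qed.
Lemma cl_cmul c d : cl (Tc (c * d)) = cl (Tc c) * cl (Tc d).
Proof. by rewrite -cl_mul; apply: clE; constructor. Qed.
Lemma cl_ccomm c (x : env) : cl (Tc c) * x = x * cl (Tc c).
Proof. by elim/env_ind: x => a; rewrite -!cl_mul; apply: clE; constructor. Qed.

Lemma escale_mulE c (x : env) : escale c x = cl (Tc c) * x.
Proof. by elim/env_ind: x => a; rewrite escaleE cl_mul. Qed.
Lemma escaleA c d x : escale c (escale d x) = escale (c * d) x.
Proof. by rewrite !escale_mulE cl_cmul mulrA. Qed.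
Lemma escale1 : left_id 1 escale.
Proof. by move=> x; rewrite escale_mulE cl1 mul1r. Qed.
Lemma escaleDr : right_distributive escale +%R.
Proof. by move=> c x y; rewrite !escale_mulE mulrDr. Qed.
Lemma escaleDl (x : env) : {morph escale^~ x : c d / c + d}.
Proof. by move=> c d; rewrite !escale_mulE cl_cadd mulrDl. Qed.
HB.instance Definition _ :=
  GRing.Zmodule_isLmodule.Build F env escaleA escale1 escaleDr escaleDl.

Lemma scale_clE c (x : env) : c *: x = cl (Tc c) * x.
Proof. exact: escale_mulE. Qed.
Lemma cl_const c : cl (Tc c) = c *: (1 : env).
Proof. by rewrite scale_clE mulr1. Qed.
Lemma env_scalerAl c (x y : env) : c *: (x * y) = (c *: x) * y.
Proof. by rewrite !scale_clE mulrA. Qed.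
Lemma env_scalerAr c (x y : env) : c *: (x * y) = x * (c *: y).
Proof. by rewrite !scale_clE !mulrA cl_ccomm. Qed.
Lemma cl_scale c a : cl (tscale c a) = c *: cl a.
Proof. by rewrite cl_mul scale_clE. Qed.
Lemma cl_tsum s : cl (tsum s) = \sum_(a <- s) cl a.
Proof. by elim: s => [|a s IH]; rewrite ?big_nil ?big_cons //= cl_add IH. Qed.

Lemma cl_invalid r : ~~ valid t prec r -> cl (Tg r) = 0.
Proof. by move=> h; rewrite -cl0; apply: clE; constructor. Qed.

Lemma centralP a : central t prec a <-> forall x : env, cl a * x = x * cl a.
Proof.
split=> [h|h u]; first by elim/env_ind=> u; rewrite -!cl_mul; apply: clE.
by apply: cl_equ; rewrite !cl_mul.
Qed.

Definition gen (r : proot) : env := cl (Tg r).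

Lemma commute_gens (z : env) :
  (forall r, valid t prec r -> gen r * z = z * gen r) ->
  forall x : env, z * x = x * z.
Proof.
move=> h; elim/env_ind; elim=> [c|r|a IHa b IHb|a IHa b IHb].
- by rewrite cl_ccomm.
- have [/h //|/cl_invalid ->] := boolP (valid t prec r).
  by rewrite mul0r mulr0.
- by rewrite cl_add mulrDr mulrDl IHa IHb.
- by rewrite cl_mul mulrA IHa -mulrA IHb mulrA.
Qed.
End Envelope.

(** * The order on indices and the brackets of root vectors *)

Record strict_order (gt : rel nat) : Prop := StrictOrder {
  so_irr : forall i, gt i i = false;
  so_trans : forall j i k, gt i j -> gt j k -> gt i k;
  so_total : forall i j, i != j -> gt i j || gt j i }.

Lemma so_asym gt : strict_order gt -> forall i j, gt i j -> gt j i = false.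
Proof.
move=> so i j h; apply/negP => h'.
by move: (so_trans so h h'); rewrite so_irr.
Qed.

Lemma so_neq gt : strict_order gt -> forall i j, gt i j -> i != j.
Proof. by move=> so i j h; apply: contraTneq h => ->; rewrite so_irr. Qed.

(** Passes from the order on $\{0\}\cup\{\pm\epsilon_i\}$ to one on indices. Totality is transported
    by [thI], the injectivity of $i\mapsto\vartheta_i$. *)
Lemma admissible_strict_order t prec :
  admissible t prec -> strict_order (gtth t prec).
Proof.
have thI i j : theta t prec i = theta t prec j -> i = j.
  by rewrite /theta /eps /sneg; case: t => /=; do ?case: ifP => _; case.
move=> adm.
have [Q [irr [tr tot]] HQ] : exists2 Q,
    strict_total Q prec & forall i, Q (theta t prec i).
  case: t adm {thI} => /= [h|[h _]|[h _]|[[h _] _]].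
  - by eexists; [exact: h|move=> i; exists i].
  - by exists (fun _ => True).
  - by exists (fun _ => True).
  - by exists (fun _ => True).
split=> [i|j i k|i j ne]; rewrite /gtth.
- by apply/negbTE/irr.
- by move=> h1 h2; apply: (tr _ (theta t prec j)).
- apply/orP; have [||/thI/eqP|h|h] := tot (theta t prec i) (theta t prec j); auto.
  by rewrite (negbTE ne).
Qed.

Section Bracket.
Variables (F : fieldType) (t : ctype) (prec : rel sel).
Local Notation gt := (gtth t prec).
Hypothesis so : strict_order gt.

(** The sign that distinguishes the symplectic form from the orthogonal ones: $E_{i,-j}+E_{j,-i}$
    against $E_{i,-j}-E_{j,-i}$. *)
Definition csg : F := if ctype_eqb t TC then 1 else -1.

(* The matrix E_{i,-j} + csg E_{j,-i} as a combination of positive root vectors. *)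
Definition fp (i j : nat) : seq (F * proot) :=
  if gt i j then [:: (1, PP i j)]
  else if gt j i then [:: (csg, PP j i)]
  else if ctype_eqb t TC then [:: (2, PL i)] else [::].

Definition lopp (L : seq (F * proot)) := [seq (- e.1, e.2) | e <- L].

(** Table of structure constants. A bracket can be nonzero only if some
    $f_{\vartheta_i-\vartheta_j}$ takes part or both roots are short (type B); other sums of
    positive roots are not roots. *)
Definition br (r s : proot) : seq (F * proot) :=
  match r, s with
  | PM i j, PM k l => (if j == k then [:: (1, PM i l)] else [::])
                      ++ (if l == i then [:: (-1, PM k j)] else [::])
  | PM i j, PP k l => (if j == k then fp i l else [::])
                      ++ (if j == l then fp k i else [::])
  | PM i j, PL k => if j == k then fp i k else [::]
  | PM i j, PS k => if j == k then [:: (1, PS i)] else [::]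
  | PP k l, PM i j => lopp ((if j == k then fp i l else [::])
                      ++ (if j == l then fp k i else [::]))
  | PL k, PM i j => lopp (if j == k then fp i k else [::])
  | PS k, PM i j => lopp (if j == k then [:: (1, PS i)] else [::])
  | PS i, PS j => lopp (fp i j)
  | _, _ => [::]
  end.

Lemma fp_valid i j : ~~ ctype_eqb t TA -> all (fun e => valid t prec e.2) (fp i j).
Proof.
move=> nA; rewrite /fp; case: ifP => [|_] /=; first by rewrite nA => ->.
case: ifP => [|_] /=; first by rewrite nA => ->.
by case: ifP => //= ->.
Qed.

Lemma br_valid r s : valid t prec r -> valid t prec s ->
  all (fun e => valid t prec e.2) (br r s).
Proof.
have ifv (b : bool) L : (b -> all (fun e : F * proot => valid t prec e.2) L) ->
    all (fun e => valid t prec e.2) (if b then L else [::]) by case: b => // ->.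
have nAC : ctype_eqb t TC -> ~~ ctype_eqb t TA by case: t.
have nAB : ctype_eqb t TB -> ~~ ctype_eqb t TA by case: t.
case: r s => [i j|i j|i|i] [k l|k l|k|k] //= vr vs;
  rewrite ?all_map ?all_cat ?fp_valid ?nAB //.
- rewrite !ifv //= => /eqP e; rewrite andbT.
    by apply: (so_trans so vs); rewrite e.
  by apply: (so_trans so vr); rewrite e.
- by case/andP: vs => nA _; rewrite !ifv // => _; rewrite fp_valid.
- by apply: ifv => _ /=; rewrite vs.
- by apply: ifv => _; rewrite fp_valid ?nAC.
- by case/andP: vr => nA _; rewrite !ifv // => _; rewrite fp_valid.
- by rewrite [all _ _]ifv //= vr.
- apply: (@sub_all _ (fun e => valid t prec e.2)) => //.
  by apply: ifv => _; apply: fp_valid; rewrite nAC.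
Qed.

Lemma mentryE (L : fmat F) x y :
  mentry L x y = \sum_(e <- L) e.1.1 * (e.1.2 == x)%:R * (e.2 == y)%:R.
Proof.
apply: eq_bigr => e _; case: (_ == x); case: (_ == y); rewrite ?mulr1 ?mulr0 ?mul0r //.
Qed.

Lemma mentry_mmul (A B : fmat F) x y : mentry (mmul A B) x y =
  \sum_(a <- A) \sum_(b <- B)
     a.1.1 * b.1.1 * (a.1.2 == x)%:R * (a.2 == b.1.2)%:R * (b.2 == y)%:R.
Proof.
rewrite mentryE /mmul big_flatten big_map; apply: eq_bigr => a _.
rewrite big_map big_filter big_mkcond; apply: eq_bigr => b _.
by case: ifP => _ /=; rewrite ?mulr1 ?mulr0 ?mul0r.
Qed.

Definition lentry (L : seq (F * proot)) x y :=
  \sum_(e <- L) e.1 * mentry (rmat F t e.2) x y.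
Lemma lentry_cat L L' x y : lentry (L ++ L') x y = lentry L x y + lentry L' x y.
Proof. by rewrite /lentry big_cat. Qed.
Lemma lentry_opp L x y : lentry (lopp L) x y = - lentry L x y.
Proof.
by rewrite /lentry big_map -sumrN; apply: eq_bigr => e _; rewrite mulNr.
Qed.
Lemma lentry_if (b : bool) L x y :
  lentry (if b then L else [::]) x y = b%:R * lentry L x y.
Proof. by case: b; rewrite ?mul1r // /lentry big_nil mul0r. Qed.
Lemma lentry1 c r x y : lentry [:: (c, r)] x y = c * mentry (rmat F t r) x y.
Proof. by rewrite /lentry big_seq1. Qed.

Lemma lentry_fp i j x y :
  lentry (fp i j) x y = (P i == x)%:R * (N j == y)%:R
      + csg * (P j == x)%:R * (N i == y)%:R.
Proof.
rewrite /fp; case: ifP => [_|g1].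
  by rewrite lentry1 mentryE /rmat /csg; case: ifP => _;
     rewrite !big_cons big_nil /=; ring.
case: ifP => [_|g2].
  by rewrite lentry1 mentryE /rmat /csg; case: ifP => _;
     rewrite !big_cons big_nil /=; ring.
have -> : i = j.
  by apply/eqP; apply/negPn/negP => /(so_total so); rewrite g1 g2.
rewrite /csg; case: ifP => _ /=.
  by rewrite lentry1 mentryE /rmat !big_cons big_nil /=; ring.
by rewrite /lentry big_nil; ring.
Qed.

Lemma eqPP i j : (P i == P j) = (i == j). Proof. by []. Qed.
Lemma eqNN i j : (N i == N j) = (i == j). Proof. by []. Qed.
Lemma eqPN i j : (P i == N j) = false. Proof. by []. Qed.
Lemma eqNP i j : (N i == P j) = false. Proof. by []. Qed.
Lemma eqP0 i : (P i == None) = false. Proof. by []. Qed.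
Lemma eqN0 i : (N i == None) = false. Proof. by []. Qed.
Lemma eq0P i : (None == P i) = false. Proof. by []. Qed.
Lemma eq0N i : (None == N i) = false. Proof. by []. Qed.
Definition eqsel := (eqPP, eqNN, eqPN, eqNP, eqP0, eqN0, eq0P, eq0N).

(** The relations of $U(\mathfrak n)$ are stated by matrix entries, so this comparison of entries is
    what licenses the table [br]. Half of the cases follow by antisymmetry, through [swap]. *)
Lemma br_entry r s x y : valid t prec r -> valid t prec s ->
  mentry (mmul (rmat F t r) (rmat F t s)) x y
  - mentry (mmul (rmat F t s) (rmat F t r)) x y = lentry (br r s) x y.
Proof.
have swap r' s' : br s' r' = lopp (br r' s') ->
   mentry (mmul (rmat F t r') (rmat F t s')) x y
     - mentry (mmul (rmat F t s') (rmat F t r')) x y = lentry (br r' s') x y ->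
   mentry (mmul (rmat F t s') (rmat F t r')) x y
     - mentry (mmul (rmat F t r') (rmat F t s')) x y = lentry (br s' r') x y.
  by move=> -> h; rewrite lentry_opp -h opprB.
have PMPM i j k l : mentry (mmul (rmat F t (PM i j)) (rmat F t (PM k l))) x y
     - mentry (mmul (rmat F t (PM k l)) (rmat F t (PM i j))) x y
     = lentry (br (PM i j) (PM k l)) x y.
  rewrite /= lentry_cat !lentry_if !lentry1 !mentry_mmul /= !mentryE /rmat.
  case: ifP => _; rewrite !big_cons !big_nil /= ?eqsel.
    by case: (j =P k) => [<-|_]; case: (l =P i) => [<-|_]; ring.
  rewrite [i == l]eqtype.eq_sym [k == j]eqtype.eq_sym.
  by case: (j =P k) => [<-|_]; case: (l =P i) => [<-|_]; ring.
have nA : ctype_eqb t TA = false ->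
    forall i j, rmat F t (PM i j) = [:: (1, P i, P j); (-1, N j, N i)].
  by rewrite /rmat => ->.
have PPE k l : rmat F t (PP k l) = [:: (1, P k, N l); (csg, P l, N k)].
  by rewrite /rmat /csg; case: ifP.
have PMPP i j k l : ~~ ctype_eqb t TA ->
     mentry (mmul (rmat F t (PM i j)) (rmat F t (PP k l))) x y
     - mentry (mmul (rmat F t (PP k l)) (rmat F t (PM i j))) x y
     = lentry (br (PM i j) (PP k l)) x y.
  move/negbTE/nA => E; rewrite /br lentry_cat !lentry_if !lentry_fp.
  rewrite !mentry_mmul E PPE !big_cons !big_nil /= ?eqsel.
  rewrite [l == j]eqtype.eq_sym [k == j]eqtype.eq_sym /csg.
  by case: (j =P k) => [<-|_]; case: (j =P l) => [<-|_]; case: ifP => _; ring.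
have PMPL i j k : ctype_eqb t TC ->
     mentry (mmul (rmat F t (PM i j)) (rmat F t (PL k))) x y
     - mentry (mmul (rmat F t (PL k)) (rmat F t (PM i j))) x y
     = lentry (br (PM i j) (PL k)) x y.
  move=> tC; have /nA E : ctype_eqb t TA = false by case: t tC.
  rewrite /br lentry_if lentry_fp.
  rewrite !mentry_mmul E /= !big_cons !big_nil /= ?eqsel.
  rewrite [k == j]eqtype.eq_sym /csg tC.
  by case: (j =P k) => [<-|_]; ring.
have PMPS i j k : ctype_eqb t TB ->
     mentry (mmul (rmat F t (PM i j)) (rmat F t (PS k))) x y
     - mentry (mmul (rmat F t (PS k)) (rmat F t (PM i j))) x y
     = lentry (br (PM i j) (PS k)) x y.
  move=> tB; have /nA E : ctype_eqb t TA = false by case: t tB.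
  rewrite /br lentry_if lentry1.
  rewrite !mentry_mmul mentryE E /= !big_cons !big_nil /= ?eqsel.
  rewrite [k == j]eqtype.eq_sym.
  by case: (j =P k) => [<-|_]; ring.
have nAC : ctype_eqb t TC -> ~~ ctype_eqb t TA by case: t.
have oppK L : lopp (lopp L) = L.
  by rewrite /lopp -map_comp map_id_in // => -[c u] _ /=; rewrite opprK.
case: r s => [i j|i j|i|i] [k l|k l|k|k] vr vs.
- exact: PMPM.
- by apply: PMPP; case/andP: vs.
- exact: PMPS.
- exact: PMPL.
- by apply: swap; rewrite /= ?oppK //; apply: PMPP; case/andP: vr.
- by rewrite !mentry_mmul !PPE !big_cons !big_nil /= ?eqsel /lentry big_nil; ring.
- by rewrite !mentry_mmul !PPE !big_cons !big_nil /= ?eqsel /lentry big_nil; ring.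
- by rewrite !mentry_mmul !PPE !big_cons !big_nil /= ?eqsel /lentry big_nil; ring.
- by apply: swap; rewrite /= ?oppK //; apply: PMPS.
- by rewrite !mentry_mmul !PPE !big_cons !big_nil /= ?eqsel /lentry big_nil; ring.
- rewrite /br lentry_opp lentry_fp !mentry_mmul !big_cons !big_nil /= ?eqsel /csg.
  by have -> : ctype_eqb t TC = false; [case: t vr|ring].
- by case: t vr vs.
- by apply: swap; rewrite /= ?oppK //; apply: PMPL.
- by rewrite !mentry_mmul !PPE !big_cons !big_nil /= ?eqsel /lentry big_nil; ring.
- by case: t vr vs.
- by rewrite !mentry_mmul !big_cons !big_nil /= ?eqsel /lentry big_nil; ring.
Qed.

Lemma gen_br r s : valid t prec r -> valid t prec s ->
  gen F t prec r * gen F t prec s - gen F t prec s * gen F t prec r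
  = \sum_(e <- br r s) e.1 *: gen F t prec e.2.
Proof.
move=> vr vs; rewrite /gen -!cl_mul -scaleN1r -cl_scale -cl_add.
rewrite (clE (eq_lie vr vs (br_valid vr vs) _)).
  by rewrite cl_tsum big_map; apply: eq_bigr => e _; rewrite cl_scale.
by move=> x y; rewrite br_entry.
Qed.
End Bracket.

(* Noncommutative polynomials in the root vectors, and their values at a
   valuation of the root vectors in a commutative ring. *)
Notation ncpoly F := (seq (F * seq proot)).

(** * Values and derivatives of noncommutative polynomials *)

Section Evaluation.
Variable F : fieldType.
Implicit Types T : ncpoly F.

Definition evw (A : comNzRingType) (v : proot -> A) (w : seq proot) : A :=
  \prod_(r <- w) v r.
(** The target ring is left free: besides [F] it will be a polynomial ring in a curve parameter or
    in the slice coordinates. *)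
Definition ev (A : comNzRingType) (iota : F -> A) (v : proot -> A) T : A :=
  \sum_(e <- T) iota e.1 * evw v e.2.

Definition nscale (c : F) T : ncpoly F := [seq (c * e.1, e.2) | e <- T].
Definition nmul T T' : ncpoly F := [seq (a.1 * b.1, a.2 ++ b.2) | a <- T, b <- T'].
Definition nletters (Q : pred proot) T := all (fun e => all Q e.2) T.
Definition ncomp (d : nat) T := [seq e <- T | size e.2 == d].

(** The directional derivative at [v] along [h], by the Leibniz rule. *)
Fixpoint derw (v h : proot -> F) (w : seq proot) : F :=
  if w is r :: w' then h r * evw v w' + v r * derw v h w' else 0.
Definition der (v h : proot -> F) T : F := \sum_(e <- T) e.1 * derw v h e.2.

Section Ev.
Variables (A : comNzRingType) (iota : {rmorphism F -> A}) (v : proot -> A).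

Lemma evw_cons r w : evw v (r :: w) = v r * evw v w.
Proof. exact: big_cons. Qed.
Lemma evw_cat w w' : evw v (w ++ w') = evw v w * evw v w'.
Proof. exact: big_cat. Qed.
Lemma ev_cat T T' : ev iota v (T ++ T') = ev iota v T + ev iota v T'.
Proof. exact: big_cat. Qed.
Lemma ev_nscale c T : ev iota v (nscale c T) = iota c * ev iota v T.
Proof.
rewrite /ev big_map mulr_sumr; apply: eq_bigr => e _.
by rewrite rmorphM mulrA.
Qed.
Lemma ev_nmul T T' : ev iota v (nmul T T') = ev iota v T * ev iota v T'.
Proof.
rewrite /ev /nmul big_allpairs_dep mulr_suml; apply: eq_bigr => a _.
rewrite mulr_sumr; apply: eq_bigr => b _.
by rewrite /= rmorphM evw_cat; ring.
Qed.
End Ev.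

Lemma eq_ev (A : comNzRingType) (iota : {rmorphism F -> A}) Q T (v v' : proot -> A) :
  nletters Q T -> (forall r, Q r -> v r = v' r) -> ev iota v T = ev iota v' T.
Proof.
move=> /allP hT h; apply: eq_big_seq => e /hT /allP he; congr (_ * _).
by apply: eq_big_seq => r /he /h.
Qed.

Lemma ev_morph (A B : comNzRingType) (iota : F -> A) (f : {rmorphism A -> B})
    v T : f (ev iota v T) = ev (f \o iota) (f \o v) T.
Proof.
rewrite rmorph_sum; apply: eq_bigr => e _; rewrite rmorphM; congr (_ * _).
exact: rmorph_prod.
Qed.

Lemma derw_cat v h w w' : derw v h (w ++ w') = derw v h w * evw v w' + evw v w * derw v h w'.
Proof.
elim: w => [|r w IH] /=; first by rewrite /evw big_nil; ring.
by rewrite IH evw_cat /evw big_cons; ring.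
Qed.
Lemma der_cat v h T T' : der v h (T ++ T') = der v h T + der v h T'.
Proof. exact: big_cat. Qed.
Lemma der_nscale v h c T : der v h (nscale c T) = c * der v h T.
Proof.
by rewrite /der big_map mulr_sumr; apply: eq_bigr => e _; rewrite mulrA.
Qed.
Lemma der_nmul v h T T' : der v h (nmul T T') =
  der v h T * ev idfun v T' + ev idfun v T * der v h T'.
Proof.
rewrite /der /ev /nmul big_allpairs_dep !mulr_suml -big_split /=.
apply: eq_bigr => a _; rewrite !mulr_sumr -big_split /=.
by apply: eq_bigr => b _; rewrite derw_cat; ring.
Qed.
Lemma eq_der Q T v v' h h' : nletters Q T ->
  (forall r, Q r -> v r = v' r) -> (forall r, Q r -> h r = h' r) ->
  der v h T = der v' h' T.
Proof.
move=> /allP hT ev' eh; apply: eq_big_seq => e /hT; move: e => [c w] /= hw.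
congr (_ * _); elim: w hw => [//|r w IH] /= /andP [hr hw].
rewrite IH // ev' // eh //; congr (_ * _ + _).
by apply: eq_big_seq => s /(allP hw)/ev'.
Qed.
Lemma der_lin v h h' c T : der v (fun r => c * h r + h' r) T = c * der v h T + der v h' T.
Proof.
rewrite /der mulr_sumr -big_split /=; apply: eq_bigr => -[c' w] _ /=.
suff -> : derw v (fun r => c * h r + h' r) w = c * derw v h w + derw v h' w by ring.
by elim: w => [|r w IH] /=; rewrite ?IH; ring.
Qed.
Lemma der0 v T : der v (fun=> 0) T = 0.
Proof.
rewrite /der big1 // => -[c w] _ /=.
suff -> : derw v (fun=> 0) w = 0 by rewrite mulr0.
by elim: w => [|r w IH] //=; rewrite IH; ring.
Qed.

Lemma horner_ev (g : proot -> {poly F}) T c :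
  (ev polyC g T).[c] = ev idfun (fun r => (g r).[c]) T.
Proof.
rewrite /ev horner_sum; apply: eq_bigr => e _.
by rewrite hornerM hornerC /evw horner_prod.
Qed.

Lemma deriv_ev (g : proot -> {poly F}) T c :
  (ev polyC g T)^`().[c] = der (fun r => (g r).[c]) (fun r => (g r)^`().[c]) T.
Proof.
rewrite /ev raddf_sum horner_sum; apply: eq_bigr => -[a w] _ /=.
rewrite derivM derivC mul0r add0r hornerM hornerC; congr (_ * _).
elim: w => [|r w IH]; rewrite /evw ?big_nil ?big_cons /=.
  by rewrite -[1]/(1%:P) derivC hornerC.
by rewrite derivM hornerD !hornerM -/(evw g w) IH /evw horner_prod.
Qed.
End Evaluation.

(** Integration of infinitesimal invariance: by [deriv_ev] the hypothesis says that the value along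
    the curve [g], a polynomial in the parameter, has zero derivative. *)
Lemma ev_curve (F : numFieldType) (g : proot -> {poly F}) (T : ncpoly F) :
  (forall c, der (fun r => (g r).[c]) (fun r => (g r)^`().[c]) T = 0) ->
  forall c, ev idfun (fun r => (g r).[c]) T = ev idfun (fun r => (g r).[0]) T.
Proof.
move=> h c; rewrite -!horner_ev; apply: poly_deriv0 => x.
by rewrite deriv_ev h.
Qed.

(** * Words in the enveloping algebra, adjoint action and degree filtration *)

Section WordsInEnvelope.
Variables (F : numFieldType) (t : ctype) (prec : rel sel).
Local Notation gt := (gtth t prec).
Hypothesis so : strict_order gt.
Local Notation U := (env F t prec).
Local Notation gen := (@gen F t prec).
Local Notation valid := (valid t prec).
Local Notation br := (@br F t prec).
Implicit Types T : ncpoly F.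

Definition mono (w : seq proot) : U := \prod_(r <- w) gen r.
Definition toU T : U := \sum_(e <- T) e.1 *: mono e.2.

Lemma mono_cat w w' : mono (w ++ w') = mono w * mono w'.
Proof. exact: big_cat. Qed.
Lemma mono_cons r w : mono (r :: w) = gen r * mono w.
Proof. exact: big_cons. Qed.
Lemma toU_cat T T' : toU (T ++ T') = toU T + toU T'.
Proof. exact: big_cat. Qed.
Lemma toU_nscale c T : toU (nscale c T) = c *: toU T.
Proof.
by rewrite /toU big_map scaler_sumr; apply: eq_bigr => e _; rewrite scalerA.
Qed.
Lemma toU_nmul T T' : toU (nmul T T') = toU T * toU T'.
Proof.
rewrite /toU /nmul big_allpairs_dep mulr_suml; apply: eq_bigr => a _.
rewrite mulr_sumr; apply: eq_bigr => b _ /=.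
by rewrite mono_cat -env_scalerAl -env_scalerAr scalerA.
Qed.

Fixpoint expand (z : term F) : ncpoly F :=
  match z with
  | Tc c => [:: (c, [::])]
  | Tg r => if valid r then [:: (1, [:: r])] else [::]
  | Tadd a b => expand a ++ expand b
  | Tmul a b => nmul (expand a) (expand b)
  end.

Lemma toU_expand z : toU (expand z) = cl t prec z.
Proof.
elim: z => [c|r|a IHa b IHb|a IHa b IHb] /=.
- by rewrite /toU big_seq1 /mono big_nil cl_const.
- case: ifP => [_|/negbT/(cl_invalid F) ->]; last by rewrite /toU big_nil.
  by rewrite /toU big_seq1 /mono big_seq1 scale1r.
- by rewrite toU_cat IHa IHb cl_add.
- by rewrite toU_nmul IHa IHb cl_mul.
Qed.

Lemma nletters_nmul Q T T' : nletters Q T -> nletters Q T' -> nletters Q (nmul T T').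
Proof.
move=> /allP h /allP h'; apply/allP => _ /allpairsP [[a b] [/= ha hb ->]] /=.
by rewrite all_cat (h _ ha) (h' _ hb).
Qed.
Lemma nletters_cat Q T T' : nletters Q (T ++ T') = nletters Q T && nletters Q T'.
Proof. exact: all_cat. Qed.
Lemma nletters_nscale Q c T : nletters Q (nscale c T) = nletters Q T.
Proof. by rewrite /nletters all_map; apply: eq_all. Qed.
Lemma nletters_sub (Q Q' : pred proot) T : {subset Q <= Q'} -> nletters Q T -> nletters Q' T.
Proof. by move=> h; apply: sub_all => e; apply: sub_all => r; apply: h. Qed.
Lemma nletters_filter Q p T : nletters Q T -> nletters Q (filter p T).
Proof. by rewrite /nletters all_filter; apply: sub_all => e /= ->; rewrite implybT. Qed.

Lemma expand_valid z : nletters valid (expand z).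
Proof.
elim: z => [c|r|a IHa b IHb|a IHa b IHb] //=; last exact: nletters_nmul.
  by case: ifP => //= ->.
by rewrite nletters_cat IHa.
Qed.

Lemma toU_split d T : toU T = toU (ncomp d T) + toU [seq e <- T | size e.2 != d].
Proof. by rewrite /toU !big_filter; apply: (bigID (fun e => size e.2 == d)). Qed.
Lemma ev_split (A : comNzRingType) (iota : F -> A) v p T :
  ev iota v T = ev iota v (filter p T) + ev iota v (filter (predC p) T).
Proof. by rewrite /ev !big_filter; apply: (bigID p). Qed.

(** The commutator with $f_r$ distributed over the letters. Every word keeps its length, so taking
    the homogeneous part of a given degree commutes with [ad]. *)
Fixpoint adw (r : proot) (w : seq proot) : ncpoly F :=
  if w is s :: w' then
    [seq (e.1, e.2 :: w') | e <- br r s] ++ [seq (e.1, s :: e.2) | e <- adw r w']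
  else [::].
Definition ad r T : ncpoly F := flatten [seq nscale e.1 (adw r e.2) | e <- T].
(** The coadjoint vector field of $f_r$ at the linear form [v]: its coordinate at [s] is
    $v([f_r,f_s])$. *)
Definition coad (r : proot) (v : proot -> F) (s : proot) : F :=
  \sum_(e <- br r s) e.1 * v e.2.

Lemma toU_adw r w : valid r -> all valid w ->
  toU (adw r w) = gen r * mono w - mono w * gen r.
Proof.
move=> vr; elim: w => [|s w IH] /=.
  by rewrite /toU big_nil /mono big_nil mulr1 mul1r subrr.
case/andP => vs vw; rewrite toU_cat.
rewrite {1}/toU big_map /=; under eq_bigr do rewrite mono_cons env_scalerAl.
rewrite -mulr_suml -(gen_br _ so) //.
have -> : toU [seq (e.1, s :: e.2) | e <- adw r w] = gen s * toU (adw r w).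
  rewrite /toU big_map mulr_sumr; apply: eq_bigr => e _ /=.
  by rewrite mono_cons env_scalerAr.
by rewrite IH // !mono_cons mulrBl mulrBr !mulrA addrA subrK.
Qed.

Lemma toU_ad r T : valid r -> nletters valid T ->
  toU (ad r T) = gen r * toU T - toU T * gen r.
Proof.
move=> vr; elim: T => [|[c w] T IH] /=.
  by rewrite /toU big_nil mulr0 mul0r subrr.
case/andP=> vw vT; rewrite /ad /= toU_cat toU_nscale -/(ad r T) IH // toU_adw //.
have -> : toU ((c, w) :: T) = c *: mono w + toU T by rewrite /toU big_cons.
rewrite mulrDr mulrDl -env_scalerAr -env_scalerAl opprD addrACA.
by rewrite scalerBr.
Qed.

Lemma ev_adw r w v : ev idfun v (adw r w) = derw v (coad r v) w.
Proof.
elim: w => [|s w IH] /=; first by rewrite /ev big_nil.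
rewrite ev_cat -IH /coad mulr_suml mulr_sumr; congr (_ + _).
  by rewrite /ev big_map; apply: eq_bigr => e _; rewrite /evw big_cons /= mulrA.
rewrite /ev big_map; apply: eq_bigr => e _; rewrite /evw big_cons /=.
by rewrite !mulrA [v s * _]mulrC.
Qed.
(** Turns centrality into differential equations for the symbol. *)
Lemma ev_ad r T v : ev idfun v (ad r T) = der v (coad r v) T.
Proof.
elim: T => [|[c w] T IH]; first by rewrite /ev /der !big_nil.
by rewrite /ad /= ev_cat -/(ad r T) IH ev_nscale ev_adw /der big_cons.
Qed.

Lemma adw_size r w e : e \in adw r w -> size e.2 = size w.
Proof.
elim: w e => [//|s w IH] e /=; rewrite mem_cat => /orP [] /mapP [e' h ->] //=.
by rewrite (IH _ h).
Qed.
Lemma ncomp_ad d r T : ncomp d (ad r T) = ad r (ncomp d T).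
Proof.
elim: T => [//|[c w] T IH]; have -> : ad r ((c, w) :: T) = nscale c (adw r w) ++ ad r T by [].
rewrite /ncomp filter_cat -!/(ncomp d _) IH /=.
have h : {in nscale c (adw r w), forall e, size e.2 = size w}.
  by move=> _ /mapP [e /adw_size <- ->].
case: ifP => e.
  by congr (_ ++ _); apply/all_filterP/allP => x /h ->.
rewrite -[RHS]cat0s; congr (_ ++ _); apply/eqP; rewrite -[_ == _]negbK -has_filter.
by apply/hasPn => x /h ->; rewrite e.
Qed.

Definition br_closed (Q : pred proot) :=
  forall r s, Q r -> Q s -> all (fun e => Q e.2) (br r s).

Lemma adw_letters Q r w : br_closed Q -> Q r -> all Q w -> nletters Q (adw r w).
Proof.
move=> cl Qr; elim: w => [//|s w IH] /= /andP [Qs Qw]; rewrite nletters_cat.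
rewrite /nletters !all_map; apply/andP; split.
  by apply: sub_all (cl _ _ Qr Qs) => e /= ->.
by apply: sub_all (IH Qw) => e /= ->; rewrite Qs.
Qed.

Section Coefficients.
Variable T : ncpoly F.
Hypothesis T0 : forall v, ev idfun v T = 0.

(** Words become monomials in finitely many variables, one for each letter in [L]; permuted words
    give the same monomial, and [mpoly_eq0] kills each coefficient. *)
Lemma coef_eq0 w : \sum_(e <- T | perm_eq e.2 w) e.1 = 0.
Proof.
pose L := undup (w ++ flatten [seq e.2 | e <- T]); pose n := size L.
pose mn (u : seq proot) := [multinom count_mem (nth (PL 0) L i) u | i < n].
have sub u : u \in w :: [seq e.2 | e <- T] -> {subset u <= L}.
  rewrite inE => /orP [/eqP -> r|/mapP [e he ->] r] hr; rewrite mem_undup mem_cat.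
    by rewrite hr.
  by apply/orP; right; apply/flattenP; exists e.2 => //; apply: map_f.
have mnE u u' : {subset u <= L} -> {subset u' <= L} -> (mn u == mn u') = perm_eq u u'.
  move=> hu hu'; apply/eqP/idP => [e|/seq.permP e]; last by apply/mnmP=> i; rewrite !mnmE e.
  apply/allP => r; rewrite mem_cat => hr; have rL : r \in L.
    by case/orP: hr => [/hu|/hu'].
  have lt : (index r L < n)%N by rewrite index_mem.
  by have /mnmP/(_ (Ordinal lt)) := e; rewrite !mnmE /= nth_index // => ->.
pose p : {mpoly F[n]} := \sum_(e <- T) e.1 *: 'X_[mn e.2].
have p0 : p = 0.
  apply: mpoly_eq0 => y _; rewrite -(T0 (fun r =>
     if insub (index r L) is Some i then y i else 0)).
  rewrite /p (raddf_sum (meval y)) /ev; apply: eq_big_seq => e he.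
  rewrite [LHS]mevalZ mevalX; congr (_ * _).
  rewrite /evw (_ : \prod_(i < n) _ = \prod_(i < n)
       \prod_(r <- e.2 | r == nth (PL 0) L i) y i); last first.
    by apply: eq_bigr => i _; rewrite mnmE big_const_seq iter_mulr_1.
  rewrite (exchange_big_dep xpredT) //=; apply: eq_big_seq => r hr.
  have rL : r \in L by apply: sub hr; rewrite inE map_f ?orbT.
  have lt : (index r L < n)%N by rewrite index_mem.
  rewrite insubT /=; rewrite (bigD1 (Ordinal lt)) /= ?nth_index // big1 ?mulr1 //.
  move=> i /andP [/eqP e1 ne]; case/negP: ne; apply/eqP/val_inj => /=.
  by rewrite e1 index_uniq // undup_uniq.
have := congr1 (mcoeff (mn w)) p0.
rewrite mcoeff0 /p (raddf_sum (mcoeff (mn w))) /= => s0; rewrite -[RHS]s0.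
rewrite big_mkcond; apply: eq_big_seq => e he; rewrite mcoeffZ mcoeffX mnE.
- by case: perm_eq; rewrite ?mulr1 ?mulr0.
- by apply: sub; rewrite inE map_f ?orbT.
- by apply: sub; rewrite inE eqxx.
Qed.
End Coefficients.

Record submodule (K : U -> Prop) : Prop := Submodule {
  sub0 : K 0;
  subD : forall x y, K x -> K y -> K (x + y);
  subZ : forall c x, K x -> K (c *: x) }.

Lemma sub_sum K I (s : seq I) (f : I -> U) (p : pred I) : submodule K ->
  (forall i, p i -> K (f i)) -> K (\sum_(i <- s | p i) f i).
Proof.
by move=> sK h; apply: big_ind => //; [exact: sub0|exact: subD].
Qed.

(** Within a class of permuted words the coefficients sum to 0, so only differences of permuted
    words remain. Applied with [K] the zero space when the letters commute, and with [K] the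
    elements of smaller degree in general. *)
Lemma ev0_toU K T : submodule K ->
  (forall e e', e \in T -> e' \in T -> perm_eq e.2 e'.2 -> K (mono e.2 - mono e'.2)) ->
  (forall v, ev idfun v T = 0) -> K (toU T).
Proof.
move=> sK; have [n] := ubnP (size T); elim: n T => // n IH [|e0 T] lt hT T0.
  by rewrite /toU big_nil; apply: sub0.
set S := e0 :: T in lt hT T0 *; pose a (e : F * seq proot) := perm_eq e.2 e0.2.
have c0 := coef_eq0 T0 e0.2.
have -> : toU S = toU (filter a S) + toU (filter (predC a) S).
  by rewrite /toU !big_filter; apply: (bigID a).
have tA : toU (filter a S) = \sum_(e <- S | (e \in S) && a e) e.1 *: (mono e.2 - mono e0.2).
  rewrite -big_seq_cond.
  under [in RHS]eq_bigr do rewrite scalerBr.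
  by rewrite sumrB -scaler_suml c0 scale0r subr0 /toU big_filter.
have evA v : ev idfun v (filter a S) = 0.
  rewrite /ev big_filter (eq_bigr (fun e => e.1 * evw v e0.2)); last first.
    by move=> e he; congr (_ * _); apply: perm_big.
  by rewrite -mulr_suml c0 mul0r.
apply: subD => //.
  rewrite tA; apply: sub_sum => // e /andP [he ae]; apply: subZ => //.
  by apply: hT => //; rewrite mem_head.
apply: IH => [|e e'|v].
- rewrite /S /= /a perm_refl /=; rewrite size_filter.
  by apply: leq_ltn_trans (count_size _ _) _; rewrite -ltnS.
- by rewrite !mem_filter => /andP [_ ?] /andP [_ ?]; apply: hT.
- by have := T0 v; rewrite (ev_split _ _ a) evA add0r.
Qed.

Lemma comm_mono_perm w w' : (forall r s, r \in w -> s \in w -> gen r * gen s = gen s * gen r) ->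
  perm_eq w w' -> mono w = mono w'.
Proof.
elim: w w' => [|r w IH] w' h; first by rewrite perm_sym => /perm_nilP ->.
move=> pe; have rw' : r \in w' by rewrite -(perm_mem pe) mem_head.
have [w1 [w2 e]] : exists w1 w2, w' = w1 ++ r :: w2.
  by case/splitPr: rw' => w1 w2; exists w1, w2.
move: pe; rewrite e -(cat1s r w) -(cat1s r w2) perm_sym perm_catCA perm_cat2l perm_sym => pe.
rewrite cat1s mono_cons (IH (w1 ++ w2)) //; last first.
  by move=> x y hx hy; apply: h; rewrite inE ?hx ?hy orbT.
rewrite !mono_cat mono_cons /mono big_nil mulr1 !mulrA; congr (_ * _).
have : {subset w1 <= r :: w}.
  by move=> x hx; rewrite inE (perm_mem pe) mem_cat hx orbT.
elim: w1 {IH pe e} => [|s w1 IH1] hs; first by rewrite big_nil mulr1 mul1r.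
rewrite big_cons mulrA h ?mem_head // ?hs ?mem_head //.
by rewrite -mulrA IH1 ?mulrA // => x hx; apply: hs; rewrite inE hx orbT.
Qed.

Lemma ev0_toU_comm (Q : pred proot) T : (forall r s, Q r -> Q s -> gen r * gen s = gen s * gen r) ->
  nletters Q T -> (forall v, ev idfun v T = 0) -> toU T = 0.
Proof.
move=> hc hT; apply: (@ev0_toU (fun x => x = 0)).
- split=> // [x y -> ->|c x ->]; [exact: addr0|exact: scaler0].
- move=> e e' he he' pe; apply/eqP; rewrite subr_eq0; apply/eqP/comm_mono_perm => //.
  move=> r s hr hs; have /allP h := allP hT _ he.
  by apply: hc; apply: h.
Qed.

(** The degree filtration, with the letters recorded: keeping them in [Q] preserves a finite support
    during the induction on the degree. *)
Definition lower (Q : pred proot) (d : nat) (x : U) : Prop :=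
  exists T, [/\ nletters Q T, all (fun e => size e.2 < d)%N T & x = toU T].

Lemma lower_submodule Q d : submodule (lower Q d).
Proof.
split.
- by exists [::]; rewrite /toU big_nil.
- move=> _ _ [T [h1 h2 ->]] [T' [h1' h2' ->]]; exists (T ++ T').
  by rewrite nletters_cat h1 all_cat h2 toU_cat.
- move=> c _ [T [h1 h2 ->]]; exists (nscale c T).
  by rewrite nletters_nscale h1 toU_nscale all_map.
Qed.

Lemma lower_adw Q w1 w2 r s : br_closed Q -> {subset Q <= valid} ->
  all Q w1 -> all Q w2 -> Q r -> Q s ->
  lower Q (size w1 + size w2).+2 (mono (w1 ++ r :: s :: w2) - mono (w1 ++ s :: r :: w2)).
Proof.
move=> clQ Qv q1 q2 qr qs.
exists [seq (e.1, w1 ++ e.2 :: w2) | e <- br r s]; split.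
- rewrite /nletters all_map; apply: sub_all (clQ _ _ qr qs) => e /= qe.
  by rewrite all_cat /= q1 qe q2.
- by rewrite all_map; apply/allP => e _ /=; rewrite size_cat /= addnS.
- rewrite /toU big_map /= (eq_bigr (fun e => mono w1 * (e.1 *: gen e.2) * mono w2)); last first.
    by move=> e _; rewrite mono_cat mono_cons -env_scalerAr -env_scalerAl mulrA.
  rewrite -mulr_suml -mulr_sumr -(gen_br _ so); [|exact: Qv..].
  by rewrite !mono_cat !mono_cons mulrBr mulrBl !mulrA.
Qed.

Lemma lower_move Q w0 w1 w2 r : br_closed Q -> {subset Q <= valid} -> Q r ->
  all Q (w0 ++ w1 ++ w2) -> lower Q (size (w0 ++ w1 ++ w2)).+1
    (mono (w0 ++ r :: w1 ++ w2) - mono (w0 ++ w1 ++ r :: w2)).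
Proof.
move=> clQ Qv qr; elim: w1 w0 => [|s w1 IH] w0 q12 /=.
  by rewrite subrr; apply: sub0 (lower_submodule _ _).
have -> : mono (w0 ++ r :: s :: w1 ++ w2) - mono (w0 ++ s :: w1 ++ r :: w2) =
  (mono (w0 ++ r :: s :: w1 ++ w2) - mono (w0 ++ s :: r :: w1 ++ w2))
  + (mono (rcons w0 s ++ r :: w1 ++ w2) - mono (rcons w0 s ++ w1 ++ r :: w2)).
  by rewrite !cat_rcons addrA subrK.
apply: (subD (lower_submodule _ _)); last first.
  by have := IH (rcons w0 s); rewrite cat_rcons; apply.
have := lower_adw clQ Qv (w1 := w0) (w2 := w1 ++ w2) (r := r) (s := s).
move: q12; rewrite all_cat /= => /and3P [h1 h2 h3] /(_ h1 h3 qr h2).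
by rewrite [size (w0 ++ _)]size_cat /= addnS.
Qed.

(** Reordering costs commutators of neighbouring letters, each of which replaces two letters by
    combinations of one and so shortens the word. *)
Lemma lower_perm Q w w' : br_closed Q -> {subset Q <= valid} -> all Q w ->
  perm_eq w w' -> lower Q (size w) (mono w - mono w').
Proof.
move=> clQ Qv; elim: w w' => [|r w IH] w' h.
  by rewrite perm_sym => /perm_nilP ->; rewrite subrr; apply: sub0 (lower_submodule _ _).
move=> pe; have rw' : r \in w' by rewrite -(perm_mem pe) mem_head.
have [w1 [w2 e]] : exists w1 w2, w' = w1 ++ r :: w2.
  by case/splitPr: rw' => w1 w2; exists w1, w2.
move: pe; rewrite e -(cat1s r w) -(cat1s r w2) perm_sym perm_catCA perm_cat2l perm_sym => pe.
case/andP: h => qr qw.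
have sM := lower_submodule Q (size w).+1.
have {IH} h1 : lower Q (size w).+1 (mono (r :: w) - mono (r :: w1 ++ w2)).
  have [T [hT sT eT]] := IH _ qw pe; exists (nmul [:: (1, [:: r])] T); split.
  - by apply: nletters_nmul => //=; rewrite qr.
  - by apply/allP => _ /allpairsP [[a b] [/= /[!inE] /eqP -> hb ->]] /=;
      rewrite ltnS; apply: (allP sT).
  - by rewrite toU_nmul -eT {1}/toU big_seq1 scale1r !mono_cons /mono big_nil mulr1 mulrBr.
have -> : mono ([:: r] ++ w) - mono (w1 ++ [:: r] ++ w2) =
   (mono (r :: w) - mono (r :: w1 ++ w2)) + (mono ([::] ++ r :: w1 ++ w2) - mono ([::] ++ w1 ++ r :: w2)).
  by rewrite addrA subrK.
apply: (subD sM) => //.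
have q12 : all Q (w1 ++ w2) by rewrite -(perm_all _ pe).
rewrite (perm_size pe : size w = _).
exact: (lower_move clQ Qv (w0 := [::])).
Qed.

Lemma ev0_toU_lower Q d T : br_closed Q -> {subset Q <= valid} ->
  nletters Q T -> all (fun e => size e.2 == d) T ->
  (forall v, ev idfun v T = 0) -> lower Q d (toU T).
Proof.
move=> clQ Qv hT sT; apply: ev0_toU; first exact: lower_submodule.
move=> e e' he he' pe; rewrite -(eqP (allP sT _ he)).
by apply: lower_perm => //; apply: (allP hT).
Qed.
End WordsInEnvelope.

(** * Representations, tensor powers and the symbol *)

Section Symbol.
Variables (F : numFieldType) (t : ctype) (prec : rel sel).
Local Notation gt := (gtth t prec).
Hypothesis so : strict_order gt.
Local Notation valid := (valid t prec).
Implicit Types T : ncpoly F.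

Record isrep (W : lmodType F) (rho : proot -> W -> W) : Prop := IsRep {
  rep_lin : forall r c x y, rho r (c *: x + y) = c *: rho r x + rho r y;
  rep_br : forall r s L, valid r -> valid s -> all (fun e => valid e.2) L ->
    (forall x y, mentry (mmul (rmat F t r) (rmat F t s)) x y
                 - mentry (mmul (rmat F t s) (rmat F t r)) x y
                 = \sum_(e <- L) e.1 * mentry (rmat F t e.2) x y) ->
    forall x, rho r (rho s x) - rho s (rho r x) = \sum_(e <- L) e.1 *: rho e.2 x }.

Section Action.
Variables (W : lmodType F) (rho : proot -> W -> W).
Hypothesis rhoP : isrep rho.

Fixpoint tact (z : term F) (x : W) : W :=
  match z with
  | Tc c => c *: x
  | Tg r => if valid r then rho r x else 0
  | Tadd a b => tact a x + tact b x
  | Tmul a b => tact a (tact b x)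
  end.

Lemma tact_lin z c x y : tact z (c *: x + y) = c *: tact z x + tact z y.
Proof.
elim: z x y => [d|r|a IHa b IHb|a IHa b IHb] x y /=.
- by rewrite scalerDr !scalerA mulrC.
- by case: ifP => _; rewrite ?(rep_lin rhoP) // scaler0 addr0.
- by rewrite IHa IHb scalerDr addrACA.
- by rewrite IHb IHa.
Qed.
Lemma tact0 z : tact z 0 = 0.
Proof.
have := tact_lin z (-1) 0 0; rewrite scaler0 addr0 => {1}->.
by rewrite scaleN1r addNr.
Qed.
Lemma tactD z x y : tact z (x + y) = tact z x + tact z y.
Proof. by have := tact_lin z 1 x y; rewrite !scale1r. Qed.
Lemma tactZ z c x : tact z (c *: x) = c *: tact z x.
Proof. by have := tact_lin z c x 0; rewrite tact0 !addr0. Qed.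

(** The action respects each generating relation, so it descends to $U(\mathfrak n)$; this is how
    elements are shown to be nonzero there. *)
Lemma equ_tact a b : equ t prec a b -> forall x, tact a x = tact b x.
Proof.
elim=> {a b} /= [||a b c _ h _ h' x|a a' b b' _ h _ h' x|a a' b b' _ h _ h' x||||||||||||||].
- by [].
- by move=> a b _ h x; rewrite h.
- by rewrite h h'.
- by rewrite h h'.
- by rewrite h' h.
- by move=> *; rewrite addrA.
- by move=> *; rewrite addrC.
- by move=> a x; rewrite scale0r add0r.
- by move=> a x; rewrite scaleN1r subrr scale0r.
- by [].
- by move=> a x; rewrite scale1r.
- by move=> a x; rewrite scale1r.
- by [].
- by move=> *; rewrite tactD.
- by move=> *; rewrite scalerDl.
- by move=> *; rewrite scalerA.
- by move=> *; rewrite tactZ.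
- by move=> r /negbTE -> x; rewrite scale0r.
move=> r s L vr vs vL hL x; rewrite /= vr vs scaleN1r (rep_br rhoP vr vs vL hL).
elim: L vL {hL} => [|e L IH] /=; first by rewrite big_nil scale0r.
by case/andP=> -> /IH <-; rewrite big_cons.
Qed.

Definition eact (u : env F t prec) (x : W) : W := tact (generic_quotient.repr u) x.
Lemma eact_cl a x : eact (cl t prec a) x = tact a x.
Proof. by apply: equ_tact; apply: equ_repr. Qed.
Lemma eactD u u' x : eact (u + u') x = eact u x + eact u' x.
Proof. by elim/env_ind: u => a; elim/env_ind: u' => b; rewrite -cl_add !eact_cl. Qed.
Lemma eactM u u' x : eact (u * u') x = eact u (eact u' x).
Proof. by elim/env_ind: u => a; elim/env_ind: u' => b; rewrite -cl_mul !eact_cl. Qed.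
Lemma eactZ c u x : eact (c *: u) x = c *: eact u x.
Proof. by elim/env_ind: u => a; rewrite -cl_scale !eact_cl. Qed.

Lemma eact0 x : eact 0 x = 0.
Proof. by rewrite -cl0 eact_cl /= scale0r. Qed.

Definition wact (w : seq proot) (x : W) : W := foldr rho x w.

Lemma eact_mono w x : all valid w -> eact (mono F t prec w) x = wact w x.
Proof.
elim: w => [_|r w IH /= /andP [vr vw]].
  by rewrite /mono big_nil -cl1 eact_cl /= scale1r.
by rewrite mono_cons eactM IH // eact_cl /= vr.
Qed.
Lemma eact_toU T x : nletters valid T ->
  eact (toU t prec T) x = \sum_(e <- T) e.1 *: wact e.2 x.
Proof.
elim: T => [_|[c w] T IH /= /andP [vw vT]].
  by rewrite /toU !big_nil -cl0 eact_cl /= scale0r.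
have -> : toU t prec ((c, w) :: T) = c *: mono F t prec w + toU t prec T.
  by rewrite /toU big_cons.
by rewrite eactD eactZ eact_mono // IH // big_cons.
Qed.
End Action.

(* The tensor product of the representation rho with the natural one: the
   first label of a function on [sel * sel] carries the matrix action, the
   second one is passive and records the starting basis vector. *)
Section Tensor.
Variables (W : lmodType F) (rho : proot -> W -> W).
Hypothesis rhoP : isrep rho.

Definition lact (L : fmat F) (g : sel -> W) (a : sel) : W :=
  \sum_(e <- L | e.1.2 == a) e.1.1 *: g e.2.
Definition trep (r : proot) (g : sel * sel -> W) : sel * sel -> W :=
  fun p => lact (rmat F t r) (fun a => g (a, p.2)) p.1 + rho r (g p).

Lemma lact_mentry (L : fmat F) g a s : uniq s -> {subset [seq e.2 | e <- L] <= s} ->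
  lact L g a = \sum_(y <- s) mentry L a y *: g y.
Proof.
move=> us hs; rewrite /lact big_mkcond.
rewrite (eq_bigr (fun y => \sum_(e <- L)
   (if (e.1.2 == a) && (e.2 == y) then e.1.1 else 0) *: g y)); last first.
  by move=> y _; rewrite /mentry scaler_suml.
rewrite exchange_big /=; apply: eq_big_seq => e he.
have es : e.2 \in s by apply: hs; apply: map_f.
rewrite (bigD1_seq e.2) //= eqxx andbT big1 ?addr0; last first.
  by move=> y ne; rewrite [e.2 == y]eqtype.eq_sym (negbTE ne) andbF scale0r.
by case: ifP => _; rewrite ?scale0r.
Qed.

Lemma lact_mmul (A B : fmat F) g a : lact (mmul A B) g a = lact A (lact B g) a.
Proof.
rewrite /lact /mmul big_flatten big_map [RHS]big_mkcond.
apply: eq_bigr => e _ /=; rewrite big_map big_filter_cond.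
case: ifP => h.
  rewrite scaler_sumr big_mkcond [RHS]big_mkcond; apply: eq_bigr => e' _ /=.
  by rewrite ?h andbT [e'.1.2 == _]eqtype.eq_sym; case: ifP => // _; rewrite scalerA.
by rewrite big1 // => e' /=; rewrite ?h andbF.
Qed.

Lemma lactD L g g' a : lact L (fun x => g x + g' x) a = lact L g a + lact L g' a.
Proof. by rewrite /lact -big_split; apply: eq_bigr => e _; rewrite scalerDr. Qed.
Lemma lactZ L c g a : lact L (fun x => c *: g x) a = c *: lact L g a.
Proof.
by rewrite /lact scaler_sumr; apply: eq_bigr => e _; rewrite !scalerA mulrC.
Qed.
Lemma rho0 r : rho r 0 = 0.
Proof.
have := rep_lin rhoP r (-1) 0 0; rewrite scaler0 addr0 => {1}->.
by rewrite scaleN1r addNr.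
Qed.
Lemma rho_lact r L g a : rho r (lact L g a) = lact L (fun x => rho r (g x)) a.
Proof.
rewrite /lact; elim: L => [|e L IH]; first by rewrite !big_nil rho0.
rewrite !big_cons; case: ifP => // _.
by rewrite (rep_lin rhoP) IH.
Qed.

Lemma trep_isrep : isrep trep.
Proof.
split=> [r c x y|r s L vr vs vL hL g]; apply: funext => p.
  rewrite /trep (rep_lin rhoP) lactD lactZ.
  by rewrite -[RHS]/(c *: (_ + _) + (_ + _)) scalerDr addrACA.
rewrite fct_sumE -[LHS]/(trep r (trep s g) p - trep s (trep r g) p).
have E r' s' : trep r' (trep s' g) p =
   lact (mmul (rmat F t r') (rmat F t s')) (fun a => g (a, p.2)) p.1
   + lact (rmat F t r') (fun a => rho s' (g (a, p.2))) p.1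
   + lact (rmat F t s') (fun a => rho r' (g (a, p.2))) p.1
   + rho r' (rho s' (g p)).
  rewrite lact_mmul /trep /= lactD -!addrA; congr (_ + (_ + _)).
  have := rep_lin rhoP r' 1 (lact (rmat F t s') (fun a => g (a, p.2)) p.1) (rho s' (g p)).
  by rewrite !scale1r => ->; rewrite rho_lact.
rewrite !E.
have -> : \sum_(e <- L) (e.1 *: trep e.2 g) p =
   \sum_(e <- L) e.1 *: lact (rmat F t e.2) (fun a => g (a, p.2)) p.1
   + \sum_(e <- L) e.1 *: rho e.2 (g p).
  by rewrite -big_split; apply: eq_bigr => e _ /=; rewrite -[LHS]/(e.1 *: trep e.2 g p) /trep scalerDr.
rewrite -(rep_br rhoP vr vs vL hL).
set A := mmul (rmat F t r) (rmat F t s); set B := mmul (rmat F t s) (rmat F t r).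
set g1 := fun a => g (a, p.2).
(* The relation compares single matrix entries, so [lact] is rewritten over a finite set [S] of
   column labels containing all that occur. *)
have -> : \sum_(e <- L) e.1 *: lact (rmat F t e.2) g1 p.1 = lact A g1 p.1 - lact B g1 p.1.
  pose S := undup ([seq e.2 | e <- A] ++ [seq e.2 | e <- B]
                   ++ flatten [seq [seq e.2 | e <- rmat F t f.2] | f <- L]).
  have uS : uniq S by apply: undup_uniq.
  rewrite !(@lact_mentry _ _ _ S) //; first last.
  - by move=> x hx; rewrite mem_undup !mem_cat hx.
  - by move=> x hx; rewrite mem_undup !mem_cat hx orbT.
  rewrite (eq_big_seq (fun f => \sum_(y <- S) (f.1 * mentry (rmat F t f.2) p.1 y) *: g1 y)); last first.
    move=> f hf; rewrite (@lact_mentry _ _ _ S) //.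
      by rewrite scaler_sumr; apply: eq_bigr => y _; rewrite scalerA.
    move=> x hx; rewrite mem_undup !mem_cat; apply/orP; right; apply/orP; right.
    by apply/flattenP; eexists; [apply: map_f hf|exact: hx].
  rewrite exchange_big -sumrB; apply: eq_bigr => y _ /=.
  by rewrite -scaler_suml -hL scalerBl.
move: (lact A g1 p.1) (lact B g1 p.1) (lact _ (fun a => rho s (g (a, p.2))) _)
  (lact _ (fun a => rho r (g (a, p.2))) _) (rho r _) (rho s _) => a b c d e f.
rewrite -[a + c + d]addrA -[b + d + c]addrA [d + c]addrC; move: (c + d) => x.
by rewrite opprD addrACA opprD [a + x + _]addrACA subrr addr0.
Qed.

Fixpoint matw (w : seq proot) (b : sel) (a : sel) : F :=
  if w is r :: w' then \sum_(e <- rmat F t r | e.1.2 == a) e.1.1 * matw w' b e.2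
  else (a == b)%:R.

(** The ways to distribute the letters, in order, over two tensor factors: the coproduct of a
    product of primitive elements. *)
Fixpoint splits (w : seq proot) : seq (seq proot * seq proot) :=
  if w is r :: w' then [seq (r :: p.1, p.2) | p <- splits w']
                       ++ [seq (p.1, r :: p.2) | p <- splits w']
  else [:: ([::], [::])].

(** The starting vector puts, for each passive label [b], the basis vector [b] next to [x]. One
    vector thus gives access to all matrix coefficients [matw p.1 b a]. *)
Lemma wact_trep w x a b :
  wact trep w (fun p => (p.1 == p.2)%:R *: x) (a, b)
  = \sum_(p <- splits w) matw p.1 b a *: wact rho p.2 x.
Proof.
elim: w a b => [|r w IH] a b /=; first by rewrite big_seq1.
rewrite big_cat !big_map /= {1}/trep /=; congr (_ + _).
  rewrite /lact (eq_bigr (fun e => \sum_(p <- splits w)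
      (e.1.1 * matw p.1 b e.2) *: wact rho p.2 x)); last first.
    by move=> e _; rewrite IH scaler_sumr; apply: eq_bigr => p _; rewrite scalerA.
  by rewrite exchange_big; apply: eq_bigr => p _; rewrite scaler_suml.
rewrite IH; elim: (splits w) => [|p s IHs]; first by rewrite !big_nil rho0.
by rewrite !big_cons (rep_lin rhoP) IHs.
Qed.
End Tensor.

Lemma splits_size w p : p \in splits w -> (size p.1 + size p.2 = size w)%N.
Proof.
elim: w p => [|r w IH] p /=; first by rewrite inE => /eqP ->.
by rewrite mem_cat => /orP [] /mapP [q /IH <- ->] /=; rewrite ?addnS.
Qed.
Lemma splits_sub w p : p \in splits w ->
  {subset p.1 <= w} /\ {subset p.2 <= w}.
Proof.
elim: w p => [|r w IH] p /=; first by rewrite inE => /eqP ->.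
rewrite mem_cat => /orP [] /mapP [q /IH [h1 h2] ->] /=; split=> x; rewrite !inE.
- by case/orP => [->//|/h1 ->]; rewrite orbT.
- by move/h2 ->; rewrite orbT.
- by move/h1 ->; rewrite orbT.
- by case/orP => [->//|/h2 ->]; rewrite orbT.
Qed.
(** Any of the letters may be the one sent to the first factor, and each choice has the same value.
    Iteration of the factor [size w] produces the factorial in [symbol_functional]. *)
Lemma splits_sum1 w (v : proot -> F) :
  \sum_(p <- splits w | size p.1 == 1) evw v p.1 * evw v p.2 = (size w)%:R * evw v w.
Proof.
have s0 u : \sum_(p <- splits u | size p.1 == 0) evw v p.1 * evw v p.2 = evw v u.
  elim: u => [|r u IH] /=; first by rewrite big_cons big_nil /= /evw !big_nil addr0 mul1r.
  rewrite big_cat !big_map /= big_pred0_eq add0r evw_cons -IH mulr_sumr.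
  by apply: eq_bigr => p _ /=; rewrite evw_cons mulrCA.
elim: w => [|r w IH] /=; first by rewrite big_cons big_nil /= mul0r.
rewrite big_cat !big_map /= evw_cons -natr1 mulrDl mul1r [RHS]addrC; congr (_ + _).
  rewrite -s0 mulr_sumr; apply: eq_big => p; first by rewrite eqSS.
  by move=> _; rewrite evw_cons mulrA.
rewrite mulrCA -IH mulr_sumr; apply: eq_bigr => p _.
by rewrite evw_cons mulrCA.
Qed.

(** A matrix position that identifies a positive root: by [pos_entry], $f_r$ has entry 1 there and
    all other positive root vectors have entry 0. *)
Definition pos (r : proot) : sel * sel :=
  match r with
  | PM i j => (P i, P j) | PP i j => (P i, N j)
  | PS i => (P i, None) | PL i => (P i, N i)
  end.

Lemma pos_offdiag r : valid r -> (pos r).1 == (pos r).2 = false.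
Proof. by case: r => //= i j h; apply/negbTE; apply: (so_neq so). Qed.

Lemma pos_entry r s : valid r -> valid s ->
  mentry (rmat F t r) (pos s).1 (pos s).2 = (r == s)%:R.
Proof.
have E (x y : proot) : (x == y) = (proot_code x == proot_code y) by [].
case: r s => [i j|i j|i|i] [k l|k l|k|k] vr vs; rewrite E mentryE /rmat;
  do ?case: ifP => _; rewrite !big_cons big_nil /= ?eqsel ?xpair_eqE ?eqxx /=;
  rewrite ?mulr0 ?mul0r ?addr0 ?mul1r ?mulr1 -?natrM ?mulnb ?andbT ?andbb //.
- rewrite (_ : (j == k) && _ = false) ?addr0 //; apply/negP => /andP [/eqP a /eqP b].
  by case/andP: vr vs => _ /(so_asym so) /=; rewrite a b => -> /andP [].
- rewrite -mulrA -natrM mulnb (_ : (j == k) && _ = false) ?mulr0 ?addr0 //.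
  apply/negP => /andP [/eqP a /eqP b].
  by case/andP: vr vs => _ /(so_asym so) /=; rewrite a b => -> /andP [].
- rewrite andbC (_ : _ && _ = false) ?addr0 //; apply/negP => /andP [/eqP a /eqP b].
  by case/andP: vr => _ /(so_neq so); rewrite a b eqxx.
- rewrite -mulrA -natrM mulnb andbC (_ : _ && _ = false) ?mulr0 ?addr0 //.
  apply/negP => /andP [/eqP a /eqP b].
  by case/andP: vr => _ /(so_neq so); rewrite a b eqxx.
- rewrite (_ : _ && _ = false) //; apply/negP => /andP [/eqP a /eqP b].
  by case/andP: vs => _ /(so_neq so); rewrite -a -b eqxx.
Qed.

(* For a valuation v, the degree d part of the symbol at v is a matrix
   coefficient of the d-th tensor power of the natural representation. *)
Lemma symbol_functional L (v : proot -> F) d : all valid L -> uniq L ->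
  exists (W : lmodType F) (rho : proot -> W -> W) (phi : W -> F) (x : W),
  [/\ isrep rho, linear_for *%R phi &
    forall w, {subset w <= L} -> (size w <= d)%N ->
      phi (wact rho w x) = if size w == d then (d`!)%:R * evw v w else 0].
Proof.
move=> vL uL; elim: d => [|d [W [rho [phi [x [rhoP lphi IH]]]]]].
  exists F^o, (fun _ _ => 0), id, 1; split=> //.
  - by split=> [r c x y|r s L' _ _ _ _ x]; rewrite ?subrr ?scaler0 ?addr0 // big1 // => e _;
      rewrite scaler0.
  - by case=> //= _ _; rewrite /evw big_nil mulr1.
(* One more natural tensor factor, read at the positions [pos r] with weights [v r]. A single letter
   acting on this factor thereby contributes its value under [v]. *)
exists (sel * sel -> W)%type, (trep rho), (fun g => \sum_(r <- L) v r * phi (g (pos r))),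
  (fun p => (p.1 == p.2)%:R *: x); split; first exact: trep_isrep.
  move=> c g g'; rewrite mulr_sumr -big_split; apply: eq_bigr => r _ /=.
  by rewrite -[(c *: g + g') _]/(c *: g _ + g' _) lphi; ring.
have phi0 : phi 0 = 0.
  by have := lphi (-1) 0 0; rewrite scaler0 addr0 mulN1r addNr.
have phiS I (s : seq I) (c : I -> F) (f : I -> W) :
    phi (\sum_(i <- s) c i *: f i) = \sum_(i <- s) c i * phi (f i).
  by elim: s => [|i s IHs]; rewrite ?big_nil // !big_cons lphi IHs.
move=> w wL sw.
rewrite (eq_bigr (fun r => \sum_(p <- splits w)
    v r * (matw p.1 (pos r).2 (pos r).1 * phi (wact rho p.2 x)))); last first.
  by move=> r _; rewrite [pos r]surjective_pairing wact_trep // phiS mulr_sumr.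
rewrite exchange_big /= (eq_big_seq (fun p => if size p.1 == 1%N then
   (if size w == d.+1 then (d`!)%:R * (evw v p.1 * evw v p.2) else 0) else 0)).
  rewrite -big_mkcond /=; case: ifP => [/eqP e|_]; last by rewrite big1.
  by rewrite -mulr_sumr splits_sum1 e factS natrM; ring.
(* No letter on the natural factor gives a diagonal coefficient, which [pos r] avoids. Two or more
   leave fewer than [d] letters for the old functional, which then is 0. Exactly one letter
   remains. *)
move=> [u1 u2] hp /=; have [s1 s2] := splits_sub hp; have := splits_size hp.
rewrite /= in s1 s2 *; case: u1 s1 {hp} => [|r0 [|r1 u1]] s1 es.
- rewrite big_seq big1 // => r /(allP vL)/pos_offdiag /= ->.
  by rewrite mul0r mulr0.
- have rL : r0 \in L by apply: wL; apply: s1; rewrite mem_head.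
  have M r : r \in L -> matw [:: r0] (pos r).2 (pos r).1 = (r0 == r)%:R.
    move=> hr; rewrite -(pos_entry (allP vL _ rL) (allP vL _ hr)) mentryE /= big_mkcond.
    by apply: eq_bigr => e _; case: ifP => _; rewrite ?mulr1 ?mulr0 ?mul0r.
  rewrite (bigD1_seq r0) // big_seq_cond big1 ?addr0; last first.
    by move=> r /andP [hr ne]; rewrite M // eqtype.eq_sym (negbTE ne) mul0r mulr0.
  rewrite M // eqxx mul1r.
  rewrite IH; [|by move=> r /s2/wL|by move: sw; rewrite -es /= add1n ltnS].
  rewrite -es /= add1n eqSS addr0; case: ifP => _; last by rewrite mulr0.
  by rewrite evw_cons /evw big_nil; ring.
- rewrite big1 // => r _; rewrite IH; first last.
  + by move: sw es => /=; lia.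
  + by move=> r' /s2/wL.
  by rewrite (_ : size u2 == d = false) ?mulr0 //; move: sw es => /=; lia.
Qed.

(** The independence part of PBW. Applied to a relation with words of length at most [d], the
    functional of [symbol_functional] sees the top words only and returns $d!$ times their value. *)
Lemma symbol_toU0 T d : nletters valid T -> all (fun e => size e.2 <= d)%N T ->
  toU t prec T = 0 -> forall v, ev idfun v (ncomp d T) = 0.
Proof.
move=> vT sT T0 v; pose L := undup (flatten [seq e.2 | e <- T]).
have TL e : e \in T -> {subset e.2 <= L}.
  move=> he r hr; rewrite mem_undup; apply/flattenP; exists e.2 => //.
  exact: map_f.
have vL : all valid L.
  apply/allP => r; rewrite mem_undup => /flattenP [_ /mapP [e he ->]].
  exact: (allP (allP vT _ he)).
have [W [rho [phi [x [rhoP lphi h]]]]] := symbol_functional v d vL (undup_uniq _).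
have phi0 : phi 0 = 0.
  by have := lphi (-1) 0 0; rewrite scaler0 addr0 mulN1r addNr.
have : \sum_(e <- T) e.1 * phi (wact rho e.2 x) = 0.
  have := eact_toU rhoP x vT; rewrite T0 (eact0 rhoP).
  move/(congr1 phi); rewrite phi0 => h0; rewrite [RHS]h0; elim: (T) => [|e S IHs].
    by rewrite !big_nil phi0.
  by rewrite !big_cons lphi IHs.
rewrite (eq_big_seq (fun e => (d`!)%:R * (if size e.2 == d then e.1 * evw v e.2 else 0))).
  rewrite -mulr_sumr -big_mkcond /ev big_filter => /eqP.
  by rewrite mulf_eq0 pnatr_eq0 -leqn0 leqNgt fact_gt0 /= => /eqP.
move=> e he; rewrite h; [|exact: TL|exact: (allP sT)].
by case: ifP => _; ring.
Qed.
End Symbol.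

(** * Permutations compatible with a perfect matching *)

Section Matching.
Variable q : nat.
Implicit Types s : 'S_q.*2.

Lemma ltn_partner (x : 'I_q.*2) : (partner x < q.*2)%N.
Proof. by have := ltn_ord x; rewrite /partner; case: ifP; lia. Qed.
Definition pt (x : 'I_q.*2) : 'I_q.*2 := Ordinal (ltn_partner x).
Lemma ptK : involutive pt.
Proof.
move=> x; apply: val_inj => /=; rewrite /partner.
by have [o|o] := boolP (odd x); case: ifP; lia.
Qed.
Lemma odd_pt x : odd (pt x) = ~~ odd x.
Proof. by rewrite /= /partner; case: ifP; lia. Qed.
Lemma pt_neq x : pt x != x.
Proof. by apply/eqP => /(congr1 val) /=; rewrite /partner; case: ifP; lia. Qed.
Lemma pt_odbl i : pt (odbl i) = odbl1 i.
Proof. by apply: val_inj => /=; rewrite /partner odd_double. Qed.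
Lemma pt_odbl1 i : pt (odbl1 i) = odbl i.
Proof. by rewrite -pt_odbl ptK. Qed.
Lemma ord_dblP (x : 'I_q.*2) : exists i, x = odbl i \/ x = odbl1 i.
Proof.
have lt : (x./2 < q)%N by have := ltn_ord x; lia.
exists (Ordinal lt); have [o|o] := boolP (odd x); [right|left];
  by apply: val_inj => /=; lia.
Qed.
Lemma odbl_inj : injective (@odbl q).
Proof. by move=> i j /(congr1 val) /= e; apply: val_inj => /=; lia. Qed.

Definition matched s := forall x, s (pt x) = pt (s x).

Lemma matchedP s : (forall i, s (odbl1 i) = pt (s (odbl i))) -> matched s.
Proof.
move=> h x; have [i [->|->]] := ord_dblP x; first by rewrite pt_odbl.
by rewrite pt_odbl1 h ptK.
Qed.

Lemma matched_tperm2 s x y : matched s -> y != x -> y != pt x ->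
  matched (s * (tperm x y * tperm (pt x) (pt y))).
Proof.
move=> h nyx nyp; have nyp' : pt y != x by apply: contraNneq nyp => <-; rewrite ptK.
have nypp : pt y != pt x by rewrite (can_eq ptK).
have t1 : tperm x y (pt x) = pt x by rewrite tpermD // eqtype.eq_sym pt_neq.
have t2 : tperm x y (pt y) = pt y by rewrite tpermD // eqtype.eq_sym // pt_neq.
have t3 : tperm (pt x) (pt y) x = x by rewrite tpermD // pt_neq.
have t4 : tperm (pt x) (pt y) y = y by rewrite tpermD ?pt_neq // eqtype.eq_sym.
move=> z; rewrite !permM h; move: (s z) => w.
have [->|nx] := eqVneq w x; first by rewrite t1 !tpermL t4.
have [->|ny] := eqVneq w y; first by rewrite t2 !tpermR t3.
have [->|npx] := eqVneq w (pt x); first by rewrite t1 ptK !tpermL t4 ptK.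
have [->|npy] := eqVneq w (pt y); first by rewrite t2 ptK !tpermR t3 ptK.
rewrite [tperm x y w]tpermD 1?eqtype.eq_sym // [tperm (pt x) (pt y) w]tpermD 1?eqtype.eq_sym //.
rewrite [tperm x y (pt w)]tpermD; first last.
- by apply: contraNneq npy => ->; rewrite ptK.
- by apply: contraNneq npx => ->; rewrite ptK.
by rewrite tpermD // (can_eq ptK) eqtype.eq_sym.
Qed.

(** Induction on the number of moved points. Exchanging [x] with [s x] and, at the same time, their
    partners is an even permutation that preserves the matching; afterwards [x] is fixed, along with
    all points fixed before. *)
Lemma even_matched s : matched s -> (forall i, ~~ odd (s (odbl i))) -> s = false :> bool.
Proof.
have [n] := ubnP #|[set x | s x != x]|; elim: n s => // n IH s lt hs ev.
have odE x : odd (s x) = odd x.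
  have [i [->|->]] := ord_dblP x; first by rewrite (negbTE (ev i)) /= odd_double.
  by rewrite -pt_odbl hs !odd_pt (ev i) /= odd_double.
have [/existsP [i ne]|none] := boolP [exists i, s (odbl i) != odbl i]; last first.
  suff -> : s = 1%g by rewrite odd_perm1.
  have fx i : s (odbl i) = odbl i.
    by apply/eqP; apply: contraNT none => ?; apply/existsP; exists i.
  apply/permP => x; rewrite perm1; have [i [->|->]] := ord_dblP x; first exact: fx.
  by rewrite -pt_odbl hs fx.
pose x := odbl i; pose y := s x; rewrite -/x in ne.
have nyp : y != pt x.
  by apply/eqP => /(congr1 (odd \o val)) /=; rewrite odE -[partner _]/(val (pt x)) odd_pt; case: odd.
pose s' := (s * (tperm x y * tperm (pt x) (pt y)))%g.
have : s' = false :> bool.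
  apply: IH; last 2 first.
  - exact: matched_tperm2.
  - move=> j; rewrite !permM.
    have oxy : odd y = odd x by rewrite /y odE.
    have par a b c : odd (a : 'I_q.*2) = odd (b : 'I_q.*2) -> odd (tperm a b c) = odd c.
      by case: tpermP => // ->.
    by rewrite par ?par ?ev // ?odd_pt oxy.
  rewrite -ltnS (leq_trans _ lt) //; apply: proper_card; apply/properP; split.
    apply/subsetP => z; rewrite !inE; apply: contraNneq => e.
    have zx : z != x by apply: contraNneq ne => <-; rewrite e.
    have zy : z != y by apply: contraNneq zx => ezy; apply/eqP/(@perm_inj _ s); rewrite e {1}ezy.
    have zpx : z != pt x.
      by apply/eqP => ez; move: ne; rewrite -(can_eq ptK) -hs -ez e eqxx.
    have zpy : z != pt y.
      apply: contraNneq zpx => ez; apply/eqP/(@perm_inj _ s).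
      by rewrite e {1}ez hs.
    by rewrite !permM e !tpermD // eqtype.eq_sym.
  exists x; rewrite !inE // negbK !permM -/y tpermR tpermD ?pt_neq //.
  by apply: contraNneq nyp => <-; rewrite ptK.
rewrite !odd_permM !odd_tperm (can_eq ptK) [x == y]eqtype.eq_sym ne /=.
by rewrite addbF.
Qed.

(** Exchanging the two ends of one pair reverses both the sign of [s] and one factor of the product.
    Once no pair is reversed, [even_matched] applies. *)
Lemma matched_sign (R : comNzRingType) s : matched s ->
  (-1) ^+ s * \prod_(i < q) (if odd (s (odbl i)) then -1 else 1) = 1 :> R.
Proof.
have [n] := ubnP #|[set i : 'I_q | odd (s (odbl i))]|; elim: n s => // n IH s lt hs.
have [/existsP [i oi]|none] := boolP [exists i : 'I_q, odd (s (odbl i))]; last first.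
  have ev i : ~~ odd (s (odbl i)) by apply: contraNN none => ?; apply/existsP; exists i.
  by rewrite even_matched // mul1r big1 // => i _; rewrite (negbTE (ev i)).
pose y := s (odbl i); pose s' := (s * tperm y (pt y))%g.
have s'E j : s' (odbl j) = if j == i then pt y else s (odbl j).
  rewrite permM; case: eqP => [->|/eqP ne]; first by rewrite tpermL.
  rewrite tpermD // /y.
    by apply: contraNneq ne => /perm_inj /odbl_inj ->.
  rewrite -hs pt_odbl; apply/eqP => /perm_inj /(congr1 (odd \o val)) /=.
  by rewrite !odd_double.
have hs' : matched s'.
  move=> x; rewrite !permM hs; move: (s x) => w.
  case: (tpermP y (pt y) w) => [->|->|n1 n2]; rewrite ?tpermR ?ptK ?tpermL //.
  rewrite tpermD //; last by rewrite (can_eq ptK); apply/eqP => e; apply: n1.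
  by apply/eqP => e; apply: n2; rewrite e ptK.
have e : (-1) ^+ s' * \prod_(j < q) (if odd (s' (odbl j)) then -1 else 1) = 1 :> R.
  apply: IH => //; rewrite -ltnS (leq_trans _ lt) //; apply: proper_card; apply/properP; split.
    by apply/subsetP => j; rewrite !inE s'E; case: eqP => // ->; rewrite odd_pt oi.
  by exists i; rewrite !inE ?s'E ?eqxx ?odd_pt ?oi.
rewrite -[RHS]e odd_permM odd_tperm [y == _]eqtype.eq_sym pt_neq /= addbT.
rewrite !(bigD1 i (P := xpredT)) //= s'E eqxx odd_pt -/y oi /=.
rewrite [in RHS](eq_bigr (fun j : 'I_q => if odd (s (odbl j)) then -1 else 1)); last first.
  by move=> j /negbTE ne; rewrite s'E ne.
by case: (s : bool) => /=; rewrite ?expr0 ?expr1; ring.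
Qed.
End Matching.

(** * Determinants and Pfaffians under elementary operations *)

Section Determinants.
Variable A : comNzRingType.
Implicit Types X : nat -> nat -> A.

(** The columns are reversed as in the generators $\Delta_q$; this changes a leading minor only by
    the sign of [rev_perm]. *)
Definition rdet q X : A := \det (\matrix_(r < q, s < q) X r (q.-1 - s)%N).

Lemma rev_col_inj q : injective (fun s : 'I_q => rev_ord s).
Proof. exact: rev_ord_inj. Qed.
Definition rev_perm q : 'S_q := perm (@rev_col_inj q).

Lemma rdetE q X : rdet q X = (-1) ^+ rev_perm q * \det (\matrix_(r < q, s < q) X r s).
Proof.
rewrite /rdet (_ : \matrix_(r, s) _ = col_perm (rev_perm q) (\matrix_(r < q, s < q) X r s)).
  by rewrite col_permE det_mulmx det_perm odd_permV mulrC.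
apply/matrixP => r s; rewrite !mxE permE /=; congr (X r _).
by have := ltn_ord s; lia.
Qed.

(** The elementary operations again, now over a commutative ring: they will be applied with a formal
    parameter from [{poly F}]. *)
Definition rowopA a c X := fun i j => X i j + c i * X a j : A.
Definition colopA a c X := fun i j => X i j + c j * X i a : A.

(** Multiplication by a unipotent triangular matrix. If row [a] lies beyond the corner, the
    condition on [c] makes the operation trivial on it. *)
Lemma det_rowop q a c X : (forall i, (i <= a)%N -> c i = 0) ->
  \det (\matrix_(r < q, s < q) rowopA a c X r s) = \det (\matrix_(r < q, s < q) X r s).
Proof.
move=> hc; pose E : 'M[A]_q := \matrix_(i, k) ((i == k)%:R + c i * (val k == a)%:R).
have dE : \det E = 1.
  rewrite det_trig; last first.
    apply/is_trig_mxP => i k lt; rewrite mxE (_ : (i == k) = false) ?add0r; last first.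
      by apply/eqP => e; rewrite e ltnn in lt.
    by case: eqP => [e|_]; rewrite ?mulr0 // hc ?mul0r // -e ltnW.
  rewrite big1 // => i _; rewrite mxE eqxx; case: eqP => [e|_]; rewrite ?mulr0 ?addr0 //.
  by rewrite hc ?e // mul0r addr0.
have -> : \matrix_(r < q, s < q) rowopA a c X r s = E *m \matrix_(r < q, s < q) X r s.
  apply/matrixP => r s; rewrite !mxE /rowopA.
  under eq_bigr do rewrite !mxE mulrDl.
  rewrite big_split /= (bigD1 r) //= eqxx mul1r big1 ?addr0; last first.
    by move=> k ne; rewrite eqtype.eq_sym (negbTE ne) mul0r.
  congr (_ + _); have [lt|ge] := ltnP a q.
    rewrite (bigD1 (Ordinal lt)) //= eqxx mulr1 big1 ?addr0 // => k ne.
    by rewrite (_ : (val k == a) = false) ?mulr0 ?mul0r //; apply/eqP => e; case/eqP: ne; apply: val_inj.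
  rewrite big1 => [|k _]; last by rewrite (ltn_eqF (leq_trans (ltn_ord k) ge)) mulr0 mul0r.
  by rewrite hc ?mul0r //; have := ltn_ord r; lia.
by rewrite det_mulmx dE mul1r.
Qed.

Lemma rdet_rowop q a c X : (forall i, (i <= a)%N -> c i = 0) ->
  rdet q (rowopA a c X) = rdet q X.
Proof. by move=> h; rewrite !rdetE det_rowop. Qed.
Lemma rdet_colop q a c X : (forall i, (i <= a)%N -> c i = 0) ->
  rdet q (colopA a c X) = rdet q X.
Proof.
move=> h; rewrite !rdetE; congr (_ * _).
have tr (Y : nat -> nat -> A) :
    \det (\matrix_(r < q, s < q) Y r s) = \det (\matrix_(r < q, s < q) Y s r).
  by rewrite -det_tr; congr (\det _); apply/matrixP => i j; rewrite !mxE.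
by rewrite tr [RHS]tr -(@det_rowop q a c (fun i j => X j i)).
Qed.

Definition congA a c X := fun i j =>
  X i j + c i * X a j + c j * X i a + c i * c j * X a a : A.

Lemma rdet_cong q a c X : (forall i, (i <= a)%N -> c i = 0) ->
  rdet q (congA a c X) = rdet q X.
Proof.
move=> h; rewrite -(@rdet_rowop q a c X) // -(@rdet_colop q a c (rowopA a c X)) //.
by congr (\det _); apply/matrixP => i j; rewrite !mxE /congA /colopA /rowopA; ring.
Qed.

Lemma rdet_diag q (d : nat -> A) :
  rdet q (fun i j => if i == j then d i else 0) = (-1) ^+ rev_perm q * \prod_(i < q) d i.
Proof.
rewrite rdetE (_ : \matrix_(r, s) _ = diag_mx (\row_(i < q) d i)); last first.
  by apply/matrixP => i j; rewrite !mxE; case: eqP => [/val_inj ->|ne];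
     rewrite ?eqxx ?mulr1n // (_ : (i == j) = false) ?mulr0n //; apply/eqP => e; case: ne; rewrite e.
by rewrite det_diag; congr (_ * _); apply: eq_bigr => i _; rewrite mxE.
Qed.

Lemma eq_rdet q X Y : (forall i j, (i < q)%N -> (j < q)%N -> X i j = Y i j) -> rdet q X = rdet q Y.
Proof.
move=> h; congr (\det _); apply/matrixP => i j; rewrite !mxE h //.
by have := ltn_ord j; lia.
Qed.
End Determinants.

Section Pfaffians.
Variables (F : numFieldType) (A : comNzRingType) (iota : {rmorphism F -> A}).
Implicit Types X : nat -> nat -> A.

Definition rpf q X : A := iota (((2 ^ q * q`!)%:R)^-1) *
  \sum_(s : 'S_q.*2) (-1) ^+ s * \prod_(i < q) X (s (odbl i)) (s (odbl1 i)).

Lemma eq_rpf q X Y : (forall i j, (i < q.*2)%N -> (j < q.*2)%N -> X i j = Y i j) ->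
  rpf q X = rpf q Y.
Proof.
move=> h; congr (_ * _); apply: eq_bigr => s _; congr (_ * _).
by apply: eq_bigr => i _; rewrite h.
Qed.

(** Composition with the transposition of [a] and [b] reverses the sign and leaves each product
    unchanged, because both values are read as [a]; then 2 is cancelled through [iota]. *)
Lemma alternating_sum0 q (a b : 'I_q.*2) X : a != b ->
  \sum_(s : 'S_q.*2) (-1) ^+ s * \prod_(i < q)
     X (if s (odbl i) == b then a else s (odbl i)) (if s (odbl1 i) == b then a else s (odbl1 i)) = 0.
Proof.
move=> ab; set S := \sum_(s : _) _.
have rt x : (if tperm a b x == b then a else tperm a b x) = (if x == b then a else x).
  case: tpermP => [->|->|n1 n2]; rewrite ?eqxx ?(negbTE ab) //.
have SN : S = - S.
  rewrite {1}/S (reindex_inj (mulIg (tperm a b))) /= -sumrN; apply: eq_bigr => s _.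
  rewrite odd_permM odd_tperm ab addbT -mulNr; congr (_ * _).
    by case: (s : bool) => /=; rewrite ?expr0 ?expr1 ?opprK.
  by apply: eq_bigr => i _; rewrite !permM !rt.
have : S + S = 0 by rewrite {1}SN addNr.
have two : iota 2 * iota 2^-1 = 1 by rewrite -rmorphM mulfV ?rmorph1 // pnatr_eq0.
rewrite -mulr2n -mulr_natl => /(congr1 (fun x => iota 2^-1 * x)).
by rewrite mulr0 mulrA [_ * 2%:R]mulrC -(rmorph_nat iota) two mul1r.
Qed.

(** One row at a time: [b] occurs in exactly one factor of each product and only once in it, so the
    change is linear in [u]. Its coefficient is the sum with [b] replaced by [a], which vanishes by
    [alternating_sum0]. *)
Lemma rpf_cong q a b u X : (a < b)%N ->
  rpf q (congA a (fun i => if i == b then u else 0) X) = rpf q X.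
Proof.
move=> ab; have [le|lt] := leqP q.*2 b.
  apply: eq_rpf => i j lti ltj; rewrite /congA.
  have -> : (i == b) = false by lia.
  have -> : (j == b) = false by lia.
  by ring.
pose b' := Ordinal lt; have lta : (a < q.*2)%N by exact: (ltn_trans ab lt).
pose a' := Ordinal lta.
have ab' : a' != b' by apply/eqP => /(congr1 val) /=; lia.
rewrite /rpf; congr (_ * _).
set S := \sum_(s : _) _; set S' := \sum_(s : _) _.
suff -> : S = S' + u * \sum_(s : 'S_q.*2) (-1) ^+ s * \prod_(i < q)
     X (if s (odbl i) == b' then a' else s (odbl i)) (if s (odbl1 i) == b' then a' else s (odbl1 i)).
  by rewrite alternating_sum0 // mulr0 addr0.
rewrite {}/S {}/S' mulr_sumr -big_split /=; apply: eq_bigr => s _.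
rewrite mulrCA -mulrDr; congr (_ * _).
have vE x : (x == b') = (val x == b) by [].
have [i0 hi0] := ord_dblP (s^-1 b')%g.
have other i : i != i0 -> (s (odbl i) != b') /\ (s (odbl1 i) != b').
  move=> nei; split; apply/eqP => e; move: hi0; rewrite -e permK => -[].
  - by move/odbl_inj => e'; rewrite e' eqxx in nei.
  - by move/(congr1 val) => /=; lia.
  - by move/(congr1 val) => /=; lia.
  - by move/(congr1 val) => /= e'; case/eqP: nei; apply: val_inj => /=; lia.
have d01 i : s (odbl i) != s (odbl1 i).
  by apply/eqP => /perm_inj/(congr1 val) /=; lia.
rewrite (bigD1 i0) //= [X in _ = X + _](bigD1 i0) //= [X in _ = _ + _ * X](bigD1 i0) //=.
have R1 : \prod_(i < q | i != i0) congA a (fun i => if i == b then u else 0) X (s (odbl i)) (s (odbl1 i))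
  = \prod_(i < q | i != i0) X (s (odbl i)) (s (odbl1 i)).
  apply: eq_bigr => i /other [n1 n2]; rewrite /congA; move: n1 n2; rewrite !vE => /negbTE -> /negbTE ->.
  by ring.
have R2 : \prod_(i < q | i != i0)
    X (if s (odbl i) == b' then a' else s (odbl i)) (if s (odbl1 i) == b' then a' else s (odbl1 i))
  = \prod_(i < q | i != i0) X (s (odbl i)) (s (odbl1 i)).
  by apply: eq_bigr => i /other [/negbTE -> /negbTE ->].
rewrite R1 R2 mulrA -mulrDl; congr (_ * _); rewrite /congA !vE.
have [e|e] : s (odbl i0) = b' \/ s (odbl1 i0) = b'.
  by case: hi0 => <-; rewrite permKV; [left|right].
- have := d01 i0; rewrite e eqtype.eq_sym vE => /negbTE ->; rewrite /= eqxx /=; ring.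
- have := d01 i0; rewrite e vE => /negbTE ->; rewrite /= eqxx /=; ring.
Qed.

(** Only permutations that map pairs to pairs contribute, and by [matched_sign] they all contribute
    the same product. The identity is one of them, so their number makes [c] nonzero. *)
Lemma rpf_slice q : exists2 c : F, c != 0 & forall d : nat -> A,
  rpf q (fun i j => if j == partner i then if odd i then - d i./2 else d i./2 else 0)
  = iota c * \prod_(i < q) d i.
Proof.
pose M := [set s : 'S_q.*2 | [forall i, s (odbl1 i) == pt (s (odbl i))]].
have M1 : 1%g \in M by rewrite inE; apply/forallP => i; rewrite !perm1 pt_odbl.
exists (((2 ^ q * q`!)%:R)^-1 * (#|M|)%:R).
  rewrite mulf_neq0 ?invr_eq0 ?pnatr_eq0 -?lt0n ?muln_gt0 ?expn_gt0 ?fact_gt0 //.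
  by apply/card_gt0P; exists 1%g.
move=> d; rewrite rmorphM rmorph_nat -mulrA; congr (_ * _).
rewrite (bigID (mem M)) /= addrC big1 ?add0r; last first.
  move=> s; rewrite inE negb_forall => /existsP [i ne].
  rewrite (bigD1 i) //= (_ : (_ == partner _) = false) ?mul0r ?mulr0 //.
  by apply: contraNF ne => /eqP e; apply/eqP/val_inj.
rewrite mulr_natl -sumr_const; apply: eq_bigr => s; rewrite inE => /forallP hs.
have ms : matched s by apply: matchedP => i; apply/eqP.
have hl i : ((s (odbl i))./2 < q)%N by have := ltn_ord (s (odbl i)); lia.
(* The permutation of the pairs induced by [s]; it reindexes the product of the [d i]. *)
pose p i : 'I_q := Ordinal (hl i).
have p_inj : injective p.
  move=> i j /(congr1 val) /= e; apply: odbl_inj; apply: (@perm_inj _ s).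
  have [o|o] := eqVneq (odd (s (odbl i))) (odd (s (odbl j))); first by apply: val_inj => /=; lia.
  have : s (odbl i) = pt (s (odbl j)).
    by apply: val_inj => /=; rewrite /partner; move: o; case: ifP; lia.
  by rewrite -ms pt_odbl => /perm_inj/(congr1 val) /=; lia.
rewrite -[RHS]mul1r -[X in _ = X * _](matched_sign A ms) -mulrA; congr (_ * _).
rewrite [\prod_(i < q) d i](reindex_inj p_inj) /= -big_split /=; apply: eq_bigr => i _.
rewrite (eqP (hs i)) eqxx; case: ifP => _; ring.
Qed.
End Pfaffians.

(** * Finite initial and final segments of the order, and the cascade *)

Section Initial.
Variable gt : rel nat.
Hypothesis so : strict_order gt.

Lemma so_rev : strict_order (fun i j => gt j i).
Proof.
split=> [i|j i k h1 h2|i j ne]; [exact: so_irr|exact: so_trans h2 h1|].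
by rewrite orbC; apply: so_total.
Qed.

Definition decseq n (a : nat -> nat) := forall r s, (r < s < n)%N -> gt (a r) (a s).
(** The [n] largest elements in decreasing order. Final segments are obtained from the reversed
    order. *)
Definition topseq n (a : nat -> nat) := decseq n a /\
  forall r x, (r < n)%N -> gt x (a r) -> exists2 r', (r' < r)%N & a r' = x.

Lemma topseq_le n m a : (m <= n)%N -> topseq n a -> topseq m a.
Proof.
move=> le [d u]; split=> [r s /andP [h1 h2]|r x lt]; first by apply: d; rewrite h1 (leq_trans h2).
by apply: u; apply: leq_trans le.
Qed.

Lemma decseq_inj n a : decseq n a -> forall r s, (r < n)%N -> (s < n)%N -> a r = a s -> r = s.
Proof.
move=> d r s hr hs e; case: (ltngtP r s) => // lt.
  by have := d r s; rewrite lt hs e (so_irr so) => /(_ isT).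
by have := d s r; rewrite lt hr e (so_irr so) => /(_ isT).
Qed.

Lemma decseq_lt n a : decseq n a -> forall r s, (r < n)%N -> (s < n)%N ->
  gt (a r) (a s) = (r < s)%N.
Proof.
move=> d r s hr hs; case: (ltngtP r s) => [lt|lt|->].
- by apply: d; rewrite lt.
- by apply: (so_asym so); apply: d; rewrite lt.
- exact: so_irr.
Qed.

Lemma decseq_unique n a b : decseq n a -> decseq n b ->
  (forall x, (exists2 r, (r < n)%N & a r = x) <-> (exists2 r, (r < n)%N & b r = x)) ->
  forall r, (r < n)%N -> a r = b r.
Proof.
move=> da db e.
have srt c : decseq n c -> sorted gt [seq c i | i <- iota 0 n].
  move=> dc; rewrite sorted_map; apply: (@sub_in_sorted _ [pred x | x < n]%N ltn).
  - by move=> r s _ hs lt; apply: dc; apply/andP; split; [exact: lt|exact: hs].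
  - by apply/allP => x; rewrite mem_iota.
  - exact: iota_ltn_sorted.
have eqs : [seq a i | i <- iota 0 n] = [seq b i | i <- iota 0 n].
  apply: (irr_sorted_eq (leT := gt)); [|exact: so_irr|exact: srt|exact: srt|].
    by move=> y x z; apply: so_trans.
  move=> x; apply/mapP/mapP => -[r]; rewrite mem_iota add0n => hr ->.
    have [|r' hr' <-] := (e (a r)).1; first by exists r.
    by exists r'; rewrite ?mem_iota.
  have [|r' hr' <-] := (e (b r)).2; first by exists r.
  by exists r'; rewrite ?mem_iota.
move=> r hr; have := congr1 (fun s => nth 0%N s r) eqs.
by rewrite !(nth_map 0%N) ?size_iota // nth_iota.
Qed.

Definition ext (n : nat) (a : nat -> nat) i r := if (r < n)%N then a r else i.

Lemma topseq_ext n a i : topseq n a ->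
  (forall r, (r < n)%N -> a r <> i) ->
  (forall x, (forall r, (r < n)%N -> a r <> x) -> x <> i -> gt i x) ->
  topseq n.+1 (ext n a i).
Proof.
move=> [d u] ni hi; split=> [r s /andP [lt]|r x].
  rewrite ltnS leq_eqVlt => /orP [/eqP es|ls]; last first.
    by rewrite /ext (ltn_trans lt ls) ls; apply: d; rewrite lt.
  have lr : (r < n)%N by rewrite -es.
  rewrite /ext lr es ltnn; have /(so_total so) /orP [//|g] : a r != i by apply/eqP/ni.
  by have [r' lt' /(ni _ (ltn_trans lt' lr))] := u _ _ lr g.
rewrite ltnS leq_eqVlt => /orP [/eqP ->|lr].
  rewrite {1}/ext ltnn => g; apply: contrapT => none.
  have : gt i x; last by rewrite (so_asym so g).
  apply: hi => [r' lt' e|e]; last by rewrite e (so_irr so) in g.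
  by apply: none; exists r' => //; rewrite /ext lt'.
rewrite {1}/ext lr => /(u _ _ lr) [r' lt' <-]; exists r' => //.
by rewrite /ext (ltn_trans lt' lr).
Qed.

(** The longest initial segment inside [M]: sort those elements of [M] above which there is nothing
    outside [M]. For each other element of [M] an index above it and outside [M] exists; it later
    serves as fresh index. *)
Lemma topseq_of (M : seq nat) : exists n a, [/\ topseq n a,
  (forall r, (r < n)%N -> a r \in M) &
  forall x, x \in M -> (forall r, (r < n)%N -> a r <> x) -> exists2 k, k \notin M & gt k x].
Proof.
pose ge i j := (i == j) || gt i j.
have ge_tot : total ge.
  move=> i j; rewrite /ge; have [->//|ne] := eqVneq i j.
  by rewrite /= so_total.
have ge_tr : transitive ge.
  move=> j i k /orP [/eqP -> //|g] /orP [/eqP <-|g']; rewrite /ge ?g ?orbT //.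
  by rewrite (so_trans so g g') orbT.
pose s := sort ge [seq x <- undup M | `[< forall k, gt k x -> k \in M >]].
have us : uniq s by rewrite sort_uniq filter_uniq // undup_uniq.
have ms x : (x \in s) = `[< forall k, gt k x -> k \in M >] && (x \in M).
  by rewrite mem_sort mem_filter mem_undup.
have ds : decseq (size s) (nth 0%N s).
  move=> r r' /andP [lt lt']; have : ge (nth 0%N s r) (nth 0%N s r').
    apply: (sorted_leq_nth ge_tr _ 0%N (sort_sorted ge_tot _)) => //; rewrite ?inE.
    - by move=> i; rewrite /ge eqxx.
    - exact: ltn_trans lt'.
    - exact: ltnW.
  case/orP=> // /eqP /eqP; rewrite nth_uniq // ?(ltn_trans lt lt') // => /eqP e.
  by rewrite e ltnn in lt.
exists (size s), (nth 0%N s); split; last first.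
- move=> x xM nx; apply: contrapT => none.
  have xs : x \in s.
    rewrite ms xM andbT; apply/asboolP => k g; apply/negPn/negP => kM.
    by apply: none; exists k.
  by apply: (nx (index x s)); rewrite ?index_mem ?nth_index.
- by move=> r lt; have := mem_nth 0%N lt; rewrite ms => /andP [].
- split=> // r x lt g; have := mem_nth 0%N lt; rewrite ms => /andP [/asboolP h _].
  have xs : x \in s.
    rewrite ms (h _ g) andbT; apply/asboolP => k g'; apply: h; exact: so_trans g' g.
  exists (index x s); last by rewrite nth_index.
  have ls : (index x s < size s)%N by rewrite index_mem.
  rewrite -(decseq_lt ds ls lt) nth_index //.
Qed.
End Initial.

Lemma fresh_nat (M : seq nat) : exists k, k \notin M.
Proof.
exists (\max_(x <- M) x).+1; apply/negP => h.
by have := leq_bigmax_seq (P := xpredT) (F := id) _ h isT; rewrite ltnn.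
Qed.

Section CascadeTop.
Variables (t : ctype) (prec : rel sel).
Local Notation gt := (gtth t prec).
Hypothesis so : strict_order gt.

Lemma is_max_unique S i j : is_max t prec S i -> is_max t prec S j -> i = j.
Proof.
move=> [ni hi] [nj hj]; apply: contrapT => ne.
have := so_asym so (hi j nj (fun e => ne (esym e))).
by rewrite (hj i ni ne).
Qed.
Lemma is_min_unique S i j : is_min t prec S i -> is_min t prec S j -> i = j.
Proof.
move=> [ni hi] [nj hj]; apply: contrapT => ne.
have := so_asym so (hi j nj (fun e => ne (esym e))).
by rewrite (hj i ni ne).
Qed.

Definition first n (a : nat -> nat) (x : nat) := exists2 r, (r < n)%N & a r = x.

Lemma is_max_top n a S : topseq gt n.+1 a -> (forall x, S x <-> first n a x) ->
  is_max t prec S (a n).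
Proof.
move=> [d u] hS; split.
  move/hS => [r lt er]; have e := decseq_inj so d (leqW lt) (ltnSn n) er.
  by rewrite e ltnn in lt.
move=> s ns ne; have /(so_total so) /orP [g|//] : s != a n by apply/eqP.
by have [r lt e] := u _ _ (ltnSn n) g; case: ns; apply/hS; exists r.
Qed.

Lemma first_ext n a i x : first n.+1 (ext n a i) x <-> first n a x \/ x = i.
Proof.
split=> [[r]|[[r lt <-]|->]].
- rewrite ltnS leq_eqVlt /ext => /orP [/eqP ->|lt]; first by rewrite ltnn => <-; right.
  by rewrite lt => <-; left; exists r.
- by exists r; [exact: leqW|rewrite /ext lt].
- by exists n => //; rewrite /ext ltnn.
Qed.
Lemma first_rec n a x : first n.+1 a x <-> first n a x \/ x = a n.
Proof.
split=> [[r]|[[r lt <-]|->]]; last by exists n.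
- rewrite ltnS leq_eqVlt => /orP [/eqP ->|lt] <-; [by right|by left; exists r].
- by exists r => //; apply: leqW.
Qed.

Lemma max_ext n a S i : topseq gt n a -> (forall x, S x <-> first n a x) ->
  is_max t prec S i -> topseq gt n.+1 (ext n a i).
Proof.
move=> ta hS [ni hi]; apply: topseq_ext => // [r lt e|x hx ne].
  by apply: ni; apply/hS; exists r.
by apply: hi => // /hS [r lt /hx]; apply.
Qed.

(** Number of indices that one step of the cascade consumes, in types B, C and D. *)
Definition rate := if ctype_eqb t TC then 1%N else 2%N.

(** Maximal elements are unique, so each step of the cascade has to take the next [rate] elements of
    the segment. *)
Lemma Nset_top (nA : ~~ ctype_eqb t TA) n a : topseq gt n a ->
  forall q, (q * rate <= n)%N -> forall x, Nset t prec q x <-> first (q * rate) a x.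
Proof.
move=> ta; elim=> [|q IH] le x; first by split=> [|[]].
have le' : (q * rate <= n)%N by apply: leq_trans le; rewrite leq_pmul2r // /rate; case: ifP.
have {}IH := IH le'; rewrite /Nset iterS -/(Nset t prec q) /cstep.
have [tC|tBD] := boolP (ctype_eqb t TC).
  move: le le' IH; rewrite /rate tC !muln1 => le le' IH; rewrite first_rec.
  have mx := is_max_top (topseq_le le ta) IH.
  have E : (Nset t prec q x \/ exists i, is_max t prec (Nset t prec q) i /\ x = i) <->
      first q a x \/ x = a q.
    split=> [[/IH|[i [hi ->]]]|[/IH|->]]; auto; last by right; exists (a q).
    by right; apply: is_max_unique hi mx.
  by move: tC E; case: (t).
move: le le' IH; rewrite /rate (negbTE tBD) !muln2 => le le' IH; rewrite doubleS !first_rec.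
have mx := is_max_top (topseq_le (ltnW le) ta) IH.
have mx2 : is_max t prec (fun s => Nset t prec q s \/ s = a q.*2) (a q.*2.+1).
  apply: is_max_top (topseq_le le ta) _ => y; rewrite first_rec; split=> -[/IH|]; auto.
have E : (Nset t prec q x \/ exists i j, is_max t prec (Nset t prec q) i /\
    is_max t prec (fun s => Nset t prec q s \/ s = i) j /\ (x = i \/ x = j)) <->
    (first q.*2 a x \/ x = a q.*2) \/ x = a q.*2.+1.
  split=> [[/IH|[i [j [h1 [h2 h3]]]]]|[[/IH|]|]]; auto.
  - have ei := is_max_unique h1 mx; rewrite ei in h2 h3.
    by rewrite (is_max_unique h2 mx2) in h3; case: h3; auto.
  - by move=> ->; right; exists (a q.*2), (a q.*2.+1); auto.
  - by move=> ->; right; exists (a q.*2), (a q.*2.+1); auto.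
by move: nA tBD E; case: (t).
Qed.

Lemma top_cascade (nA : ~~ ctype_eqb t TA) n a k : topseq gt n a -> (k * rate <= n)%N ->
  cascade_ge t prec k.
Proof.
move=> ta le [//|q] /andP [_ lt].
have r0 : (0 < rate)%N by rewrite /rate; case: ifP.
have leq1 : (q.+1 * rate <= n)%N by apply: leq_trans le; rewrite leq_pmul2r.
have lt1 : (q * rate < q.+1 * rate)%N by rewrite ltn_pmul2r.
exists (a (q * rate)%N); split.
  by apply/(Nset_top nA ta leq1); exists (q * rate)%N.
move/(Nset_top nA ta (leq_trans (ltnW lt1) leq1)) => [r lr e].
have := decseq_inj so ta.1 (leq_trans (ltn_trans lr lt1) leq1) (leq_trans lt1 leq1) e.
by move=> er; rewrite er ltnn in lr.
Qed.

(** A step that grows exhibits the maximal elements of the complement, and these prolong the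
    segment. *)
Lemma cascade_top (nA : ~~ ctype_eqb t TA) k : cascade_ge t prec k ->
  exists a, topseq gt (k * rate) a.
Proof.
elim: k => [_|q IH hc]; first by exists id; rewrite mul0n; split=> r s; rewrite ?ltn0 ?andbF.
have [|a ta] := IH; first by move=> j /andP [h1 h2]; apply: hc; rewrite h1 ltnW.
have hS := Nset_top nA ta (leqnn _).
have [x [hx nx]] : grows t prec q.+1 by apply: hc; apply/andP; split.
move: hx; rewrite /Nset iterS -/(Nset t prec q) /cstep => -[//|].
have [tC|tBD] := boolP (ctype_eqb t TC).
  suff : (exists i, is_max t prec (Nset t prec q) i /\ x = i) ->
     exists a, topseq gt (q.+1 * rate) a by move: tC; case: (t).
  move=> [i [mi _]]; exists (ext (q * rate) a i).
  by have := max_ext ta hS mi; rewrite /rate tC !muln1.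
suff : (exists i j, is_max t prec (Nset t prec q) i /\
    is_max t prec (fun s => Nset t prec q s \/ s = i) j /\ (x = i \/ x = j)) ->
     exists a, topseq gt (q.+1 * rate) a by move: nA tBD; case: (t).
move=> [i [j [mi [mj _]]]]; have t1 := max_ext ta hS mi.
exists (ext (q * rate).+1 (ext (q * rate) a i) j).
have := max_ext t1 _ mj; rewrite /rate (negbTE tBD) !muln2 doubleS; apply=> y.
rewrite first_ext; have := hS y; rewrite /rate (negbTE tBD) muln2 => h.
by split=> -[/h|]; auto.
Qed.

Local Notation lt' := (fun i j => gt j i).

(** Infinitely many indices exist, so some [k] avoids both segments; it lies below every [a r] and
    above every [b s]. *)
Lemma top_bot_disjoint n m a b : topseq gt n a -> topseq lt' m b ->
  forall r s, (r < n)%N -> (s < m)%N -> gt (a r) (b s).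
Proof.
move=> ta tb r s hr hs; have [k] := fresh_nat ([seq a i | i <- iota 0 n] ++ [seq b i | i <- iota 0 m]).
rewrite mem_cat negb_or => /andP [ka kb].
have ha : gt (a r) k.
  have /(so_total so)/orP [//|/(ta.2 _ _ hr) [r' lr e]] : a r != k.
    by apply: contraNneq ka => <-; apply: map_f; rewrite mem_iota.
  by case/negP: ka; rewrite -e; apply: map_f; rewrite mem_iota /= (ltn_trans lr).
have hb : gt k (b s).
  have /(so_total so)/orP [/(tb.2 _ _ hs) [r' lr e]|//] : b s != k.
    by apply: contraNneq kb => <-; apply: map_f; rewrite mem_iota.
  by case/negP: kb; rewrite -e; apply: map_f; rewrite mem_iota /= (ltn_trans lr).
exact: so_trans ha hb.
Qed.

Section TypeA.
Hypothesis tA : ctype_eqb t TA.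

Lemma topA_max n a b q S : topseq gt n a -> topseq lt' n b -> (q < n)%N ->
  (forall x, S x <-> first q a x \/ first q b x) -> is_max t prec S (a q) /\ is_min t prec S (b q).
Proof.
move=> ta tb lq hS; have dis := top_bot_disjoint ta tb.
split; split.
- move/hS => [[r lr e]|[r lr e]].
    by have er := decseq_inj so ta.1 (ltn_trans lr lq) lq e; rewrite er ltnn in lr.
  by have := dis q r lq (ltn_trans lr lq); rewrite e (so_irr so).
- move=> s ns ne; have /(so_total so)/orP [/(ta.2 _ _ lq) [r lr e]|//] : s != a q by apply/eqP.
  by case: ns; apply/hS; left; exists r.
- move/hS => [[r lr e]|[r lr e]].
    by have := dis r q (ltn_trans lr lq) lq; rewrite e (so_irr so).
  by have er := decseq_inj (so_rev so) tb.1 (ltn_trans lr lq) lq e; rewrite er ltnn in lr.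
- move=> s ns ne; have /(so_total so)/orP [//|/(tb.2 _ _ lq) [r lr e]] : s != b q by apply/eqP.
  by case: ns; apply/hS; right; exists r.
Qed.

Lemma cstepA S x : cstep t prec S x <->
  S x \/ exists i j, is_max t prec S i /\ is_min t prec S j /\ (x = i \/ x = j).
Proof. by move: tA; rewrite /cstep; case: (t). Qed.

Lemma NsetA n a b : topseq gt n a -> topseq lt' n b ->
  forall q, (q <= n)%N -> forall x, Nset t prec q x <-> first q a x \/ first q b x.
Proof.
move=> ta tb; elim=> [|q IH] le x; first by split=> [|[] []].
have {}IH := IH (ltnW le); rewrite /Nset iterS -/(Nset t prec q) cstepA !first_rec.
have [mx mn] := topA_max ta tb le IH; split.
  case=> [/IH []|[i [j [hi [hj h]]]]]; auto.
  rewrite (is_max_unique hi mx) (is_min_unique hj mn) in h; case: h; auto.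
case=> -[h|h]; first by left; apply/IH; left.
- by right; exists (a q), (b q); auto.
- by left; apply/IH; right.
- by right; exists (a q), (b q); auto.
Qed.

Lemma topA_cascade n a b k : topseq gt n a -> topseq lt' n b -> (k <= n)%N -> cascade_ge t prec k.
Proof.
move=> ta tb le [//|q] /andP [_ lt]; have lq := leq_trans lt le.
exists (a q); split; first by apply/(NsetA ta tb lq); left; exists q.
by case: (topA_max ta tb lq (NsetA ta tb (ltnW lq))) => -[].
Qed.

Lemma cascade_topA k : cascade_ge t prec k ->
  exists a b, topseq gt k a /\ topseq lt' k b.
Proof.
elim: k => [_|q IH hc]; first by exists id, id; split; split=> r s; rewrite ?ltn0 ?andbF.
have [|a [b [ta tb]]] := IH; first by move=> j /andP [h1 h2]; apply: hc; rewrite h1 ltnW.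
have hS := NsetA ta tb (leqnn _).
have [x [hx nx]] : grows t prec q.+1 by apply: hc; apply/andP; split.
move: hx; rewrite /Nset iterS -/(Nset t prec q) cstepA => -[//|[i [j [[ni mi] [[nj mj] _]]]]].
have dis := top_bot_disjoint ta tb.
exists (ext q a i), (ext q b j); split; apply: topseq_ext => //.
- by move=> r lr e; apply: ni; apply/hS; left; exists r.
(* Maximality of [i] is known only outside both segments. If [y] belongs to the bottom segment and
   lay above [i], then [i] would belong to that segment too. *)
- move=> y ny ne; have [[r lr e]|nb] := EM (first q b y); last first.
    by apply: mi => // /hS [[r lr /ny]|//]; apply.
  have /(so_total so)/orP [//|] : i != y by apply/eqP => e'; apply: ne.
  rewrite -e => /(tb.2 _ _ lr) [r' lr' e'].
  by case: ni; apply/hS; right; exists r' => //; apply: ltn_trans lr.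
- exact: so_rev.
- by move=> r lr e; apply: nj; apply/hS; right; exists r.
- move=> y ny ne; have [[r lr e]|na] := EM (first q a y); last first.
    by apply: mj => // /hS [//|[r lr /ny]]; apply.
  have /(so_total so)/orP [|//] : j != y by apply/eqP => e'; apply: ne.
  rewrite -e => /(ta.2 _ _ lr) [r' lr' e'].
  by case: nj; apply/hS; left; exists r' => //; apply: ltn_trans lr.
Qed.
End TypeA.
End CascadeTop.

(** * From invariant symbols to generators of the center *)

Section Endgame.
Variables (F : numClosedFieldType) (t : ctype) (prec : rel sel).
Local Notation gt := (gtth t prec).
Hypothesis so : strict_order gt.
Local Notation valid := (valid t prec).
Local Notation expand := (@expand F t prec).
Local Notation coad := (@coad F t prec).
Local Notation br := (@br F t prec).
Local Notation toU := (toU t prec).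
Local Notation cl := (cl t prec).
Implicit Types (T : ncpoly F) (z : term F).

Definition evt (A : comNzRingType) (iota : F -> A) (v : proot -> A) z := ev iota v (expand z).
Definition lett (Q : pred proot) z := nletters Q (expand z).
Definition inv T := forall r v, valid r -> der v (coad r v) T = 0.

Section Evt.
Variables (A : comNzRingType) (iota : {rmorphism F -> A}) (v : proot -> A).
Lemma evt_c c : evt iota v (Tc c) = iota c.
Proof. by rewrite /evt /ev /= big_seq1 /evw big_nil mulr1. Qed.
Lemma evt_g r : valid r -> evt iota v (Tg r) = v r.
Proof.
move=> vr; rewrite /evt /= vr /ev big_seq1 rmorph1 mul1r evw_cons.
by rewrite /evw big_nil mulr1.
Qed.
Lemma evt_add a b : evt iota v (Tadd a b) = evt iota v a + evt iota v b.
Proof. exact: ev_cat. Qed.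
Lemma evt_mul a b : evt iota v (Tmul a b) = evt iota v a * evt iota v b.
Proof. exact: ev_nmul. Qed.
Lemma evt_scale c a : evt iota v (tscale c a) = iota c * evt iota v a.
Proof. by rewrite evt_mul evt_c. Qed.
Lemma evt_tsum s : evt iota v (tsum s) = \sum_(a <- s) evt iota v a.
Proof.
elim: s => [|a s IH]; first by rewrite big_nil evt_c rmorph0.
by rewrite big_cons -IH -evt_add.
Qed.
Lemma evt_tprod s : evt iota v (tprod s) = \prod_(a <- s) evt iota v a.
Proof.
elim: s => [|a s IH]; first by rewrite big_nil evt_c rmorph1.
by rewrite big_cons -IH -evt_mul.
Qed.
Lemma evt_tpow a n : evt iota v (tpow a n) = evt iota v a ^+ n.
Proof.
elim: n => [|n IH]; first by rewrite evt_c rmorph1.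
by rewrite /tpow iterS evt_mul -/(tpow a n) IH exprS.
Qed.
End Evt.

Lemma evt_ueval k (p : {mpoly F[k]}) (g : 'I_k -> term F) v :
  evt idfun v (ueval p g) = p.@[fun i => evt idfun v (g i)].
Proof.
rewrite /ueval evt_tsum big_map mevalE; apply: eq_bigr => m _.
rewrite evt_scale evt_tprod big_map big_enum /=; congr (_ * _).
by apply: eq_bigr => i _; rewrite evt_tpow.
Qed.

Section Letters.
Variable Q : pred proot.
Lemma lett_tsum s : (forall a, List.In a s -> lett Q a) -> lett Q (tsum s).
Proof.
elim: s => [//|a s IH] h; rewrite /lett /= nletters_cat.
by apply/andP; split; [apply: h; left|apply: IH => b hb; apply: h; right].
Qed.
Lemma lett_tprod s : (forall a, List.In a s -> lett Q a) -> lett Q (tprod s).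
Proof.
elim: s => [//|a s IH] h; apply: nletters_nmul; first by apply: h; left.
by apply: IH => b hb; apply: h; right.
Qed.
Lemma lett_scale c a : lett Q a -> lett Q (tscale c a).
Proof. by move=> h; apply: nletters_nmul. Qed.
Lemma lett_tpow a n : lett Q a -> lett Q (tpow a n).
Proof.
move=> h; elim: n => [//|n IH]; exact: nletters_nmul.
Qed.
Lemma In_map (I : Type) (B : Type) (f : I -> B) s b : List.In b [seq f i | i <- s] ->
  exists i, b = f i.
Proof. by elim: s => [|i s IH] //= h; case: h => [e|h]; [exists i|apply: IH]. Qed.
Lemma lett_ueval k (p : {mpoly F[k]}) g : (forall i, lett Q (g i)) -> lett Q (ueval p g).
Proof.
move=> h; apply: lett_tsum => a1 h1; have [m ->] := In_map h1; apply: lett_scale.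
by apply: lett_tprod => a2 h2; have [i ->] := In_map h2; apply: lett_tpow.
Qed.
End Letters.

Section Derivation.
Variables (v h : proot -> F).
Definition dert z := der v h (expand z).
Lemma dert_c c : dert (Tc c) = 0.
Proof. by rewrite /dert /der big_seq1 mulr0. Qed.
Lemma dert_mul0 a b : dert a = 0 -> dert b = 0 -> dert (Tmul a b) = 0.
Proof. by rewrite /dert /= der_nmul => -> ->; rewrite mul0r mulr0 addr0. Qed.
Lemma dert_tsum0 s : (forall a, List.In a s -> dert a = 0) -> dert (tsum s) = 0.
Proof.
elim: s => [|a s IH] h0; first exact: dert_c.
by rewrite /dert /= der_cat -!/(dert _) h0 ?IH ?addr0 //; [move=> b hb; apply: h0; right|left].
Qed.
Lemma dert_tprod0 s : (forall a, List.In a s -> dert a = 0) -> dert (tprod s) = 0.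
Proof.
elim: s => [|a s IH] h0; first exact: dert_c.
by apply: dert_mul0; [apply: h0; left|apply: IH => b hb; apply: h0; right].
Qed.
Lemma dert_tpow0 a n : dert a = 0 -> dert (tpow a n) = 0.
Proof. by move=> h0; elim: n => [|n IH]; [exact: dert_c|exact: dert_mul0]. Qed.
Lemma dert_ueval0 k (p : {mpoly F[k]}) g : (forall i, dert (g i) = 0) -> dert (ueval p g) = 0.
Proof.
move=> h0; apply: dert_tsum0 => a1 h1; have [m ->] := In_map h1; apply: dert_mul0; first exact: dert_c.
by apply: dert_tprod0 => a2 h2; have [i ->] := In_map h2; apply: dert_tpow0.
Qed.
End Derivation.

Lemma gen_comm r s : valid r -> valid s -> br r s = [::] ->
  gen F t prec r * gen F t prec s = gen F t prec s * gen F t prec r.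
Proof.
move=> vr vs e; apply/eqP; rewrite -subr_eq0 gen_br // e big_nil //.
Qed.

Lemma br_closed_valid : br_closed F t prec valid.
Proof. by move=> r s; apply: br_valid. Qed.

Lemma eq_ev_poly T T' (g : proot -> {poly F}) :
  (forall v, ev idfun v T = ev idfun v T') -> ev polyC g T = ev polyC g T'.
Proof.
move=> e; apply/eqP; rewrite -subr_eq0; apply/eqP/poly_eq0 => x _.
by rewrite hornerD hornerN !horner_ev e subrr.
Qed.

Lemma der_flow v h T (g : proot -> {poly F}) : (forall r, (g r).[0] = v r) ->
  (forall r, (g r)^`().[0] = h r) -> der v h T = (ev polyC g T)^`().[0].
Proof.
by move=> gv gh; rewrite deriv_ev; congr (der _ _ T); apply: funext.
Qed.

(** A directional derivative depends on the values along the line $v+xh$ only. *)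
Lemma eq_ev_der v h T T' : (forall v, ev idfun v T = ev idfun v T') ->
  der v h T = der v h T'.
Proof.
move=> e; pose g r := (v r)%:P + (h r)%:P * 'X.
have g0 r : (g r).[0] = v r by rewrite /g hornerD hornerM !hornerC hornerX mulr0 addr0.
have g1 r : (g r)^`().[0] = h r by rewrite /g derivD derivC derivM derivC derivX mul0r !add0r mulr1 hornerC.
by rewrite !(der_flow _ g0 g1) (eq_ev_poly _ e).
Qed.

(** Interface between root vectors and elimination, common to all types. [Q] is the commuting set of
    root vectors that may occur in a symbol; [kap r * d (lam r)] is the valuation given by the
    (block) diagonal matrix with entries [d]. There [sd_val] evaluates the generators, while
    [sd_zero] and [sd_dom] are the two outcomes of elimination. *)
Record slice_data (G : nat -> term F) (k : nat) (Q : pred proot)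
    (kap : proot -> F) (lam : proot -> nat) (c : nat -> F) : Prop := SliceData {
  sd_valid : {subset Q <= valid};
  sd_comm : forall r s, Q r -> Q s -> br r s = [::];
  sd_ad : forall r s, valid r -> Q s -> all (fun e => Q e.2) (br r s);
  sd_lam : forall r, kap r != 0 -> (lam r < k)%N;
  sd_lett : forall i, (i < k)%N -> lett Q (G i.+1);
  sd_inv : forall i, (i < k)%N -> inv (expand (G i.+1));
  sd_c : forall i, c i != 0;
  sd_val : forall i d, (i < k)%N ->
    evt idfun (fun r => kap r * d (lam r)) (G i.+1) = c i * \prod_(j < i.+1) d j;
  sd_zero : forall T, nletters Q T -> inv T ->
    (forall d, ev idfun (fun r => kap r * d (lam r)) T = 0) -> forall v, ev idfun v T = 0;
  sd_dom : forall T, nletters Q T -> inv T -> forall q d, (q.+1 < k)%N ->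
    (forall l, d l != 0) -> exists pol : {poly F}, forall s, s != 0 ->
    ev idfun (fun r => kap r * rescale q s d (lam r)) T = pol.[s] }.

Section WithData.
Variables (G : nat -> term F) (k : nat) (Q : pred proot).
Variables (kap : proot -> F) (lam : proot -> nat) (c : nat -> F).
Hypothesis sd : slice_data G k Q kap lam c.
Local Notation GG := (fun j : 'I_k => G j.+1).

Lemma sd_gen_comm r s : Q r -> Q s ->
  gen F t prec r * gen F t prec s = gen F t prec s * gen F t prec r.
Proof.
move=> qr qs; apply: gen_comm; rewrite ?(sd_comm sd) //; exact: (sd_valid sd).
Qed.

Lemma ad_lett r T : valid r -> nletters Q T -> nletters Q (ad t prec r T).
Proof.
move=> vr; elim: T => [//|[a w] T IH] /= /andP [qw qT].
rewrite /ad /= nletters_cat IH // andbT nletters_nscale.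
elim: w qw => [//|s w IHw] /= /andP [qs qw]; rewrite nletters_cat /nletters !all_map.
apply/andP; split; first by apply: sub_all (sd_ad sd vr qs) => e /= ->.
by apply: sub_all (IHw qw) => e /= ->; rewrite qs.
Qed.

(** By [sd_ad] the commutator with $f_r$ stays within the commuting letters [Q], where vanishing
    values imply vanishing in $U(\mathfrak n)$; its values vanish by invariance. *)
Lemma central_generator i : (i < k)%N -> central t prec (G i.+1).
Proof.
move=> lt; apply/centralP; apply: commute_gens => r vr.
have vE : nletters valid (expand (G i.+1)) by apply: expand_valid.
apply/eqP; rewrite -subr_eq0 -!toU_expand -toU_ad //; apply/eqP.
apply: (ev0_toU_comm sd_gen_comm); last by move=> v; rewrite ev_ad (sd_inv sd).
by apply: ad_lett => //; apply: (sd_lett sd).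
Qed.

(** PBW shows that the top part has zero values. Its letters commute, so it is then zero in
    $U(\mathfrak n)$ and can be split off; induction on the degree. *)
Lemma comm_toU0 T : nletters Q T -> toU T = 0 -> forall v, ev idfun v T = 0.
Proof.
move=> qT T0 v; pose d := (\max_(e <- T) size e.2)%N.
have : all (fun e => size e.2 <= d)%N T.
  by apply/allP => e he; apply: (leq_bigmax_seq (P := xpredT) (F := fun e => size e.2) _ he isT).
move: d => d; elim: d T qT T0 => [|d IH] T qT T0 sT.
  have vT := nletters_sub (sd_valid sd) qT.
  rewrite -(symbol_toU0 so vT sT T0 v); congr (ev _ _ _); apply/esym/all_filterP.
  by apply: sub_all sT => e; rewrite leqn0.
have vT := nletters_sub (sd_valid sd) qT.
have e0 := symbol_toU0 so vT sT T0.
have qd : nletters Q (ncomp d.+1 T) by apply: nletters_filter.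
have c0 := ev0_toU_comm sd_gen_comm qd e0.
rewrite (ev_split _ _ (fun e => size e.2 == d.+1)) -/(ncomp d.+1 T) e0 add0r.
apply: IH; first exact: nletters_filter.
- by have := T0; rewrite (toU_split _ _ d.+1) c0 add0r.
- apply/allP => e; rewrite mem_filter /= => /andP [ne /(allP sT)].
  by rewrite leq_eqVlt (negbTE ne).
Qed.

Lemma generators_independent (p : {mpoly F[k]}) : cl (ueval p GG) = 0 -> p = 0.
Proof.
rewrite -toU_expand => p0; apply: (slice_independent (sd_c sd)) => d.
have qT : lett Q (ueval p GG) by apply: lett_ueval => i; apply: (sd_lett sd).
rewrite -(comm_toU0 qT p0 (fun r => kap r * d (lam r))) -/(evt _ _ _) evt_ueval.
by apply: meval_eq => i; rewrite (sd_val sd).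
Qed.

(** The restriction [h] to the slice is a polynomial in the [d i]; by [sd_dom] its exponents
    decrease, so some polynomial in the generators has the same restriction. The difference [S] is
    invariant and zero on the slice, hence has zero values by [sd_zero]. *)
Lemma symbol_polynomial T : nletters Q T -> inv T ->
  exists p : {mpoly F[k]}, forall v, ev idfun v T = evt idfun v (ueval p GG).
Proof.
move=> qT iT.
pose X l : {mpoly F[k]} := if insub l is Some i then 'X_(i : 'I_k) else 0.
pose h := ev (@mpolyC k F) (fun r => kap r *: X (lam r)) T.
have hE (d : nat -> F) : h.@[fun i : 'I_k => d i] = ev idfun (fun r => kap r * d (lam r)) T.
  rewrite /h (ev_morph _ (meval (fun i : 'I_k => d i))) /ev; apply: eq_bigr => e _.
  rewrite /= mevalC; congr (_ * _); apply: eq_bigr => r _ /=.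
  rewrite mevalZ /X; have [->|k0] := eqVneq (kap r) 0; first by rewrite !mul0r.
  by rewrite (insubT (fun i => i < k)%N (sd_lam sd k0)) mevalXU.
have [m i j hm eij|p hp] := @slice_polynomial _ k h c (sd_c sd).
- have nij : i != j by apply/eqP => e; move: eij; rewrite e => /eqP; rewrite ltn_eqF.
  apply: (dominant_exponents nij) hm => y y0.
  pose d l := if insub l is Some i then y (i : 'I_k) else 1.
  have d0 l : d l != 0 by rewrite /d; case: insubP => [l' _ _|_]; rewrite ?oner_eq0.
  have lt : (i.+1 < k)%N by rewrite -eij; apply: ltn_ord.
  have [pol hpol] := sd_dom sd qT iT lt d0; exists pol => s s0; rewrite -hpol // -hE.
  apply: meval_eq => l; rewrite /rescale -[(l : nat) == i]/(l == i).
  have dE (l' : 'I_k) : d l' = y l' by rewrite /d valK.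
  by rewrite -eij -[(l : nat) == j]/(l == j) !dE.
exists p => v.
have qp : lett Q (ueval p GG) by apply: lett_ueval => i; apply: (sd_lett sd).
pose S := T ++ nscale (-1) (expand (ueval p GG)).
have evS w : ev idfun w S = ev idfun w T - evt idfun w (ueval p GG).
  by rewrite ev_cat ev_nscale mulN1r.
apply/eqP; rewrite -subr_eq0 -evS; apply/eqP; move: v; apply: (sd_zero sd).
- by rewrite nletters_cat nletters_nscale qT.
- move=> r w vr; rewrite der_cat der_nscale iT // -/(dert w (coad r w) _).
  rewrite dert_ueval0 ?mulr0 ?addr0 // => i.
  exact: (sd_inv sd).
- move=> d; rewrite evS evt_ueval -hE -hp; apply/eqP; rewrite subr_eq0; apply/eqP.
  by apply: meval_eq => i; rewrite (sd_val sd).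
Qed.

Section Reduction.
Variable L : pred proot.
Hypothesis L_valid : {subset L <= valid}.
Hypothesis L_closed : br_closed F t prec L.
Hypothesis QL : {subset Q <= L}.
Hypothesis red : forall T, nletters L T -> inv T ->
  forall v, ev idfun v T = ev idfun v [seq e <- T | all Q e.2].

(** The top part and its portion [Tc] with letters in [Q] have equal values, so in $U(\mathfrak n)$
    they differ by some [T2] of lower degree, again with letters in [L]. [Tc] equals a polynomial in
    the generators exactly, since the letters in [Q] commute. *)
Lemma central_polynomial d T : nletters L T -> all (fun e => size e.2 < d)%N T ->
  (forall x, toU T * x = x * toU T) -> exists p : {mpoly F[k]}, toU T = cl (ueval p GG).
Proof.
have qu (p : {mpoly F[k]}) : lett Q (ueval p GG).
  by apply: lett_ueval => i; apply: (sd_lett sd).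
have cu (p : {mpoly F[k]}) x : cl (ueval p GG) * x = x * cl (ueval p GG).
  apply: commute_gens => r vr; apply/eqP; rewrite -subr_eq0 -!toU_expand -toU_ad //; last first.
    exact: expand_valid.
  apply/eqP; apply: (ev0_toU_comm sd_gen_comm); last first.
    move=> v; rewrite ev_ad -/(dert v (coad r v) _) dert_ueval0 // => i.
    exact: (sd_inv sd).
  by apply: ad_lett => //; apply: qu.
elim: d T => [|d IH] T lT sT cT.
  exists 0; rewrite (_ : T = [::]); first by rewrite /ueval msupp0 /= cl0 /toU big_nil.
  by case: T sT {lT cT}.
have vT := nletters_sub L_valid lT.
(* The commutator of $f_r$ with [T] is zero, and its top part is the commutator with the top part;
   PBW then gives zero values. *)
have iD : inv (ncomp d T).
  move=> r v vr; rewrite -ev_ad -ncomp_ad; apply: (symbol_toU0 so).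
  - by rewrite /ad /nletters; apply/allP => e /flattenP [_ /mapP [f hf ->]] /mapP [g hg ->] /=;
      apply: (allP (adw_letters br_closed_valid vr (allP vT _ hf)) _ hg).
  - apply/allP => e /flattenP [_ /mapP [f hf ->]] /mapP [g /adw_size eg ->] /=.
    by rewrite eg -ltnS; apply: (allP sT).
  - by rewrite toU_ad // cT subrr.
have lD : nletters L (ncomp d T) by apply: nletters_filter.
pose Tc := [seq e <- ncomp d T | all Q e.2].
have qc : nletters Q Tc by apply: filter_all.
have eD := red lD iD.
have [|p hp] := @symbol_polynomial Tc qc.
  by move=> r v vr; rewrite -(eq_ev_der _ _ eD) iD.
have zE : toU Tc = cl (ueval p GG).
  apply/eqP; rewrite -subr_eq0 -toU_expand -scaleN1r -toU_nscale -toU_cat; apply/eqP.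
  apply: (ev0_toU_comm sd_gen_comm).
    by rewrite nletters_cat nletters_nscale qc; apply: qu.
  by move=> v; rewrite ev_cat ev_nscale mulN1r hp subrr.
have [T2 [lT2 sT2 eT2]] : lower L d (toU (ncomp d T ++ nscale (-1) Tc)).
  apply: ev0_toU_lower => //.
  - rewrite nletters_cat nletters_nscale lD; exact: nletters_filter.
  - rewrite all_cat filter_all all_map /=; apply/allP => e; rewrite !mem_filter /=.
    by case/andP => _ /andP [].
  - by move=> v; rewrite ev_cat ev_nscale mulN1r eD subrr.
pose T1 := [seq e <- T | size e.2 != d] ++ T2.
have eT1 : toU T = toU T1 + cl (ueval p GG).
  rewrite (toU_split _ _ d) toU_cat -eT2 toU_cat toU_nscale scaleN1r -zE.
  by rewrite addrC -addrA subrK.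
have [||x|p1 hp1] := IH T1.
- by rewrite nletters_cat lT2 andbT; apply: nletters_filter.
- rewrite all_cat sT2 andbT; apply/allP => e; rewrite mem_filter => /andP [ne /(allP sT)].
  by rewrite ltnS leq_eqVlt (negbTE ne).
- have -> : toU T1 = toU T - cl (ueval p GG) by rewrite eT1 addrK.
  by rewrite mulrBl mulrBr cT cu.
(* [ueval] is not additive as a term, so the identity is checked by values in the commuting
   letters. *)
exists (p1 + p); rewrite eT1 hp1; apply/eqP; rewrite -subr_eq0.
rewrite -!toU_expand -scaleN1r -toU_nscale -!toU_cat; apply/eqP.
apply: (ev0_toU_comm sd_gen_comm).
  by rewrite !nletters_cat nletters_nscale; rewrite -!/(lett Q _) !qu.
by move=> v; rewrite !ev_cat ev_nscale -!/(evt _ _ _) !evt_ueval mevalD mulN1r subrr.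
Qed.
End Reduction.
End WithData.
End Endgame.

(** * Removing root vectors by brackets with fresh indices *)

Section Killing.
Variables (F : numClosedFieldType) (t : ctype) (prec : rel sel).
Local Notation gt := (gtth t prec).
Hypothesis so : strict_order gt.
Local Notation valid := (valid t prec).
Local Notation coad := (@coad F t prec).
Local Notation br := (@br F t prec).
Local Notation fp := (@fp F t prec).
Local Notation inv := (@inv F t prec).
Implicit Types T : ncpoly F.

Definition supp (r : proot) : seq nat :=
  match r with PM i j | PP i j => [:: i; j] | PS i | PL i => [:: i] end.
Definition inL (M : seq nat) : pred proot := fun r => valid r && all (mem M) (supp r).

Lemma fp_supp i j e : e \in fp i j -> {subset supp e.2 <= [:: i; j]}.
Proof.
rewrite /fp; case: ifP => _; first by rewrite inE => /eqP ->.
case: ifP => _; first by rewrite inE => /eqP -> x /=; rewrite !inE orbC.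
by case: ifP => _ //; rewrite inE => /eqP -> x /=; rewrite !inE => ->.
Qed.

Lemma br_supp r s e : e \in br r s -> {subset supp e.2 <= supp r ++ supp s}.
Proof.
have ifE (b : bool) (L : seq (F * proot)) : e \in (if b then L else [::]) -> b /\ e \in L.
  by case: b.
have loppE L : e \in lopp L -> exists2 e', e' \in L & e.2 = e'.2.
  by case/mapP => e' h ->; exists e'.
case: r s => [i j|i j|i|i] [k l|k l|k|k] //=; rewrite ?mem_cat.
all: try by case/orP => /ifE [_]; [rewrite inE => /eqP ->|rewrite inE => /eqP ->] => x /=;
  rewrite !inE => /orP [] ->; rewrite ?orbT.
all: try by case/orP => /ifE [_ /fp_supp h] x /h; rewrite !inE => /orP [] ->; rewrite ?orbT.
all: try by move=> /ifE [_ /fp_supp h] x /h; rewrite !inE => /orP [] ->; rewrite ?orbT.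
all: try by move=> /ifE [_]; rewrite inE => /eqP -> x; rewrite /= !inE => ->; rewrite ?orbT.
all: case/loppE => e' h ->; move: h; rewrite ?mem_cat.
- case/orP; case: ifP => // _ /fp_supp h x /h; rewrite !inE => /orP [] ->; rewrite ?orbT //.
- by case: ifP => // _; rewrite inE => /eqP -> x; rewrite /= !inE => ->; rewrite ?orbT.
- by move=> /fp_supp h x /h; rewrite !inE.
- case: ifP => // _ /fp_supp h x /h; rewrite !inE => /orP [] ->; rewrite ?orbT //.
Qed.

Lemma inL_closed M : br_closed F t prec (inL M).
Proof.
move=> r s /andP [vr /allP mr] /andP [vs /allP ms]; apply/allP => e he.
rewrite /inL (allP (br_valid F so vr vs) _ he) /=; apply/allP => x /(br_supp he).
by rewrite mem_cat => /orP [/mr|/ms].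
Qed.

Definition delta (s0 : proot) : proot -> F := fun s => (s == s0)%:R.

(** Let [v'] agree with [v] on the letters of [T] and be nonzero outside them only at [s1]. On these
    letters the coadjoint field of [r] at [v'] has the single nonzero coordinate [s0], and
    invariance becomes the vanishing of that partial derivative. *)
Lemma kill M T r s0 s1 c0 : nletters (inL M) T -> inv T -> valid r -> inL M s0 ->
  br r s0 = [:: (c0, s1)] -> c0 != 0 ->
  (forall s e, inL M s -> e \in br r s -> ~~ inL M e.2 /\ (e.2 = s1 -> s = s0)) ->
  forall v, der v (delta s0) T = 0.
Proof.
move=> lT iT vr l0 e0 c00 h v.
pose v' x := if inL M x then v x else if x == s1 then c0^-1 else 0.
have ns1 : inL M s1 = false.
  by apply/negbTE; have [] := h s0 (c0, s1) l0; rewrite // e0 mem_head.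
rewrite -(iT r v' vr); apply: (eq_der lT) => s ls; first by rewrite /v' ls.
rewrite /delta; have [->|ne] := eqVneq s s0.
  by rewrite /coad e0 big_seq1 /v' /= ns1 eqxx mulfV.
rewrite /coad big_seq big1 // => e he; have [n1 n2] := h s e ls he.
rewrite /v' (negbTE n1); case: eqP => [/n2 es|_]; last by rewrite mulr0.
by rewrite es eqxx in ne.
Qed.

(** The segment from [w], which is [v] made 0 outside [Q], to [v] moves in directions with zero
    derivative. Finitely many directions matter, as [T] has finitely many letters. *)
Lemma kill_reduce (L Q : pred proot) T : nletters L T ->
  (forall s, L s -> ~~ Q s -> forall v, der v (delta s) T = 0) ->
  forall v, ev idfun v T = ev idfun v [seq e <- T | all Q e.2].
Proof.
move=> lT h v; pose w r := if Q r then v r else 0.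
have <- : ev idfun w T = ev idfun v [seq e <- T | all Q e.2].
  rewrite (ev_split _ _ (fun e => all Q e.2)) [X in _ + X](_ : _ = 0) ?addr0.
    by apply: (eq_ev (Q := Q) idfun); [apply: filter_all|move=> r qr; rewrite /w qr].
  rewrite /ev big_filter big1 // => e /allPn [r hr nq].
  rewrite /evw (big_rem r) //= /w (negbTE nq) mul0r mulr0 //.
pose g r := (w r)%:P + (v r - w r)%:P * 'X.
have gE c r : (g r).[c] = w r + (v r - w r) * c.
  by rewrite /g hornerD hornerM !hornerC hornerX.
have g1 c r : (g r)^`().[c] = v r - w r.
  by rewrite /g derivD derivC derivM derivC derivX mul0r !add0r mulr1 hornerC.
have <- : ev idfun (fun r => (g r).[1]) T = ev idfun v T.
  by congr (ev _ _ T); apply: funext => r; rewrite gE; ring.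
have <- : ev idfun (fun r => (g r).[0]) T = ev idfun w T.
  by congr (ev _ _ T); apply: funext => r; rewrite gE; ring.
apply: ev_curve => c.
pose B := [seq s <- undup (flatten [seq e.2 | e <- T]) | ~~ Q s].
have uB : uniq B by rewrite filter_uniq // undup_uniq.
have sB u (s : seq proot) : {subset s <= B} ->
    der u (fun r => \sum_(x <- s) (v x - w x) * delta x r) T = 0.
  elim: s => [_|x s IH sub].
    by rewrite -[RHS](der0 u T); congr (der _ _ T); apply: funext => r; rewrite big_nil.
  have -> : (fun r => \sum_(y <- x :: s) (v y - w y) * delta y r)
     = (fun r => (v x - w x) * delta x r + \sum_(y <- s) (v y - w y) * delta y r).
    by apply: funext => r; rewrite big_cons.
  rewrite der_lin IH ?addr0; last by move=> y hy; apply: sub; rewrite inE hy orbT.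
  have := sub x (mem_head _ _); rewrite mem_filter mem_undup.
  case/andP => nq /flattenP [_ /mapP [e he ->] hx].
  by rewrite h ?mulr0 //; apply: (allP (allP lT _ he)).
rewrite -[RHS](sB (fun r => (g r).[c]) B) //.
apply: (eq_der (Q := mem (flatten [seq e.2 | e <- T]))) => // [|r hr].
  by apply/allP => e he; apply/allP => r hr; apply/flattenP; exists e.2; rewrite ?map_f.
rewrite g1 /delta; have [qr|nq] := boolP (Q r).
  rewrite /w qr subrr big_seq big1 // => x; rewrite mem_filter => /andP [nx _].
  by case: eqP => [e|_]; rewrite ?mulr0 // -e qr in nx *.
rewrite (bigD1_seq r) ?mem_filter ?nq ?mem_undup //= eqxx mulr1 /w (negbTE nq).
by rewrite big1 ?addr0 // => x ne; rewrite eqtype.eq_sym (negbTE ne) mulr0.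
Qed.
End Killing.

(** * Types B, C and D: the symmetric or skew-symmetric matrix of values *)

Section BCD.
Variables (F : numClosedFieldType) (t : ctype) (prec : rel sel).
Local Notation gt := (gtth t prec).
Hypothesis so : strict_order gt.
Hypothesis nA : ~~ ctype_eqb t TA.
Local Notation valid := (valid t prec).
Local Notation coad := (@coad F t prec).
Local Notation br := (@br F t prec).
Local Notation fp := (@fp F t prec).
Local Notation inv := (@inv F t prec).
Local Notation csg := (csg F t).
Local Notation evt := (evt t prec).
Local Notation expand := (@expand F t prec).
Implicit Types T : ncpoly F.

Section Fvalue.
Variables (A : comNzRingType) (iota : {rmorphism F -> A}) (v : proot -> A).
(** Entries of the matrix of values: symmetric in type C, with the factor 2 on the diagonal that
    $\Delta_q$ also has, and skew-symmetric in types B and D. *)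
Definition Fv i j : A := \sum_(e <- fp i j) iota e.1 * v e.2.

Lemma Fv_gt i j : gt i j -> Fv i j = v (PP i j).
Proof. by move=> g; rewrite /Fv /fp g big_seq1 rmorph1 mul1r. Qed.
Lemma Fv_lt i j : gt j i -> Fv i j = iota csg * v (PP j i).
Proof. by move=> g; rewrite /Fv /fp (so_asym so g) g big_seq1. Qed.
Lemma Fv_diag i : Fv i i = if ctype_eqb t TC then iota 2 * v (PL i) else 0.
Proof. by rewrite /Fv /fp (so_irr so); case: ifP => _; rewrite ?big_seq1 ?big_nil. Qed.
Lemma csg2 : iota csg * iota csg = 1.
Proof. by rewrite -rmorphM /csg; case: ifP => _; rewrite ?mulr1 ?mulrNN ?mulr1 rmorph1. Qed.
Lemma Fv_sym i j : Fv j i = iota csg * Fv i j.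
Proof.
have [->|/(so_total so)/orP [g|g]] := eqVneq i j.
- rewrite Fv_diag /csg; case: ifP => _; first by rewrite rmorph1 mul1r.
  by rewrite mulr0.
- by rewrite (Fv_gt g) (Fv_lt g).
- by rewrite (Fv_gt g) (Fv_lt g) mulrA csg2 mul1r.
Qed.
End Fvalue.

Lemma horner_Fv (g : proot -> {poly F}) i j c :
  (Fv polyC g i j).[c] = Fv idfun (fun r => (g r).[c]) i j.
Proof. by rewrite /Fv horner_sum; apply: eq_bigr => e _; rewrite hornerM hornerC. Qed.

Lemma coad_PP v x y i j : coad (PM x y) v (PP i j) =
  (y == i)%:R * Fv idfun v x j + (y == j)%:R * Fv idfun v i x.
Proof.
by rewrite /coad /= big_cat /= /Fv; case: (y == i); case: (y == j);
  rewrite ?big_nil ?mul1r ?mul0r ?addr0.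
Qed.
Lemma coad_PL v x y k : coad (PM x y) v (PL k) = (y == k)%:R * Fv idfun v x k.
Proof. by rewrite /coad /= /Fv; case: (y == k); rewrite ?big_nil ?mul1r ?mul0r. Qed.

(** The one-parameter group of $f_{\vartheta_x-\vartheta_y}$ on the coordinates in the matrix [Fv].
    It acts by congruence, whose quadratic term is seen at the root $2\vartheta_y$ alone. *)
Definition flow x y (v : proot -> F) (s : proot) : {poly F} :=
  (v s)%:P + (coad (PM x y) v s)%:P * 'X
  + (if s == PL y then v (PL x) else 0)%:P * 'X^2.

Lemma flow_at x y v s c : (flow x y v s).[c] =
  v s + coad (PM x y) v s * c + (if s == PL y then v (PL x) else 0) * c ^+ 2.
Proof. by rewrite /flow !expr2 !hornerD !hornerM !hornerC !hornerX. Qed.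
Lemma flow_deriv x y v s c : (flow x y v s)^`().[c] =
  coad (PM x y) v s + (if s == PL y then v (PL x) else 0) * (c *+ 2).
Proof.
rewrite /flow expr2 !derivD !derivM !derivC !derivX !mul0r !add0r !mulr1 mul1r.
by rewrite hornerD hornerM !hornerC hornerD hornerX mulr2n.
Qed.

Lemma flow_Fv x y v i j : gt x y -> Fv polyC (flow x y v) i j =
  congA x (fun i => if i == y then 'X else 0) (fun i j => (Fv idfun v i j)%:P) i j.
Proof.
move=> gxy; rewrite /congA.
have C0 k l : (PP k l == PL y) = false by [].
have if1 k : (if k == y then 'X else 0) = (y == k)%:R * 'X :> {poly F}.
  by rewrite eqtype.eq_sym; case: eqP => _; rewrite ?mul1r ?mul0r.
have bP (b : bool) : (b%:R)%:P = b%:R :> {poly F} by case: b.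
rewrite !if1.
have [->|/(so_total so)/orP [g|g]] := eqVneq i j; last first.
- rewrite (Fv_lt _ _ g) /flow C0 mul0r addr0 coad_PP (Fv_lt _ _ g) (Fv_sym _ _ j x) (Fv_sym _ _ x i).
  (* Off the diagonal [y] cannot be both indices, so the congruence has no quadratic term. *)
  rewrite (_ : (y == i)%:R * 'X * ((y == j)%:R * 'X) = 0); last first.
    case: (y =P i) => [->|_]; last by rewrite !mul0r.
    by rewrite eqtype.eq_sym (negbTE (so_neq so g)) mul0r mulr0.
  by rewrite !polyCD !polyCM !bP; ring.
- rewrite (Fv_gt _ _ g) /flow C0 mul0r addr0 coad_PP (Fv_gt _ _ g).
  rewrite (_ : (y == i)%:R * 'X * ((y == j)%:R * 'X) = 0); last first.
    case: (y =P i) => [->|_]; last by rewrite !mul0r.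
    by rewrite (negbTE (so_neq so g)) mul0r mulr0.
  by rewrite !polyCD !polyCM !bP; ring.
- rewrite (Fv_sym _ _ x j) !Fv_diag; case: ifP => tC.
    rewrite /flow coad_PL (_ : (PL j == PL y) = (y == j)); last first.
      by rewrite -[LHS]/((3%N, (j, 0%N)) == (3%N, (y, 0%N))) !xpair_eqE eqxx andbT /= eqtype.eq_sym.
    rewrite /csg tC; case: (y == j); rewrite ?mul1r ?mul0r ?polyC0 ?mul0r ?mulr0 ?addr0 ?polyCM //.
    by rewrite expr2; ring.
  rewrite /csg tC; case: (y == j); rewrite ?mul1r ?mul0r ?polyC0 ?mul0r ?mulr0 ?addr0 //.
  by rewrite mulN1r polyCN; ring.
Qed.

Definition Qpp (r : proot) := match r with PP _ _ | PL _ => valid r | _ => false end.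

(** The differential equation at every time [c] and not only at 0, as [ev_curve] requires. It rests
    on [x] and [y] being distinct. *)
Lemma flow_field x y v s c : gt x y -> Qpp s ->
  (flow x y v s)^`().[c] = coad (PM x y) (fun r => (flow x y v r).[c]) s.
Proof.
move=> gxy; have nxy : (x == y) = false by apply/negbTE/(so_neq so).
have E i j : Fv idfun (fun r => (flow x y v r).[c]) i j =
    Fv idfun v i j + (y == i)%:R * c * Fv idfun v x j + (y == j)%:R * c * Fv idfun v i x
    + (y == i)%:R * c * ((y == j)%:R * c) * Fv idfun v x x.
  have if1 k : (if k == y then 'X else 0).[c] = (y == k)%:R * c.
    by rewrite eqtype.eq_sym; case: eqP => _; rewrite ?hornerX ?hornerC ?mul1r ?mul0r.
  by rewrite -horner_Fv flow_Fv // /congA !hornerD !hornerM !hornerC !if1.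
case: s => [//|i j|//|i] /= hv; rewrite flow_deriv.
  case/andP: hv => _ g; have -> : (PP i j == PL y) = false by [].
  rewrite !coad_PP !E [y == x]eqtype.eq_sym nxy.
  have nij := so_neq so g.
  case: (y =P i) => [->|_]; first by rewrite (negbTE nij) !mulr0n !mulr1n; ring.
  by case: (y =P j) => _; rewrite ?mulr0n ?mulr1n; ring.
rewrite !coad_PL E [y == x]eqtype.eq_sym nxy (_ : (PL i == PL y) = (y == i)); last first.
  by rewrite -[LHS]/((3%N, (i, 0%N)) == (3%N, (y, 0%N))) !xpair_eqE eqxx andbT /= eqtype.eq_sym.
rewrite Fv_diag hv; case: (y == i); rewrite ?mulr0n ?mulr1n; last by ring.
by rewrite mulr2n /=; ring.
Qed.

Lemma ev_flow T x y v c : gt x y -> nletters Qpp T -> inv T ->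
  ev idfun (fun r => (flow x y v r).[c]) T = ev idfun v T.
Proof.
move=> gxy qT iT; rewrite (@ev_curve _ (flow x y v)).
  by congr (ev _ _ T); apply: funext => r; rewrite flow_at expr0n /= !mulr0 !addr0.
move=> c0; rewrite -[RHS](iT (PM x y) (fun r => (flow x y v r).[c0]) gxy).
by apply: (eq_der qT) => // r qr; apply: flow_field.
Qed.

Variables (n : nat) (a : nat -> nat).
Hypothesis ta : topseq gt n a.
Local Notation al := [seq a i | i <- iota 0 n].
Definition idx x := index x [seq a i | i <- iota 0 n].
Definition Qn r := Qpp r && all (mem al) (supp r).

Lemma alP x : reflect (exists2 i, (i < n)%N & x = a i) (x \in al).
Proof.
apply: (iffP mapP) => [[l]|[l h ->]]; last by exists l; rewrite ?mem_iota.
by rewrite mem_iota => h ->; exists l.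
Qed.
Lemma al_uniq : uniq al.
Proof.
rewrite map_inj_in_uniq ?iota_uniq // => i j; rewrite !mem_iota => hi hj.
exact: (decseq_inj so ta.1).
Qed.
Lemma idxE i : (i < n)%N -> idx (a i) = i.
Proof.
move=> lt; rewrite /idx.
have -> : a i = nth 0%N al i by rewrite (nth_map 0%N) ?size_iota // nth_iota.
by rewrite index_uniq ?al_uniq // size_map size_iota.
Qed.
Lemma gtE i j : (i < n)%N -> (j < n)%N -> gt (a i) (a j) = (i < j)%N.
Proof. exact: (decseq_lt so ta.1). Qed.
Lemma al_up x y : y \in al -> gt x y -> x \in al.
Proof.
case/alP => i lt -> /(ta.2 _ _ lt) [j lj <-]; apply/alP.
by exists j => //; apply: ltn_trans lt.
Qed.

Lemma fp_Qn x y : x \in al -> y \in al -> all (fun e => Qn e.2) (fp x y).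
Proof.
move=> hx hy; apply/allP => e he; have ve := allP (fp_valid F prec x y nA) _ he.
apply/andP; split; last first.
  by apply/allP => z /(fp_supp he); rewrite !inE => /orP [] /eqP ->.
by move: he ve; rewrite /fp; case: ifP => _; [|case: ifP => _; [|case: ifP => _]];
  rewrite ?inE // => /eqP ->.
Qed.

Lemma Qn_ad r s : valid r -> Qn s -> all (fun e => Qn e.2) (br r s).
Proof.
case: r => [x y|x y|x|x] vr /andP []; case: s => [//|i j|//|i] //= vs.
- rewrite andbT => /andP [hi hj]; rewrite all_cat; apply/andP; split; case: eqP => // e.
    by apply: fp_Qn => //; apply: (al_up hi); rewrite -e.
  by apply: fp_Qn => //; apply: (al_up hj); rewrite -e.
- rewrite andbT => hi; case: eqP => // e.
  by apply: fp_Qn => //; apply: (al_up hi); rewrite -e.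
Qed.
Lemma Qn_comm r s : Qn r -> Qn s -> br r s = [::].
Proof. by case: r => [//|x y|//|x] _; case: s. Qed.
Lemma Qn_valid : {subset Qn <= valid}.
Proof. by move=> r /andP []; case: r. Qed.
Lemma Qn_Qpp T : nletters Qn T -> nletters Qpp T.
Proof. by apply: nletters_sub => r /andP []. Qed.

(** The valuation whose matrix [Fv] is [X]; the half undoes the factor 2 on the diagonal. *)
Definition vX (X : nat -> nat -> F) (r : proot) : F :=
  match r with
  | PP x y => X (idx x) (idx y)
  | PL x => X (idx x) (idx x) / 2
  | _ => 0
  end.

Lemma two0 : (2 : F) != 0. Proof. by rewrite pnatr_eq0. Qed.

Lemma Fv_vX X i j : sgnsym csg X -> (i < n)%N -> (j < n)%N ->
  Fv idfun (vX X) (a i) (a j) = X i j.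
Proof.
move=> sX hi hj; case: (ltngtP i j) => [lt|lt|<-].
- by rewrite Fv_gt ?gtE //= !idxE.
- by rewrite Fv_lt ?gtE //= !idxE // -sX.
- rewrite Fv_diag; case: ifP => tC /=; first by rewrite idxE // mulrC divfK ?two0.
  by rewrite skew_diag //; move: sX; rewrite /csg tC.
Qed.

Lemma ev_read T X w : nletters Qn T ->
  (forall i j, (i < n)%N -> (j < n)%N -> Fv idfun w (a i) (a j) = X i j) ->
  ev idfun w T = ev idfun (vX X) T.
Proof.
move=> qT h; apply: (eq_ev idfun qT) => r /andP []; case: r => [//|x y|//|x] /= vr.
  rewrite andbT => /andP [/alP [i hi ei] /alP [j hj ej]]; rewrite ei ej !idxE // -h //.
  by rewrite Fv_gt // -ei -ej; case/andP: vr.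
rewrite andbT => /alP [i hi ->]; rewrite idxE // -h // Fv_diag vr /=.
by rewrite mulrC mulKf ?two0.
Qed.

Section Invariant.
Variable T : ncpoly F.
Hypothesis qT : nletters Qn T.
Hypothesis iT : inv T.
Let f X := ev idfun (vX X) T.

Lemma f_loc X Y : (forall i j, (i < n)%N -> (j < n)%N -> X i j = Y i j) -> f X = f Y.
Proof.
move=> h; apply: (eq_ev idfun qT) => r /andP []; case: r => [//|x y|//|x] /= vr.
  by rewrite andbT => /andP [/alP [i hi ->] /alP [j hj ->]]; rewrite !idxE // h.
by rewrite andbT => /alP [i hi ->]; rewrite idxE // h.
Qed.

Lemma f_lin : line_polynomial f.
Proof.
move=> X H; exists (ev polyC (fun r => (vX X r)%:P + (vX H r)%:P * 'X) T) => s.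
rewrite horner_ev; congr (ev _ _ T); apply: funext => r.
rewrite hornerD hornerM !hornerC hornerX.
by case: r => [i j|i j|i|i] /=; rewrite /line; ring.
Qed.

Lemma f_cong1 X p b u : sgnsym csg X -> (p < b < n)%N ->
  f (cong p (fun i => if i == b then u else 0) X) = f X.
Proof.
move=> sX /andP [pb bn]; have pn := ltn_trans pb bn.
rewrite /f -(@ev_flow T (a p) (a b) (vX X) u) ?gtE //; last exact: Qn_Qpp.
apply/esym/ev_read => // i j hi hj.
rewrite -horner_Fv flow_Fv ?gtE // /congA /cong !hornerD !hornerM !hornerC !Fv_vX //.
have if1 k : (k < n)%N -> (if a k == a b then 'X else 0 : {poly F}).[u] = if k == b then u else 0.
  move=> hk; have -> : (a k == a b) = (k == b).
    by apply/eqP/eqP => [/(decseq_inj so ta.1 hk bn)|->].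
  by case: eqP; rewrite ?hornerX ?hornerC.
by rewrite !if1.
Qed.

(** Elementary matrices with common source [p] and $c_p=0$ multiply by adding coefficients, so the
    congruence is built from single-entry ones. [cm m] is [c] truncated at [m]. *)
Lemma f_cong p c X : sgnsym csg X -> (forall i, c i != 0 -> (p < i < n)%N) ->
  f (cong p c X) = f X.
Proof.
move=> sX hc; pose cm m i := if (i < m)%N then c i else 0.
have step m : f (cong p (cm m) X) = f X.
  elim: m => [|m IH].
    congr f; apply: funext => i; apply: funext => j.
    by rewrite /cong /cm !ltn0; ring.
  have [c0|c0] := eqVneq (c m) 0.
    rewrite -IH; congr (f (cong p _ X)); apply: funext => i; rewrite /cm ltnS leq_eqVlt.
    by case: (i =P m) => [->|//] /=; rewrite ltnn c0.
  have /andP [pm mn] := hc _ c0.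
  have cp : c p = 0 by apply/eqP; apply: contraT => /hc; rewrite ltnn.
  rewrite -IH -(@f_cong1 (cong p (cm m) X) p m (c m)) ?pm //; last exact: cong_sgnsym.
  congr f; apply: funext => i; apply: funext => j; rewrite /cong.
  have cmp : cm m p = 0 by rewrite /cm pm.
  have cE k : cm m.+1 k = cm m k + (if k == m then c m else 0).
    rewrite /cm ltnS leq_eqVlt; case: (k =P m) => [->|_] /=; last by rewrite addr0.
    by rewrite ltnn add0r.
  rewrite !cE cmp; move: (cm m i) (cm m j) => x1 x2.
  by move: (if i == m then c m else 0) (if j == m then c m else 0) => x3 x4; ring.
rewrite -(step n); congr (f (cong p _ X)); apply: funext => i; rewrite /cm.
by case: ifP => // /negbT; rewrite -leqNgt => le; apply/eqP; apply: contraT => /hc; lia.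
Qed.
End Invariant.

(** Number of cascade steps that fit into the segment; in types B and D one index may be left
    over. *)
Definition K := if ctype_eqb t TC then n else n./2.
Lemma K_rate q : (q <= K)%N -> (q * rate t <= n)%N.
Proof. by rewrite /K /rate; case: ifP => _; rewrite ?muln1 ?muln2; lia. Qed.

Definition gv (A : comNzRingType) (iota : {rmorphism F -> A}) q X : A :=
  if ctype_eqb t TC then rdet q X else rpf iota q X.
Definition Gterm q b : term F :=
  if ctype_eqb t TC then Delta_C F t prec q b else Pf_BD F q b.

Lemma eq_gv (A : comNzRingType) (iota : {rmorphism F -> A}) q X Y :
  (forall i j, (i < q * rate t)%N -> (j < q * rate t)%N -> X i j = Y i j) ->
  gv iota q X = gv iota q Y.
Proof.
rewrite /gv /rate; case: ifP => _; rewrite ?muln1 ?muln2 => h; first exact: eq_rdet.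
exact: eq_rpf.
Qed.

Lemma gv_cong (A : comNzRingType) (iota : {rmorphism F -> A}) q p b u X : (p < b)%N ->
  gv iota q (congA p (fun i => if i == b then u else 0) X) = gv iota q X.
Proof.
move=> lt; rewrite /gv; case: ifP => _; last exact: rpf_cong.
by apply: rdet_cong => i le; case: eqP => // e; move: lt le; rewrite e; lia.
Qed.

Lemma gen_value (A : comNzRingType) (iota : {rmorphism F -> A}) v q b :
  decseq gt (q * rate t) b ->
  evt iota v (Gterm q b) = gv iota q (fun i j => Fv iota v (b i) (b j)).
Proof.
rewrite /Gterm /gv /rate; case: ifP => tC; rewrite ?muln1 ?muln2 => db.
  rewrite /Delta_C /tdet evt_tsum big_map big_enum /rdet /determinant.
  apply: eq_big => [s|s _]; first by rewrite inE.
  rewrite evt_scale rmorph_sign evt_tprod big_map big_enum; congr (_ * _).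
  apply: eq_bigr => r _; rewrite mxE; move: (s r) => c.
  have hc := ltn_ord c; have hr := ltn_ord r.
  (* The condition marks the entries whose two indices coincide once the columns are reversed. *)
  case: eqP => e.
    have -> : (q.-1 - c)%N = r by lia.
    by rewrite evt_scale evt_g // Fv_diag tC.
  have hl : (q.-1 - c < q)%N by lia.
  case: (ltngtP r (q.-1 - c)%N) => lt; last by exfalso; lia.
    have g : gt (b r) (b (q.-1 - c)%N) by apply: db; rewrite lt.
    by rewrite /fplus g evt_g ?Fv_gt //= nA.
  have g : gt (b (q.-1 - c)%N) (b r) by apply: db; rewrite lt.
  rewrite /fplus (so_asym so g) evt_g; last by rewrite /= nA.
  by rewrite Fv_lt // /csg tC rmorph1 mul1r.
rewrite /Pf_BD /tpf evt_scale /rpf; congr (_ * _).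
rewrite evt_tsum big_map big_enum.
apply: eq_big => [s|s _]; first by rewrite inE.
rewrite evt_scale rmorph_sign evt_tprod big_map big_enum; congr (_ * _).
apply: eq_bigr => r _; move: (s (odbl r)) (s (odbl1 r)) => x y.
have hx := ltn_ord x; have hy := ltn_ord y.
case: (ltngtP x y) => lt.
- have g : gt (b x) (b y) by apply: db; rewrite lt.
  by rewrite evt_g ?Fv_gt //= nA.
- have g : gt (b y) (b x) by apply: db; rewrite lt.
  rewrite evt_scale evt_g; last by rewrite /= nA.
  by rewrite Fv_lt // /csg tC.
- by rewrite evt_c rmorph0 lt Fv_diag tC.
Qed.

Lemma lett_g (Q : pred proot) r : Q r -> lett t prec Q (Tg r : term F).
Proof. by move=> h; rewrite /lett /=; case: ifP => //= _; rewrite h. Qed.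

Lemma Gterm_lett (Q : pred proot) q b : decseq gt (q * rate t) b ->
  (forall i j, (i < q * rate t)%N -> (j < q * rate t)%N -> gt (b i) (b j) -> Q (PP (b i) (b j))) ->
  (ctype_eqb t TC -> forall i, (i < q * rate t)%N -> Q (PL (b i))) ->
  lett t prec Q (Gterm q b).
Proof.
rewrite /Gterm /rate; case: ifP => tC; rewrite ?muln1 ?muln2 => db h1 h2.
  apply: lett_tsum => z1 hz1; have [s ->] := In_map hz1; apply: lett_scale.
  apply: lett_tprod => z2 hz2; have [r ->] := In_map hz2; move: (s r) => c.
  have hc := ltn_ord c; have hr := ltn_ord r.
  case: eqP => e; first by apply: lett_scale; apply: lett_g; apply: h2.
  have hl : (q.-1 - c < q)%N by lia.
  apply: lett_g; rewrite /fplus; case: (ltngtP r (q.-1 - c)%N) => lt; last by exfalso; lia.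
    have g : gt (b r) (b (q.-1 - c)%N) by apply: db; rewrite lt.
    by rewrite g; apply: h1.
  have g : gt (b (q.-1 - c)%N) (b r) by apply: db; rewrite lt.
  by rewrite (so_asym so g); apply: h1.
apply: lett_scale; apply: lett_tsum => z1 hz1; have [s ->] := In_map hz1; apply: lett_scale.
apply: lett_tprod => z2 hz2; have [r ->] := In_map hz2.
move: (s (odbl r)) (s (odbl1 r)) => x y.
have hx := ltn_ord x; have hy := ltn_ord y.
case: (ltngtP x y) => lt //.
  by apply: lett_g; apply: h1 => //; apply: db; rewrite lt.
by apply: lett_scale; apply: lett_g; apply: h1 => //; apply: db; rewrite lt.
Qed.

Lemma Fv_polyC v i j : Fv polyC (fun r => (v r)%:P) i j = (Fv idfun v i j)%:P.
Proof.
rewrite /Fv [RHS]raddf_sum; apply: eq_bigr => e _.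
by rewrite [RHS]rmorphM.
Qed.

(** Only $f_{\vartheta_x-\vartheta_y}$ with [y] among the indices of the generator acts
    nontrivially. Then [x] lies above [y], hence is an earlier index of the same initial segment,
    and the flow is a congruence that preserves the minor or Pfaffian. *)
Lemma Gterm_inv q b : topseq gt (q * rate t) b -> inv (expand (Gterm q b)).
Proof.
move=> tb r v vr; have db := tb.1; set T := expand _.
pose bl := [seq b i | i <- iota 0 (q * rate t)].
have mb i : (i < q * rate t)%N -> b i \in bl by move=> h; apply: map_f; rewrite mem_iota.
pose Qb s := Qpp s && all (mem bl) (supp s).
have qT : nletters Qb T.
  apply: Gterm_lett => // [i j hi hj g|tC i hi].
    by rewrite /Qb /= nA g !mb.
  by rewrite /Qb /= tC mb.
have zero : (forall s, Qb s -> coad r v s = 0) -> der v (coad r v) T = 0.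
  by move=> h; rewrite -[RHS](der0 v T); apply: (eq_der qT).
case: r vr zero => [x y|x y|x|x] vr zero; last first.
- by apply: zero => s /andP []; case: s => // *; rewrite /coad /= big_nil.
- by apply: zero => s /andP []; case: s => // *; rewrite /coad /= big_nil.
- by apply: zero => s /andP []; case: s => // *; rewrite /coad /= big_nil.
have [hy|ny] := boolP (y \in bl); last first.
  apply: zero => s /andP []; case: s => [//|i j|//|i] /= _.
  - rewrite andbT => /andP [hi hj]; rewrite coad_PP.
    have -> : (y == i) = false by apply/negbTE; apply: contraNneq ny => ->.
    have -> : (y == j) = false by apply/negbTE; apply: contraNneq ny => ->.
    by rewrite !mul0r addr0.
  - rewrite andbT => hi; rewrite coad_PL.
    have -> : (y == i) = false by apply/negbTE; apply: contraNneq ny => ->.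
    by rewrite mul0r.
case/mapP: hy => j; rewrite mem_iota add0n => hj ey.
have [i lij ex] : exists2 i, (i < j)%N & b i = x by apply: tb.2; rewrite -?ey.
rewrite (@der_flow _ v (coad (PM x y) v) T (flow x y v)); last 2 first.
- by move=> s; rewrite flow_at expr0n /= !mulr0 !addr0.
- by move=> s; rewrite flow_deriv mul0rn mulr0 addr0.
have -> : ev polyC (flow x y v) T = ev polyC (fun s => (v s)%:P) T.
  rewrite -!/(evt _ _ _) !gen_value //.
  rewrite -[RHS](@gv_cong _ _ q i j 'X) //; apply: eq_gv => k l hk hl.
  rewrite flow_Fv // /congA -ex !Fv_polyC ey.
  have bE k' : (k' < q * rate t)%N -> (b k' == b j) = (k' == j).
    by move=> h; apply/eqP/eqP => [/(decseq_inj so db h hj)|->].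
  by rewrite !bE.
rewrite deriv_ev -[RHS](der0 v T); congr (der _ _ T); apply: funext => s.
  by rewrite hornerC.
by rewrite derivC hornerC.
Qed.

(** Coordinates of the diagonal slice (type C) or of the slice with 2x2 blocks (types B, D); [2^-1]
    has the same origin as in [vX]. *)
Definition kap (r : proot) : F :=
  match r with
  | PL x => if ctype_eqb t TC && (x \in al) then 2^-1 else 0
  | PP x y => if [&& ~~ ctype_eqb t TC, x \in al, y \in al, ~~ odd (idx x) &
                     idx y == (idx x).+1] then 1 else 0
  | _ => 0
  end.
Definition lam (r : proot) : nat :=
  match r with PL x => idx x | PP x y => (idx x)./2 | _ => 0%N end.
Definition slm (d : nat -> F) := if ctype_eqb t TC then diagm d else skewm d.

Lemma slm_sym d : sgnsym csg (slm d).
Proof.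
rewrite /slm /csg; case: ifP => _; last exact: skewm_sgnsym.
by move=> i j; rewrite /diagm mul1r eqtype.eq_sym; case: eqP => [->|].
Qed.

Lemma sv_vX d r : Qn r -> kap r * d (lam r) = vX (slm d) r.
Proof.
move=> /andP []; case: r => [//|x y|//|x] /= vr; rewrite andbT.
  case/andP => /[dup] hx /alP [i hi ex] /[dup] hy /alP [j hj ey].
  case/andP: vr => _; rewrite hx hy /= ex ey !idxE // gtE // => lt; rewrite /slm.
  have [tC|tC] /= := boolP (ctype_eqb t TC); first by rewrite mul0r /diagm ltn_eqF.
  rewrite /skewm /partner; have [oi|oi] /= := boolP (odd i).
    by rewrite mul0r; case: eqP => // e; move: lt; rewrite e; lia.
  by case: eqP => _; rewrite ?mul1r ?mul0r.
by move=> hx; rewrite vr hx /= /slm vr /diagm eqxx mulrC.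
Qed.

Lemma lam_lt r : kap r != 0 -> (lam r < K)%N.
Proof.
rewrite /K; case: r => [x y|x y|x|x] /=; rewrite ?eqxx //; case: ifP; rewrite ?eqxx //.
  case/and5P => /negbTE -> hx hy _ /eqP e _.
  have : (idx y < n)%N by rewrite /idx -[X in (_ < X)%N](size_iota 0 n) -(size_map a) index_mem.
  by rewrite e; lia.
case/andP => -> hx _; by rewrite /idx -[X in (_ < X)%N](size_iota 0 n) -(size_map a) index_mem.
Qed.

Lemma gv_slice q : exists2 c : F, c != 0 &
  forall d, gv idfun q (slm d) = c * \prod_(i < q) d i.
Proof.
rewrite /gv /slm; case: (ctype_eqb t TC).
  exists ((-1) ^+ rev_perm q); first by rewrite signr_eq0.
  by move=> d; apply: rdet_diag.
by have [c c0 h] := @rpf_slice F F idfun q; exists c.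
Qed.

Variable G : nat -> term F.
(** A generator determines its listing only on the indices in range, so [b] agrees with [a] there
    and not as a function. *)
Hypothesis HG : forall i, (i < K)%N -> exists b, [/\ topseq gt (i.+1 * rate t) b,
  (forall j, (j < i.+1 * rate t)%N -> b j = a j) & G i.+1 = Gterm i.+1 b].

Lemma al_mem i : (i < n)%N -> a i \in al.
Proof. by move=> h; apply: map_f; rewrite mem_iota. Qed.

Lemma slice_value i d c : (i < K)%N ->
  (forall d, gv idfun i.+1 (slm d) = c * \prod_(j < i.+1) d j) ->
  evt idfun (fun r => kap r * d (lam r)) (G i.+1) = c * \prod_(j < i.+1) d j.
Proof.
move=> lt hc; have [b [tb eb ->]] := HG lt; rewrite (gen_value _ _ tb.1) -hc.
apply: eq_gv => k l hk hl; rewrite !eb //.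
have hkn := leq_trans hk (K_rate lt); have hln := leq_trans hl (K_rate lt).
rewrite -[RHS](Fv_vX (slm_sym d) hkn hln) /Fv; apply: eq_big_seq => e he.
congr (_ * _); apply: sv_vX.
exact: (allP (fp_Qn (al_mem hkn) (al_mem hln)) _ he).
Qed.

Lemma bcd_data : exists c, slice_data t prec G K Qn kap lam c.
Proof.
have /choice [c hc] : forall i, exists c : F, c != 0 /\
    forall d, gv idfun i.+1 (slm d) = c * \prod_(j < i.+1) d j.
  by move=> i; have [c c0 h] := gv_slice i.+1; exists c.
have sl T d : nletters Qn T -> ev idfun (fun r => kap r * d (lam r)) T = ev idfun (vX (slm d)) T.
  by move=> qT; apply: (eq_ev idfun qT) => r qr; apply: sv_vX.
exists c; split.
- exact: Qn_valid.
- exact: Qn_comm.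
- exact: Qn_ad.
- exact: lam_lt.
- move=> i lt; have [b [tb eb ->]] := HG lt; apply: Gterm_lett tb.1 _ _.
    move=> k l hk hl g; rewrite /Qn /= nA g /= !eb // !al_mem //;
    exact: leq_trans (K_rate lt).
  by move=> tC k hk; rewrite /Qn /= tC eb // al_mem //; apply: leq_trans (K_rate lt).
- by move=> i lt; have [b [tb eb ->]] := HG lt; apply: Gterm_inv.
- by move=> i; have [] := hc i.
- by move=> i d lt; apply: slice_value lt (hc i).2.
- move=> T qT iT h0 v.
  rewrite (@ev_read T (fun i j => Fv idfun v (a i) (a j))) //.
  have sF : sgnsym csg (fun i j => Fv idfun v (a i) (a j)) by move=> i j; apply: Fv_sym.
  have h1 d : ev idfun (vX (slm d)) T = 0 by rewrite -sl.
  have fl := f_loc qT; have fn := @f_lin T; have fc := f_cong qT iT.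
  move: sF h1 fc; rewrite /slm /csg; case: ifP => _ sF h1 fc.
    exact: (@sym_zero F n (fun X => ev idfun (vX X) T)).
  exact: (@skew_zero F n (fun X => ev idfun (vX X) T)).
- move=> T qT iT q d lt d0.
  have fl := f_loc qT; have fn := @f_lin T; have fc := f_cong qT iT.
  have [pol hpol] : exists pol : {poly F}, forall s, s != 0 ->
      ev idfun (vX (slm (rescale q s d))) T = pol.[s].
    move: lt fc; rewrite /slm /csg /K; case: ifP => _ lt fc.
      exact: (@sym_dominant F n (fun X => ev idfun (vX X) T)).
    exact: (@skew_dominant F n (fun X => ev idfun (vX X) T)).
  by exists pol => s s0; rewrite sl // hpol.
Qed.
End BCD.

(** * Types B, C and D: reduction to sums with indices in an initial segment *)

Section BCDReduction.
Variables (F : numClosedFieldType) (t : ctype) (prec : rel sel).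
Local Notation gt := (gtth t prec).
Hypothesis so : strict_order gt.
Hypothesis nA : ~~ ctype_eqb t TA.
Local Notation valid := (valid t prec).
Local Notation br := (@br F t prec).
Local Notation fp := (@fp F t prec).
Local Notation inv := (@inv F t prec).
Local Notation fplus := (fplus t prec).
Implicit Types T : ncpoly F.

Lemma fp_ne x y : x != y -> exists2 c, c != 0 & fp x y = [:: (c, fplus x y)].
Proof.
move=> ne; rewrite /fp /Defs.fplus; case: ifP => g1; first by exists 1; rewrite ?oner_eq0.
have := so_total so ne; rewrite g1 /= => ->; exists (csg F t) => //.
by rewrite /csg; case: ifP => _; rewrite ?oppr_eq0 oner_eq0.
Qed.
Lemma fplusC x y : x != y -> fplus x y = fplus y x.
Proof.
move=> ne; rewrite /Defs.fplus; have /orP [g|g] := so_total so ne; by rewrite g (so_asym so g).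
Qed.
Lemma fplus_inj k x y : k != x -> k != y -> fplus k x = fplus k y -> x = y.
Proof.
move=> /eqP nx /eqP ny; rewrite /Defs.fplus; case: ifP => _; case: ifP => _ [] //; congruence.
Qed.
Lemma fplus_supp k x : k \in supp (fplus k x).
Proof. by rewrite /Defs.fplus; case: ifP => _ /=; rewrite !inE eqxx ?orbT. Qed.
Lemma fplus_valid x y : x != y -> valid (fplus x y).
Proof.
move=> ne; rewrite /Defs.fplus; case: ifP => g /=; first by rewrite nA.
by have := so_total so ne; rewrite nA g.
Qed.

Variable M : seq nat.
Lemma notL k r : k \notin M -> k \in supp r -> ~~ inL t prec M r.
Proof. by move=> kM kr; rewrite /inL; apply/nandP; right; apply/allPn; exists k. Qed.

Lemma memM r x : inL t prec M r -> x \in supp r -> x \in M.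
Proof. by move=> /andP [_ /allP h] /h. Qed.
Lemma neqM k x : k \notin M -> x \in M -> k != x.
Proof. by move=> kM xM; apply: contraNneq kM => ->. Qed.

Variable T : ncpoly F.
Hypothesis lT : nletters (inL t prec M) T.
Hypothesis iT : inv T.

(** For fresh [k], $[f_{\vartheta_k+\vartheta_l},f_{\vartheta_i-\vartheta_l}]=\pm
    f_{\vartheta_k+\vartheta_i}$, from which [i] can be recovered. Any position of [k] serves, since
    $\vartheta_k+\vartheta_l$ is always a positive root. *)
Lemma kill_PM i l : inL t prec M (PM i l) -> forall v, der v (delta F (PM i l)) T = 0.
Proof.
move=> l0; have [k kM] := fresh_nat M.
have iM : i \in M by apply: (memM l0); rewrite !inE eqxx.
have lM : l \in M by apply: (memM l0); rewrite !inE eqxx orbT.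
have kl := neqM kM lM.
have B i' j' : i' \in M -> j' \in M -> (j' = l -> exists2 c, c != 0 &
    br (fplus k l) (PM i' j') = [:: (c, fplus k i')]) /\
    (j' <> l -> br (fplus k l) (PM i' j') = [::]).
  move=> hi hj; have ki := neqM kM hi; have kj := neqM kM hj.
  have jk : (j' == k) = false by rewrite eqtype.eq_sym (negbTE kj).
  rewrite {1 3}/Defs.fplus; split=> [->|/eqP/negbTE jl].
    have lk : (l == k) = false by rewrite eqtype.eq_sym (negbTE kl).
    case: ifP => _ /=; rewrite eqxx lk ?cats0 /=.
      have [c c0 ->] := fp_ne ki; exists (- c) => //=; by rewrite oppr_eq0.
    have ik : i' != k by rewrite eqtype.eq_sym.
    have [c c0 ->] := fp_ne ik; exists (- c); first by rewrite oppr_eq0.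
    by rewrite /= fplusC.
  by case: ifP => _ /=; rewrite jk jl.
have [c c0 e0] := (B i l iM lM).1 (erefl _).
apply: (kill lT iT (fplus_valid kl) l0 e0 c0) => s e ls.
case: s ls => [i' j'|i' j'|i'|i'] ls; try by rewrite /Defs.fplus; case: ifP.
have i'M : i' \in M by apply: (memM ls); rewrite !inE eqxx.
have j'M : j' \in M by apply: (memM ls); rewrite !inE eqxx orbT.
have [B1 B2] := B i' j' i'M j'M; have [ej|nj] := EM (j' = l); last by rewrite B2.
have [c' _ ->] := B1 ej; rewrite inE => /eqP -> /=; split.
  exact: notL kM (fplus_supp _ _).
by move=> /(fplus_inj (neqM kM i'M) (neqM kM iM)) ->; rewrite ej.
Qed.

(** Type B: for fresh [k], $[f_{\vartheta_k},f_{\vartheta_l}]=\pm f_{\vartheta_k+\vartheta_l}$. *)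
Lemma kill_PS l : inL t prec M (PS l) -> forall v, der v (delta F (PS l)) T = 0.
Proof.
move=> l0; have [k kM] := fresh_nat M.
have lM : l \in M by apply: (memM l0); rewrite !inE eqxx.
have vk : valid (PS k) by case/andP: l0.
have B l' : l' \in M -> exists2 c, c != 0 & br (PS k) (PS l') = [:: (c, fplus k l')].
  move=> h; have [c c0 e] := fp_ne (neqM kM h); exists (- c); first by rewrite oppr_eq0.
  by rewrite /= e.
have [c c0 e0] := B l lM.
apply: (kill lT iT vk l0 e0 c0) => s e ls.
case: s ls => [i' j'|i' j'|i'|i'] ls //.
  have j'M : j' \in M by apply: (memM ls); rewrite !inE eqxx orbT.
  by rewrite /= eqtype.eq_sym (negbTE (neqM kM j'M)).
have i'M : i' \in M by apply: (memM ls); rewrite !inE eqxx.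
have [c' _ ->] := B i' i'M; rewrite inE => /eqP -> /=; split.
  exact: notL kM (fplus_supp _ _).
by move=> /(fplus_inj (neqM kM i'M) (neqM kM lM)) ->.
Qed.

(** Unites the two orders of a sum and the long root, which behave alike under brackets with
    $f_{\vartheta_k-\vartheta_z}$. *)
Definition is_sum z w s := s = PP z w \/ s = PP w z \/ (s = PL z /\ w = z).
Lemma is_sum_unique z w s s' : valid s -> valid s' -> is_sum z w s -> is_sum z w s' -> s = s'.
Proof.
move=> v1 v2 [e|[e|[e ew]]] [e'|[e'|[e' ew']]]; rewrite {}e {}e' in v1 v2 *; rewrite ?ew ?ew' in v1 v2 * => //;
  move: v1 v2 => /=; do ?[case/andP => _]; move=> g1; do ?[case/andP => _]; move=> g2;
  rewrite ?(so_irr so) in g1 g2; rewrite // ?(so_asym so g1) in g2; by [].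
Qed.

(** $[f_{\vartheta_k-\vartheta_z},f_{\vartheta_z+\vartheta_w}]$ is a nonzero multiple of
    $f_{\vartheta_k+\vartheta_w}$. The fresh [k] must lie above [z] for $\vartheta_k-\vartheta_z$ to
    be positive, which is why an initial segment survives. *)
Lemma kill_sum z w s0 : inL t prec M s0 -> is_sum z w s0 ->
  (exists2 k, k \notin M & gt k z) -> forall v, der v (delta F s0) T = 0.
Proof.
move=> l0 S0 [k kM gk].
have zM : z \in M by apply: (memM l0); case: S0 => [->|[->|[-> _]]]; rewrite !inE eqxx ?orbT.
have wM : w \in M by apply: (memM l0); case: S0 => [->|[->|[-> ->]]]; rewrite !inE eqxx ?orbT.
have kn x : x \in M -> (x == k) = false by move=> h; rewrite eqtype.eq_sym; apply/negbTE/neqM.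
have B s e : inL t prec M s -> e \in br (PM k z) s -> k \in supp e.2 /\
    forall w', w' \in M -> e.2 = fplus k w' -> is_sum z w' s.
  move=> ls; case: s ls => [i j|i j|i|i] ls.
  - have jM : j \in M by apply: (memM ls); rewrite !inE eqxx orbT.
    rewrite /= kn // cats0; case: eqP => // _; rewrite inE => /eqP -> /=; split.
      by rewrite !inE eqxx.
    by move=> w' _; rewrite /Defs.fplus; case: ifP.
  - have iM : i \in M by apply: (memM ls); rewrite !inE eqxx.
    have jM : j \in M by apply: (memM ls); rewrite !inE eqxx orbT.
    rewrite /= mem_cat => /orP []; case: eqP => // ez.
      have [c _ ->] := fp_ne (neqM kM jM); rewrite inE => /eqP -> /=; split; first exact: fplus_supp.
      by move=> w' hw /(fplus_inj (neqM kM jM) (neqM kM hw)) <-; left; rewrite ez.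
    have ik : i != k by rewrite eqtype.eq_sym neqM.
    have [c _ ->] := fp_ne ik; rewrite inE => /eqP -> /=; rewrite fplusC //; split; first exact: fplus_supp.
    by move=> w' hw /(fplus_inj (neqM kM iM) (neqM kM hw)) <-; right; left; rewrite ez.
  - rewrite /=; case: eqP => // _; rewrite inE => /eqP -> /=; split; first by rewrite inE eqxx.
    by move=> w' _; rewrite /Defs.fplus; case: ifP.
  - have iM : i \in M by apply: (memM ls); rewrite !inE eqxx.
    rewrite /=; case: eqP => // ez; have [c _ ->] := fp_ne (neqM kM iM).
    rewrite inE => /eqP -> /=; split; first exact: fplus_supp.
    by move=> w' hw /(fplus_inj (neqM kM iM) (neqM kM hw)) <-; right; right; rewrite ez.
have [c c0 e0] : exists2 c, c != 0 & br (PM k z) s0 = [:: (c, fplus k w)].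
  case: S0 (l0) => [->|[->|[-> ->]]] /andP [/= v0 _].
  - case/andP: v0 => _ g; rewrite eqxx (negbTE (so_neq so g)) cats0.
    exact: fp_ne (neqM kM wM).
  - case/andP: v0 => _ g; rewrite eqxx eqtype.eq_sym (negbTE (so_neq so g)) /=.
    have wk : w != k by rewrite eqtype.eq_sym neqM.
    by have [c c0 ->] := fp_ne wk; exists c; rewrite // fplusC.
  - by rewrite eqxx; apply: fp_ne (neqM kM zM).
have vk : valid (PM k z) by [].
apply: (kill lT iT vk l0 e0 c0) => s e ls he; have [B1 B2] := B s e ls he; split.
  exact: notL kM B1.
move=> /(B2 _ wM) S1; apply: (is_sum_unique _ _ S1 S0); first by case/andP: ls.
by case/andP: l0.
Qed.

Variables (n : nat) (a : nat -> nat).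
Hypothesis hM : forall x, x \in M -> (forall r, (r < n)%N -> a r <> x) ->
  exists2 k, k \notin M & gt k x.

Lemma bcd_red v : ev idfun v T = ev idfun v [seq e <- T | all (Qn t prec n a) e.2].
Proof.
apply: (kill_reduce (L := inL t prec M)) => // s ls nq; clear v.
have out x : x \in M -> x \notin [seq a i | i <- iota 0 n] -> exists2 k, k \notin M & gt k x.
  move=> xM nx; apply: hM => // r hr e; case/negP: nx; rewrite -e.
  by apply: map_f; rewrite mem_iota.
case: s ls nq => [i j|i j|i|i] ls nq; [exact: kill_PM| |exact: kill_PS|].
- have iM : i \in M by apply: (memM ls); rewrite !inE eqxx.
  have jM : j \in M by apply: (memM ls); rewrite !inE eqxx orbT.
  have vs : valid (PP i j) by case/andP: ls.
  move: nq; rewrite /Qn /Qpp vs /= andbT negb_and => /orP [/(out _ iM)|/(out _ jM)] hk.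
    by apply: (kill_sum ls (z := i) (w := j)) => //; left.
  by apply: (kill_sum ls (z := j) (w := i)) => //; right; left.
- have iM : i \in M by apply: (memM ls); rewrite !inE eqxx.
  have vs : valid (PL i) by case/andP: ls.
  move: nq; rewrite /Qn /Qpp vs /= andbT => /(out _ iM) hk.
  by apply: (kill_sum ls (z := i) (w := i)) => //; right; right.
Qed.
End BCDReduction.

(** * Type A: the rectangular matrix of values *)

Section TypeA.
Variables (F : numClosedFieldType) (t : ctype) (prec : rel sel).
Local Notation gt := (gtth t prec).
Local Notation lt' := (fun i j => gt j i).
Hypothesis so : strict_order gt.
Hypothesis tA : ctype_eqb t TA.
Local Notation valid := (valid t prec).
Local Notation coad := (@coad F t prec).
Local Notation br := (@br F t prec).
Local Notation inv := (@inv F t prec).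
Local Notation evt := (evt t prec).
Local Notation expand := (@expand F t prec).
Implicit Types T : ncpoly F.

Lemma validA r : valid r -> exists i j, r = PM i j /\ gt i j.
Proof.
move: tA; case: r => [i j|i j|i|i] /=; case: (t) => //= _ g; by exists i, j.
Qed.

Lemma coad_PM v x y i j : coad (PM x y) v (PM i j) =
  (y == i)%:R * v (PM x j) - (j == x)%:R * v (PM i y).
Proof.
by rewrite /coad /= big_cat /=; case: (y == i); case: (j == x);
  rewrite ?big_nil ?big_seq1 /= ?mul1r ?mul0r ?mulN1r ?subr0 ?addr0 ?oppr0.
Qed.

(** Affine in the parameter, in contrast to [flow]: a quadratic term could sit only at
    $\vartheta_y-\vartheta_x$, which is negative. *)
Definition flowA x y (v : proot -> F) (s : proot) : {poly F} :=
  (v s)%:P + (coad (PM x y) v s)%:P * 'X.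
Lemma flowA_at x y v s c : (flowA x y v s).[c] = v s + coad (PM x y) v s * c.
Proof. by rewrite /flowA hornerD hornerM !hornerC hornerX. Qed.
Lemma flowA_deriv x y v s c : (flowA x y v s)^`().[c] = coad (PM x y) v s.
Proof. by rewrite /flowA derivD derivM !derivC derivX mul0r !add0r mulr1 hornerC. Qed.

Lemma flowA_field x y v s c : gt x y -> valid s ->
  (flowA x y v s)^`().[c] = coad (PM x y) (fun r => (flowA x y v r).[c]) s.
Proof.
move=> gxy /validA [i [j [-> gij]]]; rewrite flowA_deriv !coad_PM !flowA_at !coad_PM.
have -> : (y == x) = false by rewrite eqtype.eq_sym; apply/negbTE/(so_neq so).
have [ey|_] := eqVneq y i; have [ej|_] := eqVneq j x; rewrite ?mulr0n ?mulr1n; try by ring.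
by exfalso; move: gij; rewrite ej -ey (so_asym so gxy).
Qed.

Lemma ev_flowA T x y v c : gt x y -> nletters valid T -> inv T ->
  ev idfun (fun r => (flowA x y v r).[c]) T = ev idfun v T.
Proof.
move=> gxy qT iT; rewrite (@ev_curve _ (flowA x y v)).
  by congr (ev _ _ T); apply: funext => r; rewrite flowA_at mulr0 addr0.
move=> c0; rewrite -[RHS](iT (PM x y) (fun r => (flowA x y v r).[c0]) gxy).
by apply: (eq_der qT) => // r qr; apply: flowA_field.
Qed.

Variables (p m : nat) (a b : nat -> nat).
Hypothesis ta : topseq gt p a.
Hypothesis tb : topseq lt' m b.
Local Notation al := [seq a i | i <- iota 0 p].
Local Notation bl := [seq b i | i <- iota 0 m].
Definition ia x := index x [seq a i | i <- iota 0 p].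
Definition ib x := index x [seq b i | i <- iota 0 m].
(** Rows come from the initial segment and columns from the final one; their lengths may differ, so
    the matrix is rectangular. *)
Definition QA r := if r is PM x y then (x \in al) && (y \in bl) else false.

Lemma mapiP (c : nat -> nat) k x :
  reflect (exists2 i, (i < k)%N & x = c i) (x \in [seq c i | i <- iota 0 k]).
Proof.
apply: (iffP mapP) => [[l]|[l h ->]]; last by exists l; rewrite ?mem_iota.
by rewrite mem_iota => h ->; exists l.
Qed.
Lemma ab_gt i j : (i < p)%N -> (j < m)%N -> gt (a i) (b j).
Proof. exact: (top_bot_disjoint so ta tb). Qed.
Lemma index_seq gt' (so' : strict_order gt') (c : nat -> nat) k i : decseq gt' k c -> (i < k)%N ->
  index (c i) [seq c i | i <- iota 0 k] = i.
Proof.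
move=> dc lt; set s := map _ _.
have -> : c i = nth 0%N s i by rewrite (nth_map 0%N) ?size_iota // nth_iota.
rewrite index_uniq ?size_map ?size_iota // map_inj_in_uniq ?iota_uniq // => x y.
by rewrite !mem_iota => hx hy; apply: (decseq_inj so' dc).
Qed.
Lemma iaE i : (i < p)%N -> ia (a i) = i.
Proof. exact: (index_seq so ta.1). Qed.
Lemma ibE i : (i < m)%N -> ib (b i) = i.
Proof. exact: (index_seq (so_rev so) tb.1). Qed.

Lemma QA_valid : {subset QA <= valid}.
Proof.
by case=> [x y|//|//|//] /andP [/mapiP [i hi ->] /mapiP [j hj ->]]; apply: ab_gt.
Qed.
Lemma al_upA x y : y \in al -> gt x y -> x \in al.
Proof.
case/mapiP => i lt -> /(ta.2 _ _ lt) [j lj <-]; apply/mapiP.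
by exists j => //; apply: ltn_trans lt.
Qed.
Lemma bl_downA x y : x \in bl -> gt x y -> y \in bl.
Proof.
case/mapiP => i lt -> /(tb.2 _ _ lt) [j lj <-]; apply/mapiP.
by exists j => //; apply: ltn_trans lt.
Qed.
Lemma ab_neq x y : x \in al -> y \in bl -> x != y.
Proof. by case/mapiP => i hi -> /mapiP [j hj ->]; apply: (so_neq so); apply: ab_gt. Qed.

Lemma QA_ad r s : valid r -> QA s -> all (fun e => QA e.2) (br r s).
Proof.
move=> /validA [x [y [-> g]]]; case: s => [i j|//|//|//] /andP [hi hj].
rewrite /= all_cat; apply/andP; split; case: eqP => // e /=; rewrite andbT.
  by rewrite hj andbT; apply: (al_upA hi); rewrite -e.
by rewrite hi; apply: (bl_downA hj); rewrite e.
Qed.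
Lemma QA_comm r s : QA r -> QA s -> br r s = [::].
Proof.
case: r => [x y|//|//|//] /andP [hx hy]; case: s => [i j|//|//|//] /andP [hi hj] /=.
rewrite [y == i]eqtype.eq_sym (negbTE (ab_neq hi hy)).
by rewrite [j == x]eqtype.eq_sym (negbTE (ab_neq hx hj)).
Qed.

Definition vA (X : nat -> nat -> F) (r : proot) : F :=
  if r is PM x y then X (ia x) (ib y) else 0.

Section InvariantA.
Variable T : ncpoly F.
Hypothesis qT : nletters QA T.
Hypothesis iT : inv T.
Let f X := ev idfun (vA X) T.

Lemma ev_readA X w :
  (forall i j, (i < p)%N -> (j < m)%N -> w (PM (a i) (b j)) = X i j) ->
  ev idfun w T = f X.
Proof.
move=> h; apply: (eq_ev idfun qT); case=> [x y|//|//|//] /andP [/mapiP [i hi ->] /mapiP [j hj ->]] /=.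
by rewrite iaE // ibE // h.
Qed.
Lemma fA_loc X Y : (forall i j, (i < p)%N -> (j < m)%N -> X i j = Y i j) -> f X = f Y.
Proof.
by move=> h; apply: ev_readA => i j hi hj; rewrite /= iaE // ibE // h.
Qed.
Lemma fA_lin : line_polynomial f.
Proof.
move=> X H; exists (ev polyC (fun r => (vA X r)%:P + (vA H r)%:P * 'X) T) => s.
rewrite horner_ev; congr (ev _ _ T); apply: funext => r.
rewrite hornerD hornerM !hornerC hornerX.
by case: r => [i j|i j|i|i] /=; rewrite /line; ring.
Qed.

Lemma a_eq i j : (i < p)%N -> (j < p)%N -> (a i == a j) = (i == j).
Proof. by move=> hi hj; apply/eqP/eqP => [/(decseq_inj so ta.1 hi hj)|->]. Qed.
Lemma b_eq i j : (i < m)%N -> (j < m)%N -> (b i == b j) = (i == j).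
Proof. by move=> hi hj; apply/eqP/eqP => [/(decseq_inj (so_rev so) tb.1 hi hj)|->]. Qed.
Lemma ab_eq i j : (i < p)%N -> (j < m)%N -> (a i == b j) = false.
Proof. by move=> hi hj; apply/negbTE/(so_neq so)/ab_gt. Qed.

Lemma fA_row1 X q l u : (q < l < p)%N -> f (rowop q (fun i => if i == l then u else 0) X) = f X.
Proof.
move=> /andP [ql lp]; have qp := ltn_trans ql lp.
have g : gt (a q) (a l) by apply: ta.1; rewrite ql.
rewrite -[RHS](@ev_flowA T (a q) (a l) (vA X) u) //; last by apply: nletters_sub QA_valid qT.
apply/esym/ev_readA => i j hi hj; rewrite flowA_at coad_PM /= !iaE // !ibE //.
rewrite a_eq // [b j == _]eqtype.eq_sym ab_eq // mul0r subr0 /rowop [l == i]eqtype.eq_sym.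
by case: eqP => _; rewrite ?mul1r ?mul0r // mulrC.
Qed.
(** [b] counts from the bottom, so the positive root is $\vartheta_{b_l}-\vartheta_{b_q}$ for
    [q < l]. The parameter [- u] compensates the sign of the second term in [coad_PM]. *)
Lemma fA_col1 X q l u : (q < l < m)%N -> f (colop q (fun i => if i == l then u else 0) X) = f X.
Proof.
move=> /andP [ql lm]; have qm := ltn_trans ql lm.
have g : gt (b l) (b q) by apply: tb.1; rewrite ql.
rewrite -[RHS](@ev_flowA T (b l) (b q) (vA X) (- u)) //; last by apply: nletters_sub QA_valid qT.
apply/esym/ev_readA => i j hi hj; rewrite flowA_at coad_PM /= !iaE // !ibE //.
rewrite b_eq // [b q == _]eqtype.eq_sym ab_eq // mul0r sub0r /colop.
by case: eqP => _; rewrite ?mul1r ?mul0r ?oppr0 ?mul0r // mulrNN mulrC.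
Qed.

Lemma fA_row q c X : (forall i, c i != 0 -> (q < i < p)%N) -> f (rowop q c X) = f X.
Proof.
move=> hc; pose cm k i := if (i < k)%N then c i else 0.
have step k : f (rowop q (cm k) X) = f X.
  elim: k => [|k IH].
    by congr f; apply: funext => i; apply: funext => j; rewrite /rowop /cm ltn0 mul0r addr0.
  have [c0|c0] := eqVneq (c k) 0.
    rewrite -IH; congr (f (rowop q _ X)); apply: funext => i; rewrite /cm ltnS leq_eqVlt.
    by case: (i =P k) => [->|//] /=; rewrite ltnn c0.
  have /andP [qk kp] := hc _ c0.
  have cq : c q = 0 by apply/eqP; apply: contraT => /hc; rewrite ltnn.
  rewrite -IH -(@fA_row1 (rowop q (cm k) X) q k (c k)) ?qk //.
  congr f; apply: funext => i; apply: funext => j; rewrite /rowop.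
  have -> : cm k q = 0 by rewrite /cm qk.
  have -> : cm k.+1 i = cm k i + (if i == k then c k else 0).
    rewrite /cm ltnS leq_eqVlt; case: (i =P k) => [->|_] /=; last by rewrite addr0.
    by rewrite ltnn add0r.
  move: (cm k i) => x1.
  by move: (if i == k then c k else 0) => x3; ring.
rewrite -(step p); congr (f (rowop q _ X)); apply: funext => i; rewrite /cm.
by case: ifP => // /negbT; rewrite -leqNgt => le; apply/eqP; apply: contraT => /hc; lia.
Qed.
Lemma fA_col q c X : (forall i, c i != 0 -> (q < i < m)%N) -> f (colop q c X) = f X.
Proof.
move=> hc; pose cm k i := if (i < k)%N then c i else 0.
have step k : f (colop q (cm k) X) = f X.
  elim: k => [|k IH].
    by congr f; apply: funext => i; apply: funext => j; rewrite /colop /cm ltn0 mul0r addr0.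
  have [c0|c0] := eqVneq (c k) 0.
    rewrite -IH; congr (f (colop q _ X)); apply: funext => i; rewrite /cm ltnS leq_eqVlt.
    by case: (i =P k) => [->|//] /=; rewrite ltnn c0.
  have /andP [qk kp] := hc _ c0.
  have cq : c q = 0 by apply/eqP; apply: contraT => /hc; rewrite ltnn.
  rewrite -IH -(@fA_col1 (colop q (cm k) X) q k (c k)) ?qk //.
  congr f; apply: funext => i; apply: funext => j; rewrite /colop.
  have -> : cm k q = 0 by rewrite /cm qk.
  have -> : cm k.+1 j = cm k j + (if j == k then c k else 0).
    rewrite /cm ltnS leq_eqVlt; case: (j =P k) => [->|_] /=; last by rewrite addr0.
    by rewrite ltnn add0r.
  move: (cm k j) => x1.
  by move: (if j == k then c k else 0) => x3; ring.
rewrite -(step m); congr (f (colop q _ X)); apply: funext => i; rewrite /cm.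
by case: ifP => // /negbT; rewrite -leqNgt => le; apply/eqP; apply: contraT => /hc; lia.
Qed.
End InvariantA.

Definition KA := minn p m.

Section GeneratorA.
Variables (q : nat) (w : nat -> nat).
Hypothesis qK : (q <= KA)%N.
Hypothesis wa : forall r, (r < q)%N -> w r = a r.
(** In the decreasing listing of $\mathcal N_q$ the lower half is [b] read backwards; this is the
    column reversal in [rdet]. *)
Hypothesis wb : forall s, (s < q)%N -> w (q + s)%N = b (q.-1 - s)%N.

Lemma lt_pm i : (i < q)%N -> (i < p)%N /\ (i < m)%N.
Proof. by move: qK; rewrite /KA; lia. Qed.

Lemma gen_valueA (A : comNzRingType) (iota : {rmorphism F -> A}) v :
  evt iota v (Delta_A F q w) = rdet q (fun i j => v (PM (a i) (b j))).
Proof.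
rewrite /Delta_A /tdet evt_tsum big_map big_enum /rdet /determinant.
apply: eq_big => [s|s _]; first by rewrite inE.
rewrite evt_scale rmorph_sign evt_tprod big_map big_enum; congr (_ * _).
apply: eq_bigr => r _; rewrite mxE; move: (s r) => c.
have hc := ltn_ord c; have hr := ltn_ord r.
rewrite wa // wb // evt_g //=; apply: ab_gt; first by case: (lt_pm hr).
have h : (q.-1 - c < q)%N by lia.
by case: (lt_pm h).
Qed.

Lemma lett_A (Q : pred proot) : (forall i j, (i < q)%N -> (j < q)%N -> Q (PM (a i) (b j))) ->
  lett t prec Q (Delta_A F q w).
Proof.
move=> h; apply: lett_tsum => z1 hz1; have [s ->] := In_map hz1; apply: lett_scale.
apply: lett_tprod => z2 hz2; have [r ->] := In_map hz2; move: (s r) => c.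
have hc := ltn_ord c; have hr := ltn_ord r.
rewrite wa // wb // /lett /=; case: ifP => //= _; rewrite h //; lia.
Qed.

(** $f_{\vartheta_x-\vartheta_y}$ acts on the minor by a row operation if [y] indexes a row, by a
    column operation if [x] indexes a column, and by zero otherwise. In the first two cases the
    other index belongs to the same segment and precedes. *)
Lemma inv_A : inv (expand (Delta_A F q w)).
Proof.
move=> r v /validA [x [y [-> g]]]; set T := expand _.
pose Qq s := if s is PM i j then (i \in [seq a i | i <- iota 0 q]) && (j \in [seq b i | i <- iota 0 q]) else false.
have mq (c : nat -> nat) i : (i < q)%N -> c i \in [seq c i | i <- iota 0 q].
  by move=> h; apply: map_f; rewrite mem_iota.
have qT : nletters Qq T by apply: lett_A => i j hi hj; rewrite /Qq !mq.
have main : (ev polyC (flowA x y v) T = ev polyC (fun s => (v s)%:P) T) ->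
    der v (coad (PM x y) v) T = 0.
  move=> e; rewrite (@der_flow _ v (coad (PM x y) v) T (flowA x y v)).
  - rewrite e deriv_ev -[RHS](der0 v T); congr (der _ _ T); apply: funext => s.
      by rewrite hornerC.
    by rewrite derivC hornerC.
  - by move=> s; rewrite flowA_at mulr0 addr0.
  - by move=> s; rewrite flowA_deriv.
have [hy|ny] := boolP (y \in [seq a i | i <- iota 0 q]).
  case/mapiP: hy => l hl ey; have [hlp hlm] := lt_pm hl.
  have [i lil ex] : exists2 i, (i < l)%N & a i = x by apply: ta.2 => //; rewrite -ey.
  have hip := ltn_trans lil hlp.
  apply: main.
  rewrite -!/(evt _ _ _) !gen_valueA -[RHS](@rdet_rowop _ q i (fun k => if k == l then 'X else 0)).
    apply: eq_rdet => k k' hk hk'; have [hkp hkm] := lt_pm hk; have [hk'p hk'm] := lt_pm hk'.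
    rewrite /flowA coad_PM /rowopA -ex ey a_eq // [b k' == _]eqtype.eq_sym ab_eq // mul0r subr0.
    rewrite [l == k]eqtype.eq_sym; case: eqP => _; rewrite ?mul1r ?mul0r // mulrC //.
  by move=> k le; case: eqP => // e; move: lil le; rewrite e; lia.
have [hx|nx] := boolP (x \in [seq b i | i <- iota 0 q]).
  case/mapiP: hx => l hl ex; have [hlp hlm] := lt_pm hl.
  have [i lil ey] : exists2 i, (i < l)%N & b i = y by apply: tb.2 => //; rewrite -ex.
  have him := ltn_trans lil hlm.
  apply: main.
  rewrite -!/(evt _ _ _) !gen_valueA -[RHS](@rdet_colop _ q i (fun k => if k == l then - 'X else 0)).
    apply: eq_rdet => k k' hk hk'; have [hkp hkm] := lt_pm hk; have [hk'p hk'm] := lt_pm hk'.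
    rewrite /flowA coad_PM /colopA -ey ex b_eq // [b i == _]eqtype.eq_sym ab_eq // mul0r sub0r.
    case: eqP => _; rewrite ?mul1r ?mul0r ?oppr0 ?mul0r // polyCN mulNr mulrC mulNr //.
  by move=> k le; case: eqP => // e; move: lil le; rewrite e; lia.
rewrite -[RHS](der0 v T); apply: (eq_der qT) => // s.
case: s => [i j|//|//|//] /andP [hi hj]; rewrite coad_PM.
have -> : (y == i) = false by apply/negbTE; apply: contraNneq ny => ->.
have -> : (j == x) = false by apply/negbTE; apply: contraNneq nx => <-.
by rewrite !mul0r subr0.
Qed.
End GeneratorA.

Definition kapA (r : proot) : F :=
  if r is PM x y then if [&& x \in al, y \in bl & ia x == ib y] then 1 else 0 else 0.
Definition lamA (r : proot) : nat := if r is PM x y then ia x else 0%N.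

Lemma svA d r : QA r -> kapA r * d (lamA r) = vA (diagm d) r.
Proof.
case: r => [x y|//|//|//] /andP [hx hy] /=; rewrite hx hy /= /diagm.
by case: eqP => _; rewrite ?mul1r ?mul0r.
Qed.
Lemma lamA_lt r : kapA r != 0 -> (lamA r < KA)%N.
Proof.
case: r => [x y|x y|x|x] /=; rewrite ?eqxx //; case: ifP; rewrite ?eqxx // => /and3P [hx hy /eqP e] _.
have h1 : (ia x < p)%N by rewrite /ia -[X in (_ < X)%N](size_iota 0 p) -(size_map a) index_mem.
have h2 : (ib y < m)%N by rewrite /ib -[X in (_ < X)%N](size_iota 0 m) -(size_map b) index_mem.
by rewrite /KA; move: e h1 h2; lia.
Qed.

Variable G : nat -> term F.
Hypothesis HG : forall i, (i < KA)%N -> exists w, [/\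
  (forall r, (r < i.+1)%N -> w r = a r),
  (forall s, (s < i.+1)%N -> w (i.+1 + s)%N = b (i.+1.-1 - s)%N) &
  G i.+1 = Delta_A F i.+1 w].

Lemma A_data : exists c, slice_data t prec G KA QA kapA lamA c.
Proof.
have sl T d : nletters QA T -> ev idfun (fun r => kapA r * d (lamA r)) T = ev idfun (vA (diagm d)) T.
  by move=> qT; apply: (eq_ev idfun qT) => r qr; apply: svA.
have mqa i : (i < p)%N -> a i \in al by move=> h; apply: map_f; rewrite mem_iota.
have mqb i : (i < m)%N -> b i \in bl by move=> h; apply: map_f; rewrite mem_iota.
exists (fun i => (-1) ^+ rev_perm i.+1); split.
- exact: QA_valid.
- exact: QA_comm.
- exact: QA_ad.
- exact: lamA_lt.
- move=> i lt; have [w [wa wb ->]] := HG lt; apply: (lett_A lt wa wb) => k l hk hl.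
  have [h1 _] := lt_pm lt hk; have [_ h2] := lt_pm lt hl.
  by rewrite /QA mqa // mqb.
- by move=> i lt; have [w [wa wb ->]] := HG lt; apply: (inv_A lt wa wb).
- by move=> i; rewrite signr_eq0.
- move=> i d lt; have [w [wa wb ->]] := HG lt; rewrite (gen_valueA lt wa wb) -rdet_diag.
  apply: eq_rdet => k l hk hl; have [h1 _] := lt_pm lt hk; have [_ h2] := lt_pm lt hl.
  by rewrite svA /=; [rewrite iaE // ibE|rewrite mqa // mqb].
- move=> T qT iT h0 v; rewrite (@ev_readA T qT (fun i j => v (PM (a i) (b j)))) //.
  apply: (@rect_zero F p m (fun X => ev idfun (vA X) T)).
  + exact: fA_loc.
  + by move=> *; apply: fA_row.
  + by move=> *; apply: fA_col.
  + exact: fA_lin.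
  + by move=> d; rewrite -sl.
- move=> T qT iT q d lt d0.
  have [||||pol hpol] := @rect_dominant F p m (fun X => ev idfun (vA X) T) _ _ _ _ q d lt d0.
  + exact: fA_loc.
  + by move=> *; apply: fA_row.
  + by move=> *; apply: fA_col.
  + exact: fA_lin.
  by exists pol => s s0; rewrite sl // hpol.
Qed.

Variable M : seq nat.
Hypothesis aM : forall x, x \in M -> (forall r, (r < p)%N -> a r <> x) ->
  exists2 k, k \notin M & gt k x.
Hypothesis bM : forall x, x \in M -> (forall r, (r < m)%N -> b r <> x) ->
  exists2 k, k \notin M & gt x k.

(** If [i] is outside the top segment, take a fresh [k] above it:
    $[f_{\vartheta_k-\vartheta_i},f_{\vartheta_i-\vartheta_j}]=f_{\vartheta_k-\vartheta_j}$. If [j]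
    is outside the bottom segment, take a fresh [k] below it:
    $[f_{\vartheta_j-\vartheta_k},f_{\vartheta_i-\vartheta_j}]=-f_{\vartheta_i-\vartheta_k}$. *)
Lemma A_red T : nletters (inL t prec M) T -> inv T ->
  forall v, ev idfun v T = ev idfun v [seq e <- T | all QA e.2].
Proof.
move=> lT iT; apply: (kill_reduce (L := inL t prec M)) => // s ls nq.
have notL k r : k \notin M -> k \in supp r -> ~~ inL t prec M r.
  by move=> kM kr; rewrite /inL; apply/nandP; right; apply/allPn; exists k.
have [i [j [es g]]] := validA (andP ls).1; rewrite {}es in ls nq *.
have mem x y : inL t prec M (PM x y) -> x \in M /\ y \in M.
  by case/andP => _ /= /and3P [].
have [iM jM] := mem _ _ ls.
have ne k x : k \notin M -> x \in M -> (x == k) = false.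
  by move=> kM xM; apply/negbTE; apply: contraNneq kM => <-.
move: nq; rewrite /QA negb_and => /orP [ni|nj].
  have [|k kM gk] := aM iM.
    by move=> r hr e; case/negP: ni; rewrite -e; apply: map_f; rewrite mem_iota.
  apply: (@kill _ _ _ M T (PM k i) (PM i j) (PM k j) 1 lT iT gk ls); rewrite ?oner_eq0 //.
    by rewrite /= eqxx ne.
  move=> s' e ls'; have [i' [j' [es' g']]] := validA (andP ls').1; rewrite {}es' in ls' *.
  have [i'M j'M] := mem _ _ ls'; rewrite /= (ne k j') // cats0; case: eqP => // ei.
  rewrite inE => /eqP -> /=; split; first by apply: (notL k) => //; rewrite inE eqxx.
  by case=> ->; rewrite ei.
have [|k kM gk] := bM jM.
  by move=> r hr e; case/negP: nj; rewrite -e; apply: map_f; rewrite mem_iota.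
apply: (@kill _ _ _ M T (PM j k) (PM i j) (PM i k) (-1) lT iT gk ls); rewrite ?oppr_eq0 ?oner_eq0 //.
  by rewrite /= eqxx eqtype.eq_sym ne.
move=> s' e ls'; have [i' [j' [es' g']]] := validA (andP ls').1; rewrite {}es' in ls' *.
have [i'M j'M] := mem _ _ ls'; rewrite /= [k == i']eqtype.eq_sym (ne k i') //=; case: eqP => // ej.
rewrite inE => /eqP -> /=; split; first by apply: (notL k) => //; rewrite !inE eqxx orbT.
by case=> ->; rewrite ej.
Qed.
End TypeA.

(** * Assembly of the four types *)

Section Final.
Variables (F : numClosedFieldType) (t : ctype) (prec : rel sel).
Local Notation gt := (gtth t prec).
Local Notation lt' := (fun i j => gt j i).
Hypothesis so : strict_order gt.
Variable G : nat -> term F.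

(** Slice data are supplied twice: for every [k] within the cascade, which gives centrality and
    independence, and for every finite index set [M] together with the reduction to [Q], which gives
    generation. There [M] is the support of the given central element. *)
Lemma center_of_data :
  (forall k, cascade_ge t prec k ->
     exists Q kap lam c, slice_data t prec G k Q kap lam c) ->
  (forall M, exists k Q kap lam c, [/\ cascade_ge t prec k,
     slice_data t prec G k Q kap lam c, {subset Q <= inL t prec M} &
     forall T : ncpoly F, nletters (inL t prec M) T -> inv t prec T ->
       forall v, ev idfun v T = ev idfun v [seq e <- T | all Q e.2]]) ->
  (forall q, (0 < q)%N -> cascade_ge t prec q -> central t prec (G q)) /\
  (forall z, central t prec z ->
     exists k, cascade_ge t prec k /\
       exists p : {mpoly F[k]}, equ t prec z (ueval p (fun j : 'I_k => G j.+1))) /\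
  (forall (k : nat) (p : {mpoly F[k]}), cascade_ge t prec k ->
     equ t prec (ueval p (fun j : 'I_k => G j.+1)) (Tc 0) -> p = 0).
Proof.
move=> h1 h2; split; [|split].
- case=> [//|q] _ hq; have [Q [kap [lam [c sd]]]] := h1 _ hq.
  by apply: (central_generator so sd).
- move=> z cz; pose T := expand t prec z.
  pose M := flatten [seq supp r | r <- flatten [seq e.2 | e <- T]].
  have [k [Q [kap [lam [c [hk sd QL red]]]]]] := h2 M; exists k; split=> //.
  have vT : nletters (valid t prec) T by apply: expand_valid.
  have lT : nletters (inL t prec M) T.
    apply/allP => e he; apply/allP => r hr; apply/andP; split.
      exact: (allP (allP vT _ he)).
    apply/allP => x hx; apply/flattenP; exists (supp r) => //; apply: map_f.
    by apply/flattenP; exists e.2 => //; apply: map_f.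
  have [|||p hp] := @central_polynomial F t prec so G k Q kap lam c sd (inL t prec M) _
     (@inL_closed F t prec so M) red (\max_(e <- T) size e.2).+1 T lT.
  + by move=> r /andP [].
  + apply/allP => e he; rewrite ltnS.
    exact: (leq_bigmax_seq (P := xpredT) (F := fun e => size e.2) _ he isT).
  + by move/centralP: cz => cz x; rewrite toU_expand; apply: cz.
  by exists p; apply: cl_equ; rewrite -hp toU_expand.
- move=> k p hk /clE p0; have [Q [kap [lam [c sd]]]] := h1 _ hk.
  exact: (generators_independent so sd).
Qed.

Hypothesis HG : forall q, (0 < q)%N -> cascade_ge t prec q -> is_generator t prec q (G q).

Section BCDCase.
Hypothesis nA : ~~ ctype_eqb t TA.

(** A finite set has only one decreasing listing, so the one hidden in [is_generator] coincides in
    range with the segment [a]. *)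
Lemma bcd_HG n a : topseq gt n a -> forall i, (i < K t n)%N -> exists b,
  [/\ topseq gt (i.+1 * rate t) b, (forall j, (j < i.+1 * rate t)%N -> b j = a j) &
      G i.+1 = Gterm F t prec i.+1 b].
Proof.
move=> ta i lt; have le := K_rate nA lt.
have [b hb] := HG (ltn0Sn i) (top_cascade so nA ta le).
have [[db sb] eG] : dec_listing t prec (i.+1 * rate t) (Nset t prec i.+1) b /\
    G i.+1 = Gterm F t prec i.+1 b.
  by move: hb nA; rewrite /rate /Gterm; case: (t) => //= hb _; rewrite ?muln1 ?muln2.
have ta' := topseq_le le ta.
have eb j : (j < i.+1 * rate t)%N -> b j = a j.
  apply: (decseq_unique so db ta'.1) => x; rewrite -sb; exact: (Nset_top so nA ta le).
exists b; split=> //; split=> // r x hr; rewrite eb // => g.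
have [r' lr e] := ta'.2 r x hr g; exists r' => //.
by rewrite eb // (ltn_trans lr).
Qed.

Lemma K_of k : K t (k * rate t) = k.
Proof. by rewrite /K /rate; case: (ctype_eqb t TC); rewrite ?muln1 ?muln2 ?doubleK. Qed.

Lemma bcd_case1 k : cascade_ge t prec k ->
  exists Q kap lam c, slice_data t prec G k Q kap lam c.
Proof.
move=> hk; have [a ta] := cascade_top so nA hk.
have [c sd] := bcd_data so nA ta (bcd_HG ta); rewrite K_of in sd.
by do 4!eexists; exact: sd.
Qed.

Lemma bcd_case2 M : exists k Q kap lam c, [/\ cascade_ge t prec k,
     slice_data t prec G k Q kap lam c, {subset Q <= inL t prec M} &
     forall T : ncpoly F, nletters (inL t prec M) T -> inv t prec T ->
       forall v, ev idfun v T = ev idfun v [seq e <- T | all Q e.2]].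
Proof.
have [n [a [ta aM hM]]] := topseq_of so M.
have [c sd] := bcd_data so nA ta (bcd_HG ta).
exists (K t n), (Qn t prec n a); do 3!eexists; split; [|exact: sd| |].
- exact: (top_cascade so nA ta (K_rate nA (leqnn _))).
- move=> r qr; apply/andP; split; first exact: (sd_valid sd qr).
  case/andP: qr => _ /allP h; apply/allP => x hx.
  have /mapP [l] : x \in [seq a i | i <- iota 0 n] := h x hx.
  by rewrite mem_iota add0n => hl ->; apply: aM.
- by move=> T lT iT v; apply: (bcd_red so nA lT iT hM).
Qed.
End BCDCase.

Section ACase.
Hypothesis tA : ctype_eqb t TA.

Lemma A_HG p m a b : topseq gt p a -> topseq lt' m b -> forall i, (i < KA p m)%N -> exists w,
  [/\ (forall r, (r < i.+1)%N -> w r = a r),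
  (forall s, (s < i.+1)%N -> w (i.+1 + s)%N = b (i.+1.-1 - s)%N) &
  G i.+1 = Delta_A F i.+1 w].
Proof.
move=> ta tb i lt; set q := i.+1.
have ta' : topseq gt q a by apply: topseq_le ta; move: lt; rewrite /KA /q; lia.
have tb' : topseq lt' q b by apply: topseq_le tb; move: lt; rewrite /KA /q; lia.
have [w hw] := HG (ltn0Sn i) (topA_cascade so tA ta' tb' (leqnn q)).
have [[dw sw] eG] : dec_listing t prec q.*2 (Nset t prec q) w /\ G q = Delta_A F q w.
  by move: hw tA; case: (t).
(* The decreasing listing of both segments: [a] from the top, then [b] backwards, because [b] starts
   at the minimal element. *)
pose u r := if (r < q)%N then a r else b (q.*2.-1 - r)%N.
have du : decseq gt q.*2 u.
  move=> r s /andP [rs s2]; rewrite /u; case: ifP => hr; case: ifP => hs.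
  - by apply: ta'.1; rewrite rs.
  - by apply: (top_bot_disjoint so ta' tb') => //; lia.
  - by exfalso; lia.
  - by apply: tb'.1; lia.
have wu : forall r, (r < q.*2)%N -> w r = u r.
  apply: (decseq_unique so dw du) => x; rewrite -sw (NsetA so tA ta' tb' (leqnn q)).
  split=> [[[r hr <-]|[r hr <-]]|[r hr <-]].
  - by exists r; [lia|rewrite /u hr].
  - exists (q.*2.-1 - r)%N; first by lia.
    rewrite /u (_ : (_ < q)%N = false); last by lia.
    by congr b; lia.
  - rewrite /u; case: ifP => h; [by left; exists r|right].
    by exists (q.*2.-1 - r)%N => //; lia.
exists w; split=> // [r hr|s hs].
  by rewrite wu; [rewrite /u hr|lia].
rewrite wu; last by lia.
rewrite /u (_ : (_ < q)%N = false); last by lia.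
by congr b; lia.
Qed.

Lemma A_case1 k : cascade_ge t prec k ->
  exists Q kap lam c, slice_data t prec G k Q kap lam c.
Proof.
move=> hk; have [a [b [ta tb]]] := cascade_topA so tA hk.
have [c sd] := A_data so tA ta tb (A_HG ta tb); rewrite /KA minnn in sd.
by do 4!eexists; exact: sd.
Qed.

Lemma A_case2 M : exists k Q kap lam c, [/\ cascade_ge t prec k,
     slice_data t prec G k Q kap lam c, {subset Q <= inL t prec M} &
     forall T : ncpoly F, nletters (inL t prec M) T -> inv t prec T ->
       forall v, ev idfun v T = ev idfun v [seq e <- T | all Q e.2]].
Proof.
have [p [a [ta aM hM]]] := topseq_of so M.
have [m [b [tb bM hM']]] := topseq_of (so_rev so) M.
have [c sd] := A_data so tA ta tb (A_HG ta tb).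
exists (KA p m), (QA p m a b); do 3!eexists; split; [|exact: sd| |].
- have ta' : topseq gt (KA p m) a by apply: topseq_le ta; rewrite /KA geq_minl.
  have tb' : topseq lt' (KA p m) b by apply: topseq_le tb; rewrite /KA geq_minr.
  exact: (topA_cascade so tA ta' tb' (leqnn _)).
- move=> r qr; apply/andP; split; first exact: (sd_valid sd qr).
  case: r qr => [x y|//|//|//] /andP [/mapP [i hi ->] /mapP [j hj ->]] /=.
  by rewrite mem_iota in hi; rewrite mem_iota in hj; rewrite aM // bM.
- by move=> T lT iT v; apply: A_red; eassumption.
Qed.
End ACase.

Lemma center_structure :
  (forall q, (0 < q)%N -> cascade_ge t prec q -> central t prec (G q)) /\
  (forall z, central t prec z ->
     exists k, cascade_ge t prec k /\
       exists p : {mpoly F[k]}, equ t prec z (ueval p (fun j : 'I_k => G j.+1))) /\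
  (forall (k : nat) (p : {mpoly F[k]}), cascade_ge t prec k ->
     equ t prec (ueval p (fun j : 'I_k => G j.+1)) (Tc 0) -> p = 0).
Proof.
have [tA|nA] := boolP (ctype_eqb t TA).
  by apply: center_of_data; [exact: A_case1|exact: A_case2].
by apply: center_of_data; [exact: bcd_case1|exact: bcd_case2].
Qed.
End Final.

Theorem theorem2p6 (R : realType) (t : ctype) (prec : rel sel)
  (Hadm : admissible t prec) (G : nat -> term R[i])
  (HG : forall q, (0 < q)%N -> cascade_ge t prec q ->
          is_generator t prec q (G q)) :
  (forall q, (0 < q)%N -> cascade_ge t prec q -> central t prec (G q)) /\
  (forall z, central t prec z ->
     exists k, cascade_ge t prec k /\
       exists p : {mpoly R[i][k]},
         equ t prec z (ueval p (fun j : 'I_k => G j.+1))) /\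
  (forall (k : nat) (p : {mpoly R[i][k]}), cascade_ge t prec k ->
     equ t prec (ueval p (fun j : 'I_k => G j.+1)) (Tc 0) -> p = 0).
Proof.
exact: (center_structure (admissible_strict_order Hadm) HG).
Qed.
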